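(* Let $T>0$, $s>3/2$ and $2\le p\le\infty$. Let $u\in C([0,T],H^s(\mathbb{R}))$ be a strong solution of the Cauchy problem for the Camassa--Holm equation \[ \partial_t u+u\partial_x u=P(D)\Bigl(u^2+\tfrac12(\partial_x u)^2\Bigr),\qquad P(D)=-\partial_x(1-\partial_x^2)^{-1}, \] with $u|_{t=0}=u_0$, and suppose that $u_0\phi\in L^p(\mathbb{R})$ and $(\partial_x u_0)\phi\in L^p(\mathbb{R})$, where $\phi$ is an admissible weight function for the Camassa--Holm equation (defined in the context). Then for all $t\in[0,T]$, \[ \|u(t)\phi\|_p+\|\partial_x u(t)\phi\|_p\le\Bigl(\|u_0\phi\|_p+\|\partial_x u_0\phi\|_p\Bigr)e^{CMt}, \] where $C>0$ depends only on $v$ and $\phi$ (through the constants $A$, $C_0$, $\inf_{\mathbb{R}}v$ and $\int_{\mathbb{R}}v(x)e^{-|x|}\,dx$), and \[ M=\sup_{t\in[0,T]}\bigl(\|u(t)\|_\infty+\|\partial_x u(t)\|_\infty\bigr)<\infty. \]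
   Context: A weight $v:\mathbb{R}\to\mathbb{R}$ (nonnegative, continuous) is sub-multiplicative if $v(x+y)\le v(x)v(y)$ for all $x,y$. Given a sub-multiplicative $v$, a positive continuous function $\phi$ is $v$-moderate if there is $C_0>0$ with $\phi(x+y)\le C_0\,v(x)\phi(y)$ for all $x,y\in\mathbb{R}$. An admissible weight function for the Camassa--Holm equation is a locally absolutely continuous function $\phi:\mathbb{R}\to\mathbb{R}$ such that for some $A>0$, $|\phi'(x)|\le A|\phi(x)|$ for a.e. $x$, and which is $v$-moderate for some sub-multiplicative weight $v$ with $\inf_{\mathbb{R}}v>0$ and $\int_{\mathbb{R}}v(x)e^{-|x|}\,dx<\infty$. Equivalently to the equation above, with $G(x)=\tfrac12 e^{-|x|}$ and $F(u)=u^2+\tfrac12(\partial_xu)^2$, strong solutions satisfy $\partial_t u+u\partial_xu+\partial_xG*F(u)=0$. $\|\cdot\|_p$ denotes the $L^p(\mathbb{R})$ norm. *)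

(* Defs.v *)
From HB Require Import structures.
From mathcomp Require Import all_boot all_order all_algebra.
From mathcomp Require Import all_classical all_reals all_analysis.
Set Implicit Arguments. Unset Strict Implicit. Unset Printing Implicit Defensive.
Import Order.TTheory GRing.Theory Num.Theory.
Import numFieldNormedType.Exports.
Local Open Scope classical_set_scope.
Local Open Scope ring_scope.

Section CH_defs.
Context {R : realType}.
Local Notation mu := (@lebesgue_measure R).

Definition Lp_norm (p : \bar R) (f : R -> R) : \bar R :=
  Lnorm mu p (fun x => (f x)%:E).

Definition L2sq (f : R -> R) : \bar R := (\int[mu]_x ((f x) ^+ 2)%:E)%E.

Definition in_L2 (f : R -> R) : Prop :=
  measurable_fun [set: measurableTypeR R] f /\ (L2sq f < +oo)%E.

Definition test_fun (psi : R -> R) : Prop :=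
  (forall x, derivable psi x 1) /\ continuous (derive1 psi) /\
  exists K : R, forall x, K < `|x| -> psi x = 0.

Definition weak_deriv (f g : R -> R) : Prop :=
  forall psi, test_fun psi ->
    (\int[mu]_x (f x * derive1 psi x)%:E = - \int[mu]_x (g x * psi x)%:E)%E.

Definition gagliardo (sigma : R) (h : R -> R) : \bar R :=
  (\int[mu]_x \int[mu]_y
     ((`|h x - h y| ^+ 2 / (`|x - y| `^ (1 + 2 * sigma)))%:E))%E.

(* s = k + sigma (k integer part, 0 <= sigma < 1); g j is the j-th weak
   derivative of f (j <= k), all in L^2, and g k has finite Gagliardo
   seminorm of order sigma when sigma > 0.  This is f \in H^s(R). *)
Definition sob_data (k : nat) (sigma : R) (f : R -> R) (g : nat -> R -> R)
  : Prop :=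
  g 0%N = f /\
  (forall j : nat, (j < k)%N -> weak_deriv (g j) (g j.+1)) /\
  (forall j : nat, (j <= k)%N -> in_L2 (g j)) /\
  (0 < sigma -> (gagliardo sigma (g k) < +oo)%E).

Definition Hs_sq (k : nat) (sigma : R) (g : nat -> R -> R) : \bar R :=
  (\sum_(0 <= j < k.+1) L2sq (g j) +
   (if (0 < sigma)%R then gagliardo sigma (g k) else 0))%E.

Definition C_Hs (T s : R) (u : R -> R -> R) : Prop :=
  exists (k : nat) (sigma : R), s = k%:R + sigma /\ 0 <= sigma < 1 /\
  exists g : R -> nat -> R -> R,
    (forall t, 0 <= t <= T -> sob_data k sigma (u t) (g t)) /\
    (forall t0, 0 <= t0 <= T -> forall eps : R, 0 < eps ->
       exists2 delta : R, 0 < delta & forall t, 0 <= t <= T ->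
         `|t - t0| < delta ->
         (Hs_sq k sigma (fun j x => (g t j x - g t0 j x)%R) < eps%:E)%E).

Definition Gker (x : R) : R := 2^-1 * expR (- `|x|).
Definition conv (G f : R -> R) (x : R) : R :=
  fine (\int[mu]_y (G (x - y) * f y)%:E)%E.

Definition F_CH (w : R -> R) (x : R) : R := w x ^+ 2 + 2^-1 * (derive1 w x) ^+ 2.

(* strong solution of  u_t + u u_x + d_x G*F(u) = 0 ,  u(0) = u0,
   u \in C([0,T], H^s); u t is the continuous (C^1) representative. *)
Definition CH_strong_solution (T s : R) (u0 : R -> R) (u : R -> R -> R)
  : Prop :=
  C_Hs T s u /\ u 0 = u0 /\
  (forall t, 0 <= t <= T -> forall x, derivable (u t) x 1) /\
  (forall t, 0 < t < T -> forall x,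
     is_derive t 1 (fun tau => u tau x)
       (- (u t x * derive1 (u t) x + derive1 (conv Gker (F_CH (u t))) x))).

Definition submultiplicative (v : R -> R) : Prop :=
  continuous v /\ (forall x, 0 <= v x) /\
  forall x y, v (x + y) <= v x * v y.

Definition v_moderate (v phi : R -> R) (C0 : R) : Prop :=
  0 < C0 /\ continuous phi /\ (forall x, 0 < phi x) /\
  forall x y, phi (x + y) <= C0 * v x * phi y.

Definition loc_abs_cont (phi : R -> R) : Prop :=
  forall a b : R, a <= b -> forall eps : R, 0 < eps ->
  exists2 delta : R, 0 < delta &
    forall (n : nat) (c d : nat -> R),
      (forall i : nat, (i < n)%N -> a <= c i /\ c i <= d i /\ d i <= b) ->
      (forall i : nat, (i.+1 < n)%N -> d i <= c i.+1) ->
      \sum_(i < n) (d i - c i) < delta ->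
      \sum_(i < n) `|phi (d i) - phi (c i)| < eps.

Definition admissible_CH (phi v : R -> R) (A C0 : R) : Prop :=
  loc_abs_cont phi /\ 0 < A /\
  {ae mu, forall x, derivable phi x 1 /\ `|derive1 phi x| <= A * `|phi x|} /\
  submultiplicative v /\ v_moderate v phi C0 /\
  0 < inf (range v) /\
  (\int[mu]_x (v x * expR (- `|x|))%:E < +oo)%E.

End CH_defs.

(* Main.v *)
(* Idea of the proof.  Replace [phi] by [min(phi, n e^(-|x|/2))], which is still
   log-Lipschitz and moderate with constants independent of [n], and smooth it by
   averaging over a short interval.  For such a weight [w] and real [p], the
   transport structure [f_t = - u f_x + G], an integration by parts and a Schur
   test for the kernel [e^(-|x|) v(x)] bound the growth of [||f w||_p] for [f = u]
   and for the difference quotients [f = (u(x + r) - u(x)) / r].  Time regularity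
   comes from the embedding of H^s, s > 3/2, into C^1.  Since the solution is only
   differentiable in time pointwise, the growth bound takes the form of backward
   Euler steps [y t <= y s + (t - s) (rate)] for [s < t] close to [t], obtained by
   testing with [|f w|^(p-2) f w] at the later time.  A Gronwall argument and
   the limits [r -> 0], then (smoothing) -> 0, [n -> oo], and finally [p -> oo] for
   the sup norm conclude. *)
Require Import Defs.
From HB Require Import structures.
From mathcomp Require Import all_boot all_order all_algebra.
From mathcomp Require Import all_classical all_reals all_analysis.
Import Order.TTheory GRing.Theory Num.Theory.
Import numFieldNormedType.Exports.
Local Open Scope classical_set_scope.
Local Open Scope ring_scope.
From mathcomp Require Import measurable_realfun ring lra.

Set Implicit Arguments.
Unset Strict Implicit.
Unset Printing Implicit Defensive.

(** For [s] near 3/2 the solution is only C^1 in [x], so [u_x] cannot be differentiated along the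
    flow. The energy of a difference quotient can, but its source still contains the norm of [u_x]
    itself; hence a Gronwall lemma that compares a family of approximants with the energy. Testing
    at the later time replaces the derivative of the norm by Hoelder's inequality against one fixed
    test function. The nonlinearity becomes linear through [|F(u)| <= M (|u| + |u_x|)], which is
    where [M] enters the exponent. The envelope [e^(-|x|/2)] makes every integral converge for
    merely bounded [u], yet decays more slowly than the kernel [e^(-|x|)], so that the moderation
    bound [e^(|x|/2)] remains integrable against the kernel. Smoothing is needed because [phi] has a
    derivative only almost everywhere while integration by parts asks for a C^1 weight; it
    multiplies the logarithmic Lipschitz constant by [e^2] at most. The embedding rests on averages
    of the weak derivative against a C^1 bump: between the scales [4^-n] and [4^-(n+1)] they change
    by a geometrically small amount, which bounds [u_x] and makes it continuous at once. *)

Section integrals_on_the_line.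
Context {R : realType}.
Local Notation mu := (@lebesgue_measure R).
Implicit Types (f g h : R -> R) (x y z a b c : R).

(** * Integration on the line: exponentials, shifts and reflections *)

Lemma is_derive1_continuous f x a : is_derive x 1 f a -> {for x, continuous f}.
Proof. by case=> df _; exact/differentiable_continuous/derivable1_diffP. Qed.

Lemma is_derive1E f x a : is_derive x 1 f a -> derive1 f x = a.
Proof. by rewrite derive1E => -[_ ->]. Qed.

Lemma continuous_exp_norm c : continuous (fun x => expR (- (c * `|x|)) : R).
Proof.
move=> x; apply: continuous_comp; last exact: continuous_expR.
apply: continuousN; apply: continuousM; first exact: cst_continuous.
exact: norm_continuous.
Qed.

Lemma integral_exp_norm c : 0 < c ->
  (\int[mu]_x (expR (- (c * `|x|)))%:E = (2 / c)%:E)%E.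
Proof.
move=> c0.
rewrite ge0_symfun_integralT; last 3 first.
- by move=> x; exact: expR_ge0.
- exact: continuous_exp_norm.
- by move=> x; rewrite /= normrN.
rewrite (_ : [set x | (0 <= x)%R] = [set` `[0, +oo[]); last first.
  by apply/seteqP; split => x /=; rewrite in_itv/= andbT.
have dF x : is_derive x 1 (fun y => - c^-1 * expR (- c * y)) (expR (- c * x)).
  apply: is_derive_eq; rewrite /GRing.scale/= !mulr1 mulrCA mulrNN mulVf ?mulr1//.
  by rewrite gt_eqF.
rewrite (@ge0_continuous_FTC2y _ _ (fun x => - c^-1 * expR (- c * x)) _ 0).
- by rewrite mulr0 expR0 sub0e mulr1 EFinN oppeK -EFinM mulrC.
- by move=> x _; exact: expR_ge0.
- exact/continuous_subspaceT/continuous_exp_norm.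
- rewrite -[X in _ --> X](mulr0 (- c^-1)).
  apply: cvgM; first exact: cvg_cst.
  have -> : (fun x => expR (- c * x)) = (fun x => expR (- x)) \o ( *%R c).
    by apply/funext => x /=; rewrite mulNr.
  apply: (@cvg_comp _ _ _ _ _ _ (pinfty_nbhs R)); last exact: cvgr_expR.
  exact: gt0_cvgMry.
- by move=> x _; have [] := dF x.
- by apply: cvg_at_right_filter; exact: is_derive1_continuous (dF 0).
- move=> x; rewrite in_itv/= andbT => x0.
  by rewrite (is_derive1E (dF x)) gtr0_norm// mulNr.
Qed.

(** Lebesgue measure is determined by half-open intervals, and a shift pulls these back to half-open
    intervals of the same length. *)
Lemma lebesgue_measure_shift c (A : set R) : measurable A ->
  pushforward mu ((fun x => x + c) : _ -> measurableTypeR R) A = mu A.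
Proof.
have ms : measurable_fun [set: R] ((fun x => x + c) : R -> measurableTypeR R).
  apply: continuous_measurable_fun => x.
  by apply: continuousD; [exact: cvg_id|exact: cvg_cst].
move=> mA; apply/esym/lebesgue_measure_unique => //= _ [[a b]] _ <-.
rewrite /pushforward (_ : _ @^-1` _ = [set` `]a - c, b - c]]); last first.
  by apply/seteqP; split => x /=; rewrite !in_itv/= ltrBlDr lerBrDr.
rewrite !lebesgue_measure_itv/= !lte_fin ltrD2r; case: ifP => // _.
by rewrite -!EFinB opprB addrA subrK.
Qed.

Lemma ge0_integral_shift c (f : R -> \bar R) : measurable_fun setT f ->
  (forall x, 0 <= f x)%E -> (\int[mu]_x f (x + c)%R = \int[mu]_x f x)%E.
Proof.
move=> mf f0.
have ms : measurable_fun [set: R] ((fun x => x + c) : R -> measurableTypeR R).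
  apply: continuous_measurable_fun => x.
  by apply: continuousD; [exact: cvg_id|exact: cvg_cst].
transitivity (\int[pushforward mu ((fun x => x + c)%R : _ -> measurableTypeR R)]_x f x)%E.
  by rewrite ge0_integral_pushforward.
by apply: eq_measure_integral => /= A mA _; exact: lebesgue_measure_shift.
Qed.

Lemma ge0_integral_opp (f : R -> \bar R) : measurable_fun setT f ->
  (forall x, 0 <= f x)%E -> (\int[mu]_x f (- x)%R = \int[mu]_x f x)%E.
Proof.
move=> mf f0.
transitivity (\int[pushforward mu (-%R : _ -> measurableTypeR R)]_x f x)%E.
  by rewrite ge0_integral_pushforward.
by apply: eq_measure_integral => /= A mA _; exact: lebesgue_measureN.
Qed.

Lemma ge0_integral_reflect c (f : R -> \bar R) : measurable_fun setT f ->
  (forall x, 0 <= f x)%E -> (\int[mu]_x f (c - x)%R = \int[mu]_x f x)%E.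
Proof.
move=> mf f0; rewrite -(ge0_integral_opp mf f0).
rewrite -[RHS](@ge0_integral_shift (- c)); last 2 first.
- exact: measurableT_comp.
- by [].
by apply: eq_integral => x _; rewrite opprD opprK addrC.
Qed.

(** * Functions with exponential decay *)

(** The rate 1/2 is that of the truncated weights. A bounded continuous function times such a weight
    stays in this class, on which every integral below is finite and boundary terms vanish. *)
Definition expdecay f := continuous f /\
  exists2 C : R, 0 <= C & forall x, `|f x| <= C * expR (- (2^-1 * `|x|)).

Lemma expdecay_integrable f : expdecay f -> mu.-integrable setT (EFin \o f).
Proof.
move=> [cf [C C0 fC]]; apply: (@le_integrable _ _ R mu setT measurableT _
  (fun x => (C * expR (- (2^-1 * `|x|)))%:E)) => //.
- apply/measurable_EFinP; exact: continuous_measurable_fun.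
- move=> x _ /=; rewrite lee_fin [leRHS]ger0_norm ?mulr_ge0 ?expR_ge0//; exact: fC.
- rewrite (_ : (fun _ => _) = (fun x => C%:E * (expR (- (2^-1 * `|x|)))%:E)%E) //.
  apply: integrableZl => //; apply/integrableP; split.
    by apply/measurable_EFinP; apply: continuous_measurable_fun; exact: continuous_exp_norm.
  under eq_integral => x _ do rewrite gee0_abs ?lee_fin ?expR_ge0//.
  by rewrite integral_exp_norm ?invr_gt0// ltry.
Qed.

Lemma continuous_mul f g : continuous f -> continuous g ->
  continuous (fun x => f x * g x).
Proof. by move=> cf cg x; apply: continuousM; [exact: cf|exact: cg]. Qed.

Lemma continuous_add f g : continuous f -> continuous g ->
  continuous (fun x => f x + g x).
Proof. by move=> cf cg x; apply: continuousD; [exact: cf|exact: cg]. Qed.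

Lemma continuous_normr f : continuous f -> continuous (fun x => `|f x|).
Proof.
by move=> cf x; apply: continuous_comp; [exact: cf|exact: norm_continuous].
Qed.

Lemma expdecay_norm f : expdecay f -> expdecay (fun x => `|f x|).
Proof.
move=> [cf [C C0 fC]]; split; first exact: continuous_normr.
by exists C => // x; rewrite normr_id.
Qed.

Lemma expdecayD f g : expdecay f -> expdecay g -> expdecay (fun x => f x + g x).
Proof.
move=> [cf [C C0 fC]] [cg [D D0 gD]]; split; first exact: continuous_add.
exists (C + D); first exact: addr_ge0.
by move=> x; rewrite mulrDl (le_trans (ler_normD _ _))// lerD.
Qed.

Lemma expdecayM f g M : (forall x, `|g x| <= M) -> continuous g -> expdecay f ->
  expdecay (fun x => g x * f x).
Proof.
move=> gM cg [cf [C C0 fC]]; split; first exact: continuous_mul.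
have M0 : 0 <= M by exact: le_trans (gM 0).
exists (M * C); first exact: mulr_ge0.
by move=> x; rewrite normrM -mulrA ler_pM.
Qed.

Lemma expdecay_bounded f : expdecay f -> exists2 C : R, 0 <= C & forall x, `|f x| <= C.
Proof.
move=> [_ [C C0 fC]]; exists C => // x; apply: le_trans (fC x) _.
rewrite ler_piMr// -expR0 ler_expR oppr_le0 mulr_ge0 ?invr_ge0//.
Qed.

Lemma expdecayZ k f : expdecay f -> expdecay (fun x => k * f x).
Proof. by apply: (@expdecayM _ (cst k) `|k|) => //; exact: cst_continuous. Qed.

Lemma cvg_exp_half_norm : (expR (- (2^-1 * n.+1%:R)) : R) @[n --> \oo] --> 0.
Proof.
have -> : (fun n => expR (- (2^-1 * n.+1%:R)) : R) = (fun n => expR (- 2^-1) ^+ n.+1).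
  by apply/funext => n; rewrite -expRM_natl -mulNr mulrC.
rewrite (@cvg_shiftS _ (fun n => expR (- 2^-1 : R) ^+ n)).
by apply: cvg_expr; rewrite ger0_norm ?expR_ge0// expR_lt1 oppr_lt0 invr_gt0.
Qed.

(* [\int_(-n)^n H' = H n - H (- n)] tends both to [0] and to [\int H']. *)
Lemma Rintegral_derive_eq0 (H H' : R -> R) :
  (forall x, is_derive x 1 H (H' x)) -> expdecay H -> expdecay H' ->
  \int[mu]_x H' x = 0.
Proof.
move=> dH [cH [C C0 HC]] eH'; have [cH' _] := eH'.
(* [n.+1] keeps the interval nondegenerate at [n = 0], as the fundamental theorem of calculus
   requires. *)
pose I n : set R := [set` `[(- n.+1%:R), n.+1%:R]].
pose F n := ((EFin \o H') \_ (I n)).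
have FH x : setT x -> F n x @[n --> \oo] --> (H' x)%:E.
  move=> _; apply: cvg_near_cst; near=> n.
  rewrite /F patchE mem_set//= /I/= in_itv/= -ler_norml.
  by rewrite (@le_trans _ _ n%:R)// ?ler_nat//; near: n; exact: nbhs_infty_ger.
have mF n : measurable_fun setT (F n).
  apply/(measurable_restrictT _ _).1; first exact: measurable_itv.
  by apply: measurable_funTS; apply/measurable_EFinP; exact: continuous_measurable_fun.
have IF n : (\int[mu]_x F n x = (H n.+1%:R - H (- n.+1%:R))%:E)%E.
  rewrite -[LHS]integral_mkcond (@continuous_FTC2 _ _ H)//.
  - by rewrite gtrN.
  - exact: continuous_subspaceT.
  - split; first by move=> x _; have [] := dH x.
    + by apply: cvg_at_right_filter; exact: cH.
    + by apply: cvg_at_left_filter; exact: cH.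
  - by move=> x _; exact: is_derive1E.
have h1 : (\int[mu]_x F n x)%E @[n --> \oo] --> (\int[mu]_x (H' x)%:E)%E.
  apply: (@dominated_cvg _ _ _ mu setT measurableT F _ (fun x => `|H' x|%:E)) => //.
  - exact: expdecay_integrable (expdecay_norm eH').
  - move=> n x _; rewrite /F patchE; case: ifP => _ //=.
    by rewrite normr0 lee_fin.
have h2 : (\int[mu]_x F n x)%E @[n --> \oo] --> 0%E.
  under eq_cvg => n do rewrite IF.
  apply: cvg_EFin; first by near=> n.
  apply: norm_cvg0; apply: (@squeeze_cvgr _ _ _ _ (cst 0)
    (fun n => (C + C) * expR (- (2^-1 * n.+1%:R)))).
  - near=> n => /=; rewrite normr_ge0/= (le_trans (ler_normB _ _))// mulrDl lerD//.
      by rewrite (le_trans (HC _))// ger0_norm.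
    by rewrite (le_trans (HC _))// normrN ger0_norm.
  - exact: cvg_cst.
  - rewrite -[X in _ --> X](mulr0 (C + C)).
    by apply: cvgM; [exact: cvg_cst|exact: cvg_exp_half_norm].
by rewrite /Rintegral (cvg_unique _ h1 h2).
Unshelve. all: by end_near. Qed.

(** * Signed powers *)

(** Up to the factor [p] this is the derivative of [|x|^p], that is, the test function of the energy
    method in L^p. *)
Definition spow p x := `|x| `^ (p - 2) * x.

Section signed_power.
Variable p : R.
Hypothesis p2 : 2 <= p.

Let p10 : 0 < p - 1. Proof. by move: p2; lra. Qed.
Let p0 : 0 < p. Proof. by move: p2; lra. Qed.
Let p11 : 1 <= p - 1. Proof. by move: p2; lra. Qed.

Lemma normr_spow x : `|spow p x| = `|x| `^ (p - 1).
Proof.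
rewrite /spow normrM ger0_norm ?powR_ge0// mulrC.
have -> : p - 2 = (p - 1) - 1 by ring.
by rewrite mulr_powRB1.
Qed.

Lemma spow_mul x : spow p x * x = `|x| `^ p.
Proof.
rewrite /spow -mulrA -expr2 -real_normK ?num_real// expr2.
have -> : p - 2 = (p - 1) - 1 by ring.
by rewrite mulrCA [_ * `|x|]mulrC mulr_powRB1// mulr_powRB1.
Qed.

Lemma continuous_spow : continuous (spow p).
Proof.
move=> x; have [->|x0] := eqVneq x 0.
  rewrite /continuous_at; apply/cvgrPdist_lt => e e0; near=> y.
  rewrite {1}/spow mulr0 sub0r normrN normr_spow.
  apply: (@le_lt_trans _ _ `|y|); last first.
    by near: y; apply: (@cvgr0_norm_lt _ _ _ _ _ id) => //; exact: cvg_id.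
  have y1 : `|y| <= 1.
    by near: y; apply: (@cvgr0_norm_le _ _ _ _ _ id) => //; exact: cvg_id.
  have [->|y0] := eqVneq y 0; first by rewrite normr0 powR0// gt_eqF.
  by rewrite ge1r_powR// normr_gt0 y0 y1.
apply: (@continuousM _ _ (fun y : R => `|y| `^ (p - 2)) id x); last exact: cvg_id.
apply: (@continuous_comp _ _ _ (fun y => `|y|) (fun z => z `^ (p - 2))).
  exact: norm_continuous.
apply: is_derive1_continuous (is_derive1_powR _ _).
by rewrite normr_gt0.
Unshelve. all: by end_near. Qed.

(** The power rule for [x > 0], evenness for [x < 0]. At 0, [|z|^p = spow p z * z] exhibits [spow p]
    itself as Caratheodory slope function, continuous and zero there. *)
Lemma is_derive_norm_powR x : is_derive x 1 (fun y => `|y| `^ p) (p * spow p x).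
Proof.
have pos z : 0 < z -> is_derive z 1 (fun y => `|y| `^ p) (p * spow p z).
  move=> z0; apply: (@near_eq_is_derive _ _ _ (fun y => y `^ p)).
    by near=> y; rewrite ger0_norm// ltW//; near: y; exact: lt_nbhsr.
  rewrite /spow gtr0_norm// mulrC.
  have -> : z `^ (p - 2) * z = z `^ (p - 1).
    rewrite mulrC; have -> : p - 2 = (p - 1) - 1 by ring.
    by rewrite mulr_powRB1// ltW.
  by rewrite mulrC; exact: is_derive1_powR.
have [x0|x0|->] := ltgtP x 0.
- have -> : (fun y => `|y| `^ p) = (fun y => `|y| `^ p) \o (-%R : R -> R).
    by apply/funext => y /=; rewrite normrN.
  have -> : p * spow p x = (p * spow p (- x)) * (-1).
    by rewrite /spow normrN; ring.
  by apply: is_derive1_comp; apply: pos; rewrite oppr_gt0.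
- exact: pos.
- apply/is_derive1_caratheodory; exists (spow p); split.
  + by move=> z; rewrite subr0 spow_mul normr0 powR0 ?gt_eqF ?subr0.
  + exact: continuous_spow.
  + by rewrite /spow !mulr0.
Unshelve. all: by end_near. Qed.

End signed_power.
(** * Hoelder and Schur bounds *)

Section power_integrals.
Variable p : R.
Hypothesis p2 : 2 <= p.

Let p10 : 0 < p - 1. Proof. by move: p2; lra. Qed.
Let p0 : 0 < p. Proof. by move: p2; lra. Qed.

Lemma expdecay_spowM g h : expdecay g -> expdecay h ->
  expdecay (fun x => spow p (g x) * h x).
Proof.
move=> eg eh; have [cg _] := eg; have [C C0 gC] := expdecay_bounded eg.
apply: (@expdecayM h (fun x => spow p (g x)) (C `^ (p - 1))) => //.
- move=> x; by rewrite normr_spow//; apply: (ge0_ler_powR (ltW p10)); rewrite ?nnegrE.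
- by move=> x; apply: continuous_comp; [exact: cg|exact: continuous_spow].
Qed.

Lemma expdecay_norm_powR g : expdecay g -> expdecay (fun x => `|g x| `^ p).
Proof.
move=> eg; have := expdecay_spowM eg eg.
by under [X in expdecay X -> _]eq_fun => x do rewrite spow_mul//.
Qed.

Definition pint g := \int[mu]_x (`|g x| `^ p).

Definition pnorm g := pint g `^ p^-1.

Lemma pint_ge0 g : 0 <= pint g.
Proof. by apply: Rintegral_ge0 => x _; exact: powR_ge0. Qed.

Lemma pnorm_ge0 g : 0 <= pnorm g. Proof. exact: powR_ge0. Qed.

Lemma pnorm_powR g : pnorm g `^ p = pint g.
Proof. by rewrite /pnorm -powRrM mulVf ?gt_eqF// powRr1// pint_ge0. Qed.

Lemma EFin_pint g : expdecay g -> (\int[mu]_x (`|g x| `^ p)%:E = (pint g)%:E)%E.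
Proof.
move=> eg; rewrite /pint /Rintegral fineK//.
by apply: integrable_fin_num => //; exact: expdecay_integrable (expdecay_norm_powR eg).
Qed.

(** Young's inequality for [a / y] and [b / z], multiplied by [y^(p-1) z]. If the integrals of [a^p]
    and [b^p] are at most [y^p] and [z^p], the right-hand side integrates to at most [y^(p-1) z],
    because [1/q + 1/p = 1]: this one pointwise bound gives both Hoelder's inequality and the Schur
    test. *)
Lemma young_powR a b y z : 0 <= a -> 0 <= b -> 0 < y -> 0 < z ->
  a `^ (p - 1) * b <=
  (y `^ (p - 1) * z * (1 - p^-1) / y `^ p) * a `^ p +
  (y `^ (p - 1) * z / p / z `^ p) * b `^ p.
Proof.
move=> a0 b0 y0 z0.
have q0 : 0 < p / (p - 1) by rewrite divr_gt0.
have pq : (p / (p - 1))^-1 + p^-1 = 1.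
  by rewrite invf_div mulrDl divff ?gt_eqF// mulN1r subrK.
have ay : 0 <= a / y by rewrite divr_ge0// ltW.
have bz : 0 <= b / z by rewrite divr_ge0// ltW.
have := conjugate_powR (powR_ge0 (a / y) (p - 1)) bz q0 p0 pq.
rewrite -powRrM; have -> : (p - 1) * (p / (p - 1)) = p.
  by rewrite mulrC divfK// gt_eqF.
have -> : (p / (p - 1))^-1 = 1 - p^-1 by move: pq => /(canRL (addrK _)).

have Vp (w r : R) : 0 <= w -> w^-1 `^ r = (w `^ r)^-1.
  by move=> w0; rewrite -(powR_inv1 w0) -powRrM mulN1r powRN.
have y0' := ltW y0; have z0' := ltW z0.
have yi : 0 <= y^-1 by rewrite invr_ge0.
have zi : 0 <= z^-1 by rewrite invr_ge0.
rewrite !(powRM _ a0 yi) (powRM _ b0 zi) !(Vp _ _ y0') (Vp _ _ z0') => H.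
have yp0 : 0 < y `^ (p - 1) by exact: powR_gt0.
have := ler_wpM2l (ltW (mulr_gt0 yp0 z0)) H.
rewrite mulrACA mulrA.
have -> : y `^ (p - 1) * (a `^ (p - 1) / y `^ (p - 1)) = a `^ (p - 1).
  by rewrite mulrC divfK// gt_eqF.
rewrite -mulrA [z * _]mulrC divfK ?gt_eqF// => H2.
apply: le_trans H2 _; rewrite le_eqVlt; apply/orP; left; apply/eqP; ring.
Qed.

Lemma measurable_norm_powR g (r : R) : continuous g ->
  measurable_fun setT (fun x => `|g x| `^ r).
Proof.
move=> cg; apply: measurableT_comp (measurable_powR r) _.
by apply: continuous_measurable_fun; exact: continuous_normr.
Qed.

(* Schur test: by Young's inequality the double integral is at most
   [Y^(p-1) Z (1/q + 1/p) K]. *)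
Lemma schur_pairing (k g h : R -> R) (K Y Z : R) : measurable_fun setT k ->
  (forall x, 0 <= k x) -> (\int[mu]_x (k x)%:E <= K%:E)%E ->
  expdecay g -> expdecay h ->
  0 < Y -> 0 < Z -> pint g <= Y `^ p -> pint h <= Z `^ p ->
  (\int[mu]_x (((`|g x| `^ (p - 1))%:E * \int[mu]_y (k (x - y) * `|h y|)%:E))
     <= (K * (Y `^ (p - 1) * Z))%:E)%E.
Proof.
move=> mk k0 kK eg eh Y0 Z0 gY hZ.
have [cg _] := eg; have [ch _] := eh.
pose c1 := Y `^ (p - 1) * Z * (1 - p^-1) / Y `^ p.
pose c2 := Y `^ (p - 1) * Z / p / Z `^ p.
have YZ0 : 0 < Y `^ (p - 1) * Z by rewrite mulr_gt0// powR_gt0.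
have p1 : 0 <= 1 - p^-1 by rewrite subr_ge0 invf_le1// (le_trans _ p2)// ler1n.
have c10 : 0 <= c1 by rewrite divr_ge0 ?powR_ge0// mulr_ge0// ltW.
have c20 : 0 <= c2 by rewrite divr_ge0 ?powR_ge0// divr_ge0 ?ltW.
have msub : measurable_fun [set: R * R] (fun z : R * R => z.1 - z.2).
  by apply: measurable_funB; [exact: measurable_fst|exact: measurable_snd].
have mkxy : measurable_fun [set: R * R] (fun z : R * R => k (z.1 - z.2)).
  exact: measurableT_comp.
have mg1 : measurable_fun setT (fun x => `|g x| `^ (p - 1)) by exact: measurable_norm_powR.
have mgp : measurable_fun setT (fun x => `|g x| `^ p) by exact: measurable_norm_powR.
have mhp : measurable_fun setT (fun x => `|h x| `^ p) by exact: measurable_norm_powR.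
have mh : measurable_fun setT (fun x => `|h x|).
  by apply: continuous_measurable_fun; exact: continuous_normr.
have mkl x : measurable_fun setT (fun y => k (x - y)).
  by apply: measurableT_comp => //; exact: measurable_funB.
have mkr y : measurable_fun setT (fun x => k (x - y)).
  by apply: measurableT_comp => //; exact: measurable_funB.
have Kl x : (\int[mu]_y (k (x - y))%:E <= K%:E)%E.
  apply: le_trans kK; rewrite (@ge0_integral_reflect x (EFin \o k))//.
  exact/measurable_EFinP.
have Kr y : (\int[mu]_x (k (x - y))%:E <= K%:E)%E.
  apply: le_trans kK; rewrite (@ge0_integral_shift (- y) (EFin \o k))//.
  exact/measurable_EFinP.
pose H x := (\int[mu]_y (c2 * `|h y| `^ p * k (x - y))%:E)%E.
have mD : measurable_fun setT (fun z : R * R => (c2 * `|h z.2| `^ p * k (z.1 - z.2))%:E).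
  apply/measurable_EFinP; apply: measurable_funM => //; apply: measurable_funM => //.
  exact: measurableT_comp mhp measurable_snd.
have D0 (z : R * R) : (0 <= (c2 * `|h z.2| `^ p * k (z.1 - z.2))%:E)%E.
  by rewrite lee_fin mulr_ge0// mulr_ge0// powR_ge0.
have mH : measurable_fun setT H.
  exact: (@measurable_fun_fubini_tonelli_F _ _ _ _ R mu _ mD).
have H0 x : (0 <= H x)%E.
  by apply: integral_ge0 => y _; exact: (D0 (x, y)).
have mE : measurable_fun setT (fun z : R * R => (k (z.1 - z.2) * `|h z.2|)%:E).
  apply/measurable_EFinP; apply: measurable_funM => //.
  exact: measurableT_comp mh measurable_snd.
have E0 (z : R * R) : (0 <= (k (z.1 - z.2) * `|h z.2|)%:E)%E.
  by rewrite lee_fin mulr_ge0.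
(* The [g] part of Young's bound is integrated in [y] at once, with the mass of [k] as factor; the
   [h] part [H] has to wait for Tonelli's theorem. *)
apply: (@le_trans _ _ (\int[mu]_x ((c1 * K * `|g x| `^ p)%:E + H x))%E).
  apply: ge0_le_integral => //.
  - move=> x _; rewrite mule_ge0 ?lee_fin ?powR_ge0//.
    by apply: integral_ge0 => y _; exact: (E0 (x, y)).
  - apply: emeasurable_funM; first exact/measurable_EFinP.
    exact: (@measurable_fun_fubini_tonelli_F _ _ _ _ R mu _ mE).
  - apply: emeasurable_funD => //; apply/measurable_EFinP.
    exact: measurable_funM.
  move=> x _; rewrite -ge0_integralZl_EFin ?powR_ge0//; last 2 first.
  - by move=> y _; exact: (E0 (x, y)).
  - by apply/measurable_EFinP; exact: measurable_funM (mkl x) mh.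
  apply: (@le_trans _ _ (\int[mu]_y ((c1 * `|g x| `^ p)%:E * (k (x - y))%:E +
      (c2 * `|h y| `^ p * k (x - y))%:E))%E).
    apply: ge0_le_integral => //.
    - by move=> y _; rewrite mule_ge0 ?lee_fin ?powR_ge0//; exact: (E0 (x, y)).
    - by apply: emeasurable_funM => //; apply/measurable_EFinP; exact: measurable_funM (mkl x) mh.
    - apply: emeasurable_funD; last first.
        apply/measurable_EFinP; apply: measurable_funM; last exact: (mkl x).
    exact: measurable_funM.
      by apply: emeasurable_funM => //; apply/measurable_EFinP; exact: (mkl x).
    move=> y _; rewrite -!EFinM -EFinD lee_fin mulrCA -mulrDl mulrC.
    by apply: ler_wpM2r => //; exact: young_powR.
  rewrite ge0_integralD//; last 4 first.
  - by move=> y _; rewrite -EFinM lee_fin mulr_ge0// mulr_ge0// powR_ge0.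
  - by apply: emeasurable_funM => //; apply/measurable_EFinP; exact: (mkl x).
  - by move=> y _; exact: (D0 (x, y)).
  - apply/measurable_EFinP; apply: measurable_funM; last exact: (mkl x).
    exact: measurable_funM.
  apply: leeD2r; rewrite ge0_integralZl_EFin//; last 3 first.
  - by move=> y _; rewrite lee_fin.
  - by apply/measurable_EFinP; exact: (mkl x).
  - by rewrite mulr_ge0// powR_ge0.
  rewrite [in leRHS]mulrAC [in leRHS]EFinM; apply: lee_wpmul2l => //.
  by rewrite lee_fin mulr_ge0// powR_ge0.
have K0 : 0 <= K by rewrite -lee_fin (le_trans _ kK)// integral_ge0// => x _; rewrite lee_fin.
rewrite ge0_integralD//; last 2 first.
- by move=> x _; rewrite lee_fin mulr_ge0 ?powR_ge0// mulr_ge0.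
- by apply/measurable_EFinP; exact: measurable_funM.
have -> : K * (Y `^ (p - 1) * Z) = c1 * K * Y `^ p + c2 * K * Z `^ p.
  rewrite /c1 /c2; field; rewrite !gt_eqF ?powR_gt0//.
rewrite EFinD; apply: leeD.
  under eq_integral => x _ do rewrite EFinM.
  rewrite ge0_integralZl_EFin//; last 2 first.
  - exact/measurable_EFinP.
  - exact: mulr_ge0.
  by rewrite EFin_pint// -EFinM lee_fin ler_wpM2l// mulr_ge0.
rewrite /H (@fubini_tonelli _ _ _ _ R mu mu _ mD D0) /=.
apply: (@le_trans _ _ (\int[mu]_y ((c2 * K)%:E * (`|h y| `^ p)%:E))%E).
  apply: ge0_le_integral => //.
  - by move=> y _; apply: integral_ge0 => x _; exact: (D0 (x, y)).
  - exact: (@measurable_fun_fubini_tonelli_G _ _ _ _ R mu _ mD).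
  - by apply: emeasurable_funM => //; exact/measurable_EFinP.
  move=> y _; under eq_integral => x _ do rewrite EFinM.
  rewrite ge0_integralZl_EFin//; last 3 first.
  - by move=> x _; rewrite lee_fin.
  - by apply/measurable_EFinP; exact: (mkr y).
  - by rewrite mulr_ge0// powR_ge0.
  rewrite -[in leRHS]EFinM [in leRHS]mulrAC [in leRHS]EFinM; apply: lee_wpmul2l => //.
  by rewrite lee_fin mulr_ge0// powR_ge0.
rewrite ge0_integralZl_EFin//; last 2 first.
- exact/measurable_EFinP.
- exact: mulr_ge0.
by rewrite EFin_pint// -EFinM lee_fin ler_wpM2l// mulr_ge0.
Qed.

End power_integrals.

(** * Hoelder and Minkowski inequalities, and the energy identity *)

Lemma expdecay_RintegralD f g : expdecay f -> expdecay g ->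
  \int[mu]_x (f x + g x) = \int[mu]_x f x + \int[mu]_x g x.
Proof. by move=> ef eg; rewrite RintegralD//; exact: expdecay_integrable. Qed.

Lemma expdecay_RintegralZ k f : expdecay f ->
  \int[mu]_x (k * f x) = k * \int[mu]_x f x.
Proof. by move=> ef; rewrite RintegralZl//; exact: expdecay_integrable. Qed.

Lemma expdecay_le_Rintegral f g : expdecay f -> expdecay g ->
  (forall x, f x <= g x) -> \int[mu]_x f x <= \int[mu]_x g x.
Proof.
by move=> ef eg fg; apply: le_Rintegral => //; exact: expdecay_integrable.
Qed.

Section p_norms.
Variable p : R.
Hypothesis p2 : 2 <= p.

Let p10 : 0 < p - 1. Proof. by move: p2; lra. Qed.
Let p0 : 0 < p. Proof. by move: p2; lra. Qed.

Lemma expdecay_pairing g h : expdecay g -> expdecay h ->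
  expdecay (fun x => `|g x| `^ (p - 1) * `|h x|).
Proof.
move=> eg eh; have := expdecay_norm (expdecay_spowM p2 eg eh).
by under [X in expdecay X -> _]eq_fun => x do rewrite normrM normr_spow//.
Qed.

Lemma hoelder_pairing g h Y Z : expdecay g -> expdecay h ->
  0 < Y -> 0 < Z -> pint p g <= Y `^ p -> pint p h <= Z `^ p ->
  \int[mu]_x (`|g x| `^ (p - 1) * `|h x|) <= Y `^ (p - 1) * Z.
Proof.
move=> eg eh Y0 Z0 gY hZ.
pose c1 := Y `^ (p - 1) * Z * (1 - p^-1) / Y `^ p.
pose c2 := Y `^ (p - 1) * Z / p / Z `^ p.
have YZ0 : 0 < Y `^ (p - 1) * Z by rewrite mulr_gt0// powR_gt0.
have p1 : 0 <= 1 - p^-1 by rewrite subr_ge0 invf_le1// (le_trans _ p2)// ler1n.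
have c10 : 0 <= c1 by rewrite divr_ge0 ?powR_ge0// mulr_ge0// ltW.
have c20 : 0 <= c2 by rewrite divr_ge0 ?powR_ge0// divr_ge0 ?ltW.
have egp := expdecay_norm_powR p2 eg; have ehp := expdecay_norm_powR p2 eh.
apply: (@le_trans _ _ (\int[mu]_x (c1 * `|g x| `^ p + c2 * `|h x| `^ p))).
  apply: expdecay_le_Rintegral.
  - exact: expdecay_pairing.
  - by apply: expdecayD; exact: expdecayZ.
  - by move=> x; exact: young_powR.
rewrite expdecay_RintegralD; [|exact: expdecayZ..].
rewrite !expdecay_RintegralZ//.
have -> : Y `^ (p - 1) * Z = c1 * Y `^ p + c2 * Z `^ p.
  by rewrite /c1 /c2; field; rewrite !gt_eqF ?powR_gt0.
by apply: lerD; apply: ler_wpM2l.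
Qed.

Lemma pint_le_pnorm g Z : pnorm p g <= Z -> pint p g <= Z `^ p.
Proof.
move=> gZ; rewrite -pnorm_powR//; apply: (ge0_ler_powR (ltW p0)) => //.
  by rewrite nnegrE pnorm_ge0.
by rewrite nnegrE (le_trans _ gZ)// pnorm_ge0.
Qed.

(** Young's normalisation divides by [Z], which must be positive while the norm of [h] may vanish;
    [Z] is the norm plus a slack that tends to 0. *)
Lemma pnorm_hoelder g h Y : expdecay g -> expdecay h ->
  0 < Y -> pint p g <= Y `^ p ->
  \int[mu]_x (`|g x| `^ (p - 1) * `|h x|) <= Y `^ (p - 1) * pnorm p h.
Proof.
move=> eg eh Y0 gY; apply/ler_addgt0Pr => e e0.
have Yp : 0 < Y `^ (p - 1) by exact: powR_gt0.
have -> : Y `^ (p - 1) * pnorm p h + e = Y `^ (p - 1) * (pnorm p h + e / Y `^ (p - 1)).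
  by field; rewrite gt_eqF.
apply: hoelder_pairing => //.
  by rewrite ltr_wpDl ?pnorm_ge0// divr_gt0.
by apply: pint_le_pnorm; rewrite lerDl divr_ge0// ltW.
Qed.

Lemma pint_spow g : expdecay g -> pint p g = \int[mu]_x (spow p (g x) * g x).
Proof. by move=> eg; apply: eq_Rintegral => x _; rewrite spow_mul. Qed.

Lemma pnorm_le g h : expdecay g -> expdecay h -> (forall x, `|g x| <= `|h x|) ->
  pnorm p g <= pnorm p h.
Proof.
move=> eg eh gh; have pi : 0 <= p^-1 by rewrite invr_ge0 ltW.
apply: (ge0_ler_powR pi); [by rewrite nnegrE pint_ge0..|].
apply: expdecay_le_Rintegral; [exact: expdecay_norm_powR..|].
by move=> x; apply: (ge0_ler_powR (ltW p0)); rewrite ?nnegrE.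
Qed.

Lemma pnormZ k g : expdecay g -> pnorm p (fun x => k * g x) = `|k| * pnorm p g.
Proof.
move=> eg; rewrite /pnorm.
have -> : pint p (fun x => k * g x) = `|k| `^ p * pint p g.
  rewrite /pint -expdecay_RintegralZ; last exact: expdecay_norm_powR.
  by apply: eq_Rintegral => x _; rewrite normrM powRM.
rewrite powRM ?powR_ge0 ?pint_ge0// -powRrM mulfV ?gt_eqF// powRr1//.
Qed.

(** Minkowski's inequality by duality: pair [|f|^(p-1)] with [|f| <= |g| + |h|], apply Hoelder to
    both terms and divide by the power [p - 1] of the norm of [f]. *)
Lemma pnorm_leD f g h : expdecay f -> expdecay g -> expdecay h ->
  (forall x, `|f x| <= `|g x| + `|h x|) -> pnorm p f <= pnorm p g + pnorm p h.
Proof.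
move=> ef eg eh fgh.
have [->|y0] := eqVneq (pnorm p f) 0; first by rewrite addr_ge0// pnorm_ge0.
have {}y0 : 0 < pnorm p f by rewrite lt0r y0 pnorm_ge0.
have fp : pint p f <= pnorm p f `^ p by exact: pint_le_pnorm.
have yp : 0 < pnorm p f `^ (p - 1) by exact: powR_gt0.
rewrite -(ler_pM2l yp) mulrDr.
apply: le_trans (lerD (pnorm_hoelder ef eg y0 fp) (pnorm_hoelder ef eh y0 fp)).
rewrite -expdecay_RintegralD; [|exact: expdecay_pairing..].
rewrite mulrC mulr_powRB1 ?pnorm_ge0// pnorm_powR//.
apply: expdecay_le_Rintegral; first exact: expdecay_norm_powR.
  by apply: expdecayD; exact: expdecay_pairing.
move=> x; rewrite -mulrDr -(mulr_powRB1 _ p0)// mulrC.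
by apply: ler_wpM2l => //; exact: powR_ge0.
Qed.

(* Integrating [(a |g|^p)' = a' |g|^p + p a spow g g'] over the line. *)
Lemma energy_identity (a a' g g' : R -> R) M : (forall x, is_derive x 1 a (a' x)) ->
  continuous a' -> (forall x, `|a x| <= M) -> (forall x, `|a' x| <= M) ->
  (forall x, is_derive x 1 g (g' x)) -> expdecay g -> expdecay g' ->
  \int[mu]_x (spow p (g x) * (a x * g' x)) = - p^-1 * \int[mu]_x (a' x * `|g x| `^ p).
Proof.
move=> da ca' aM a'M dg eg eg'.
have ca : continuous a by move=> x; exact: is_derive1_continuous (da x).
have e1 : expdecay (fun x => a' x * `|g x| `^ p).
  by apply: (expdecayM a'M ca'); exact: expdecay_norm_powR.
have e2 : expdecay (fun x => spow p (g x) * (a x * g' x)).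
  by apply: expdecay_spowM => //; exact: (expdecayM aM ca).
have : \int[mu]_x (a' x * `|g x| `^ p + p * (spow p (g x) * (a x * g' x))) = 0.
  apply: (@Rintegral_derive_eq0 (fun x => a x * `|g x| `^ p)).
  - move=> x; have d1 := da x.
    have d2 : is_derive x 1 (fun y => `|g y| `^ p) (p * spow p (g x) * g' x).
      apply: (@is_derive1_comp _ (fun y => `|y| `^ p) g) => //.
      exact: is_derive_norm_powR.
    by apply: is_derive_eq; rewrite /GRing.scale/=; ring.
  - by apply: (expdecayM aM ca); exact: expdecay_norm_powR.
  - by apply: expdecayD => //; exact: expdecayZ.
rewrite expdecay_RintegralD//; last exact: expdecayZ.
rewrite expdecay_RintegralZ// => /eqP; rewrite addrC addr_eq0 => /eqP H.
by rewrite mulNr -mulrN -H mulrA mulVf ?mul1r// gt_eqF.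
Qed.

End p_norms.
(** * One backward Euler step for a transport equation *)

Implicit Types (e d s t M B p : R).

Definition smooth_weight (B : R) (w w' : R -> R) :=
  [/\ forall x, 0 < w x, forall x, is_derive x 1 w (w' x), continuous w',
      forall x, `|w' x| <= B * w x & expdecay w].

Definition bcont (f : R -> R) := continuous f /\ exists C : R, forall x, `|f x| <= C.

Lemma bcontD f g : bcont f -> bcont g -> bcont (fun x => f x + g x).
Proof.
move=> [cf [C fC]] [cg [D gD]]; split; first exact: continuous_add.
by exists (C + D) => x; rewrite (le_trans (ler_normD _ _))// lerD.
Qed.

Lemma bcontM f g : bcont f -> bcont g -> bcont (fun x => f x * g x).
Proof.
move=> [cf [C fC]] [cg [D gD]]; split; first exact: continuous_mul.
by exists (C * D) => x; rewrite normrM ler_pM.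
Qed.

Lemma bcontZ k f : bcont f -> bcont (fun x => k * f x).
Proof.
by apply: bcontM; split; [exact: cst_continuous|exists `|k|].
Qed.

Lemma bcontB f g : bcont f -> bcont g -> bcont (fun x => f x - g x).
Proof.
move=> bf bg; have := bcontD bf (bcontZ (-1) bg).
by under [X in bcont X -> _]eq_fun => x do rewrite mulN1r.
Qed.

Lemma bcont_norm f : bcont f -> bcont (fun x => `|f x|).
Proof.
move=> [cf [C fC]]; split; first exact: continuous_normr.
by exists C => x; rewrite normr_id.
Qed.

Lemma bcont_expdecay f w : bcont f -> expdecay w -> expdecay (fun x => f x * w x).
Proof. by move=> [cf [C fC]]; exact: expdecayM fC cf. Qed.

Lemma smooth_weight_expdecay B w w' : 0 <= B -> smooth_weight B w w' -> expdecay w'.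
Proof.
move=> B0 [w0 dw cw' w'B [cw [C C0 wC]]]; split => //.
exists (B * C); first exact: mulr_ge0.
move=> x; rewrite (le_trans (w'B x))// -mulrA ler_wpM2l//.
by rewrite (le_trans (ler_norm _)).
Qed.

Lemma le_Rintegral_spow p g h : 2 <= p -> expdecay g -> expdecay h ->
  \int[mu]_x (spow p (g x) * h x) <= \int[mu]_x (`|g x| `^ (p - 1) * `|h x|).
Proof.
move=> p2 eg eh; apply: expdecay_le_Rintegral.
- exact: expdecay_spowM.
- exact: expdecay_pairing.
- by move=> x; rewrite (le_trans (ler_norm _))// normrM normr_spow.
Qed.

(** The expansion [f t - f s = (t - s) f_t(t) + r] is paired with [spow p (f t w)]. The left side
    gives [y(t)^p], the term in [f s] at most [y(t)^(p-1) y(s)], the transport term is integrated by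
    parts, and [r] is small because [f_t] is continuous in time uniformly in [x]. Division by
    [y(t)^(p-1)] gives the claim. The equation for [f_t] is used as a time derivative only on the
    open interval, so [t] may be the final time. *)
Lemma transport_step p B (w w' : R -> R) M b t (f ft : R -> R -> R) (fd a a' G : R -> R) :
  2 <= p -> 0 <= B -> smooth_weight B w w' -> 0 < t ->
  (forall s, 0 <= s <= t -> bcont (f s)) ->
  (forall x, is_derive x 1 (f t) (fd x)) -> bcont fd ->
  (forall x, is_derive x 1 a (a' x)) -> continuous a' ->
  (forall x, `|a x| <= M) -> (forall x, `|a' x| <= M) ->
  bcont G -> (forall x, ft t x = - (a x * fd x) + G x) ->
  (forall x, {within `[0, t], continuous f^~ x}) ->
  (forall s x, 0 < s < t -> is_derive s 1 (f^~ x) (ft s x)) ->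
  (forall e, 0 < e -> exists2 d : R, 0 < d &
     forall s, 0 <= s <= t -> t - s < d -> forall x, `|ft s x - ft t x| <= e) ->
  let y s := pnorm p (fun x => f s x * w x) in
  (0 < y t -> \int[mu]_x (`|f t x * w x| `^ (p - 1) * `|G x * w x|) <=
    y t `^ (p - 1) * b) -> 0 <= b ->
  forall e, 0 < e -> exists2 d : R, 0 < d & forall s, 0 <= s < t -> t - s < d ->
    y t <= y s + (t - s) * ((B + 1) * M * y t + b + e).
Proof.
move=> p2 B0 sw t0 bf dft bfd da ca' aM a'M bG ftE cf df uft y pairG b0 e e0.
have [w0 dw cw' w'B ew] := sw.
have ew' := smooth_weight_expdecay B0 sw.
have p0 : 0 < p by rewrite (lt_le_trans _ p2).
have M0 : 0 <= M by exact: le_trans (aM 0).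
have y0 s : 0 <= y s by exact: pnorm_ge0.
have K0 : 0 <= (B + 1) * M * y t + b + e.
  by rewrite addr_ge0 ?(ltW e0)// addr_ge0// !mulr_ge0// addr_ge0.
(* No division by [y(t)^(p-1)] is possible here, but the right-hand side is nonnegative, so any [d]
   will do. *)
have [yt0|yt0] := eqVneq (y t) 0.
  exists 1 => // s /andP[s0 st] _; rewrite yt0.
  by rewrite addr_ge0// mulr_ge0 ?subr_ge0 ?(ltW st)//; rewrite yt0 in K0.
have {yt0}Y0 : 0 < y t by rewrite lt0r yt0 y0.
have tt : 0 <= t <= t by rewrite (ltW t0) lexx.
pose g x := f t x * w x.
have eg : expdecay g by exact: bcont_expdecay (bf _ tt) ew.
have gp : pint p g <= y t `^ p by exact: pint_le_pnorm.
pose J := \int[mu]_x (`|g x| `^ (p - 1) * `|w x|).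
have J0 : 0 <= J by apply: Rintegral_ge0 => x _; rewrite mulr_ge0 ?powR_ge0.
have Yp : 0 < y t `^ (p - 1) by exact: powR_gt0.
(* Tolerance for [f_t]: integrated against [|g|^(p-1) |w|], of total [J], it costs at most
   [e y(t)^(p-1)]; [J + 1] avoids a division by zero. *)
have e'0 : 0 < e * y t `^ (p - 1) / (J + 1) by rewrite divr_gt0 ?mulr_gt0// ltr_wpDl.
have [d d0 uftd] := uft _ e'0.
exists d => // s /andP[s0 st] std.
have tst : 0 <= s <= t by rewrite s0 ltW.
have rE x : `|f t x - f s x - (t - s) * ft t x| <=
    (t - s) * (e * y t `^ (p - 1) / (J + 1)).
  (* Mean value theorem in time for [f z x - z f_t(t, x)], whose increment from [s] to [t] is the
     remainder. *)
  have [] := @MVT R (fun z => f z x - z * ft t x) (fun z => ft z x - ft t x) s t st.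
  - move=> z /[!in_itv]/= /andP[sz zt].
    have dz : is_derive z 1 (f^~ x) (ft z x).
      by apply: df; rewrite zt (le_lt_trans s0).
    apply: is_derive_eq; rewrite /GRing.scale/=; ring.
  - apply: (@within_continuousB _ _ _ _ (f^~ x) (fun z => z * ft t x)).
      apply: continuous_subspaceW (cf x).
      by apply: subset_itvr; rewrite bnd_simp.
    apply: continuous_subspaceT.
    by apply: continuous_mul; [move=> z; exact: cvg_id|exact: cst_continuous].
  - move=> z /[!in_itv]/= /andP[sz zt] H.
    have -> : f t x - f s x - (t - s) * ft t x =
      f t x - t * ft t x - (f s x - s * ft t x) by ring.
    rewrite H normrM [`|t - s|]ger0_norm ?subr_ge0 ?(ltW st)// mulrC.
    rewrite ler_wpM2l ?subr_ge0 ?(ltW st)//.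
    apply: uftd; first by rewrite (le_trans s0) ?(ltW sz) ?(ltW zt).
    by apply: le_lt_trans std; rewrite lerD2l lerN2 ltW.
pose r x := f t x - f s x - (t - s) * ft t x.
have ca : continuous a by move=> x; exact: is_derive1_continuous (da x).
have ba : bcont a by split => //; exists M.
have bft : bcont (ft t).
  have -> : ft t = fun x => -1 * (a x * fd x) + G x.
    by apply/funext => x; rewrite ftE mulN1r.
  by apply: bcontD => //; apply: bcontZ; exact: bcontM.
have br : bcont r by apply: bcontB; [apply: bcontB; exact: bf|exact: bcontZ].
pose g' x := fd x * w x + f t x * w' x.
have efdw := bcont_expdecay bfd ew.
have efw' := bcont_expdecay (bf _ tt) ew'.
have eg' : expdecay g' by exact: expdecayD.
have dg x : is_derive x 1 g (g' x).
  have d1 := dft x; have d2 := dw x.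
  by apply: is_derive_eq; rewrite /GRing.scale/= /g'; ring.
have eE1 := bcont_expdecay (bf _ tst) ew.
have eE2 : expdecay (fun x => a x * (fd x * w x)) by exact: expdecayM aM ca _.
have eE2' : expdecay (fun x => a x * g' x) by exact: expdecayM aM ca _.
have eE2'' : expdecay (fun x => a x * (f t x * w' x)) by exact: expdecayM aM ca _.
have eE3 := bcont_expdecay bG ew.
have eE4 := bcont_expdecay br ew.
have I1 : \int[mu]_x (spow p (g x) * (f s x * w x)) <= y t `^ (p - 1) * y s.
  apply: le_trans (le_Rintegral_spow p2 eg eE1) _.
  exact: pnorm_hoelder.
have I3 : \int[mu]_x (spow p (g x) * (G x * w x)) <= y t `^ (p - 1) * b.
  by apply: le_trans (le_Rintegral_spow p2 eg eE3) (pairG Y0).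
have I4 : \int[mu]_x (spow p (g x) * (r x * w x)) <= (t - s) * (e * y t `^ (p - 1)).
  apply: le_trans (le_Rintegral_spow p2 eg eE4) _.
  apply: (@le_trans _ _ (\int[mu]_x ((t - s) * (e * y t `^ (p - 1) / (J + 1)) *
      (`|g x| `^ (p - 1) * `|w x|)))).
    apply: expdecay_le_Rintegral.
    - exact: expdecay_pairing.
    - by apply: expdecayZ; exact: expdecay_pairing.
    - move=> x; rewrite normrM mulrCA; apply: ler_wpM2l; first exact: powR_ge0.
      by rewrite normrM ler_wpM2r//; exact: rE.
  rewrite expdecay_RintegralZ; last exact: expdecay_pairing.
  rewrite -mulrA; apply: ler_wpM2l; first by rewrite subr_ge0 ltW.
  rewrite -/J -mulrA ler_piMr//; first by rewrite mulr_ge0 ?powR_ge0// ltW.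
  by rewrite mulrC ler_pdivrMr ?mul1r ?lerDl// ltr_wpDl.
(* After the integration by parts the derivative of [a] costs [M / p <= M] and the derivative of the
   weight costs [M B]. *)
have I2 : - (\int[mu]_x (spow p (g x) * (a x * (fd x * w x)))) <= (B + 1) * M * y t `^ p.
  have -> : \int[mu]_x (spow p (g x) * (a x * (fd x * w x))) =
      \int[mu]_x (spow p (g x) * (a x * g' x)) +
      -1 * \int[mu]_x (spow p (g x) * (a x * (f t x * w' x))).
    rewrite -expdecay_RintegralZ; last exact: expdecay_spowM.
    rewrite -expdecay_RintegralD; last 2 first.
    - exact: expdecay_spowM.
    - by apply: expdecayZ; exact: expdecay_spowM.
    by apply: eq_Rintegral => x _; rewrite /g'; ring.
  rewrite (energy_identity p2 da ca' aM a'M dg eg eg').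
  rewrite mulN1r opprD opprK mulNr opprK.
  have -> : (B + 1) * M * y t `^ p = M * y t `^ p + M * B * y t `^ p by ring.
  apply: lerD.
    apply: (@le_trans _ _ (p^-1 * (M * y t `^ p))).
      rewrite ler_wpM2l ?invr_ge0 ?(ltW p0)// pnorm_powR// -expdecay_RintegralZ; last exact: expdecay_norm_powR.
      apply: expdecay_le_Rintegral.
      - by apply: (expdecayM a'M ca'); exact: expdecay_norm_powR.
      - by apply: expdecayZ; exact: expdecay_norm_powR.
      - by move=> x; rewrite ler_wpM2r ?powR_ge0// (le_trans (ler_norm _)).
    rewrite ler_piMl//; first by apply: mulr_ge0 => //; exact: powR_ge0.
    by rewrite invf_le1// (le_trans _ p2)// ler1n.
  rewrite pnorm_powR// -expdecay_RintegralZ; last exact: expdecay_norm_powR.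
  apply: expdecay_le_Rintegral.
  - exact: expdecay_spowM.
  - by apply: expdecayZ; exact: expdecay_norm_powR.
  - move=> x; rewrite (le_trans (ler_norm _))// normrM normr_spow//.
    rewrite -(mulr_powRB1 _ p0)//.
    have H : `|a x * (f t x * w' x)| <= M * B * `|g x|.
      rewrite normrM -mulrA; apply: ler_pM => //.
      rewrite /g !normrM mulrCA; apply: ler_wpM2l => //.
      by rewrite [`|w x|]gtr0_norm.
    apply: (@le_trans _ _ (`|g x| `^ (p - 1) * (M * B * `|g x|))).
      by apply: ler_wpM2l => //; exact: powR_ge0.
    by rewrite le_eqVlt; apply/orP; left; apply/eqP; rewrite /g; ring.
have : y t `^ p <= y t `^ (p - 1) * y s + (t - s) * ((B + 1) * M * y t `^ p)
   + (t - s) * (y t `^ (p - 1) * b) + (t - s) * (e * y t `^ (p - 1)).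
  apply: (@le_trans _ _ (\int[mu]_x (spow p (g x) * (f s x * w x))
    + (t - s) * (- (\int[mu]_x (spow p (g x) * (a x * (fd x * w x)))))
    + (t - s) * (\int[mu]_x (spow p (g x) * (G x * w x)))
    + \int[mu]_x (spow p (g x) * (r x * w x)))).
    rewrite {1}/y pnorm_powR// pint_spow// mulrN -mulNr.
    have s1 := expdecay_spowM p2 eg eE1.
    have s2 := expdecayZ (- (t - s)) (expdecay_spowM p2 eg eE2).
    have s3 := expdecayZ (t - s) (expdecay_spowM p2 eg eE3).
    have s4 := expdecay_spowM p2 eg eE4.
    rewrite -(expdecay_RintegralZ _ (expdecay_spowM p2 eg eE2)).
    rewrite -(expdecay_RintegralZ _ (expdecay_spowM p2 eg eE3)).
    rewrite -(expdecay_RintegralD s1 s2).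
    rewrite -(expdecay_RintegralD (expdecayD s1 s2) s3).
    rewrite -(expdecay_RintegralD (expdecayD (expdecayD s1 s2) s3) s4).
    rewrite le_eqVlt; apply/orP; left; apply/eqP.
    by apply: eq_Rintegral => x _; rewrite /g /r ftE; ring.
  have ts : 0 <= t - s by rewrite subr_ge0 ltW.
  by apply: lerD => //; apply: lerD; [apply: lerD => //|]; apply: ler_wpM2l.
have yE : y t `^ p = y t `^ (p - 1) * y t by rewrite mulrC mulr_powRB1.
rewrite yE.
have factorE (P yt ys h K : R) :
    P * ys + h * (K * (P * yt)) + h * (P * b) + h * (e * P) =
    P * (ys + h * (K * yt + b + e)) by ring.
by rewrite factorE ler_pM2l.
Qed.
(** * Convolution with the kernel [Gker] *)

Lemma Rintegral_opp f : measurable_fun setT f ->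
  \int[mu]_x f (- x) = \int[mu]_x f x.
Proof.
move=> mf; rewrite /Rintegral; congr fine.
have mEf : measurable_fun setT (EFin \o f) by exact/measurable_EFinP.
rewrite integralE [RHS]integralE.
congr (_ - _)%E.
- by rewrite -[RHS](ge0_integral_opp (measurable_funepos mEf) (fun x => funepos_ge0 _ x));
  apply: eq_integral => x _; rewrite !funeposE.
- by rewrite -[RHS](ge0_integral_opp (measurable_funeneg mEf) (fun x => funeneg_ge0 _ x));
  apply: eq_integral => x _; rewrite !funenegE.
Qed.

Lemma Gker_ge0 x : 0 <= Gker x. Proof. by rewrite mulr_ge0 ?invr_ge0 ?expR_ge0. Qed.

Lemma continuous_Gker : continuous (@Gker R).
Proof.
apply: continuous_mul; first exact: cst_continuous.
move=> x; apply: continuous_comp; last exact: continuous_expR.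
by apply: continuousN; exact: norm_continuous.
Qed.

Lemma integral_Gker : (\int[mu]_x (Gker x)%:E = 1)%E.
Proof.
under eq_integral => x _ do rewrite /Gker -[`|x|]mul1r EFinM.
rewrite ge0_integralZl_EFin ?invr_ge0//; last first.
  by apply/measurable_EFinP; apply: continuous_measurable_fun; exact: continuous_exp_norm.
by rewrite integral_exp_norm// -EFinM divr1 mulVf.
Qed.

Lemma measurable_Gker_sub x : measurable_fun setT (fun y => Gker (x - y)).
Proof.
apply: (measurableT_comp (continuous_measurable_fun continuous_Gker)).
exact: measurable_funB.
Qed.

Lemma integral_Gker_sub x : (\int[mu]_y (Gker (x - y))%:E = 1)%E.
Proof.
rewrite (@ge0_integral_reflect x (EFin \o Gker)) ?integral_Gker//.
- by apply/measurable_EFinP; apply: continuous_measurable_fun; exact: continuous_Gker.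
- by move=> y; rewrite lee_fin Gker_ge0.
Qed.

Lemma integrable_Gker_sub x : mu.-integrable setT (fun y => (Gker (x - y))%:E).
Proof.
apply/integrableP; split; first by apply/measurable_EFinP; exact: measurable_Gker_sub.
under eq_integral => y _ do rewrite gee0_abs ?lee_fin ?Gker_ge0//.
by rewrite integral_Gker_sub ltry.
Qed.

Lemma integrable_conv F x : bcont F ->
  mu.-integrable setT (EFin \o (fun y => Gker (x - y) * F y)).
Proof.
move=> [cF [C FC]].
have C0 : 0 <= C by exact: le_trans (FC 0).
apply: (@le_integrable _ _ R mu setT measurableT _
  (fun y => C%:E * (Gker (x - y))%:E)%E) => //.
- apply/measurable_EFinP; apply: measurable_funM; first exact: measurable_Gker_sub.
  exact: continuous_measurable_fun.
- move=> y _ /=; rewrite lee_fin normrM (ger0_norm (Gker_ge0 _)).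
  rewrite [leRHS]ger0_norm; last by apply: mulr_ge0 => //; exact: Gker_ge0.
  by rewrite mulrC; apply: ler_wpM2r; [exact: Gker_ge0|exact: FC].
- by apply: integrableZl => //; exact: integrable_Gker_sub.
Qed.

Lemma EFin_conv F x : bcont F ->
  ((Defs.conv Gker F x)%:E = \int[mu]_y (Gker (x - y) * F y)%:E)%E.
Proof.
by move=> bF; rewrite fineK//; apply: integrable_fin_num => //; exact: integrable_conv.
Qed.

Lemma conv_ge0 F x : (forall y, 0 <= F y) -> 0 <= Defs.conv Gker F x.
Proof.
by move=> F0; apply: fine_ge0; apply: integral_ge0 => y _; rewrite lee_fin mulr_ge0 ?Gker_ge0.
Qed.

Lemma conv_le_sup F x C : bcont F -> (forall y, `|F y| <= C) ->
  Defs.conv Gker (fun y => `|F y|) x <= C.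
Proof.
move=> bF FC; have C0 : 0 <= C by exact: le_trans (FC 0).
rewrite -lee_fin EFin_conv; last exact: bcont_norm.
apply: (@le_trans _ _ (\int[mu]_y (C%:E * (Gker (x - y))%:E))%E).
  apply: ge0_le_integral => //.
  - by move=> y _; rewrite lee_fin mulr_ge0 ?Gker_ge0.
  - have := measurable_int mu (integrable_conv x (bcont_norm bF)); exact.
  - by apply: emeasurable_funM => //; apply/measurable_EFinP; exact: measurable_Gker_sub.
  - by move=> y _; rewrite -EFinM lee_fin mulrC ler_wpM2r ?Gker_ge0.
rewrite ge0_integralZl_EFin//; last 2 first.
- by move=> y _; rewrite lee_fin Gker_ge0.
- by apply/measurable_EFinP; exact: measurable_Gker_sub.
by rewrite integral_Gker_sub mule1.
Qed.

(** From [|x - y| <= |x + z - y| + z]: the kernel changes by a factor [e^z] at most. This compares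
    all values of the convolution on a short interval with the one at its left end. *)
Lemma conv_shift_le F x z : 0 <= z -> bcont F -> (forall y, 0 <= F y) ->
  Defs.conv Gker F (x + z) <= expR z * Defs.conv Gker F x.
Proof.
move=> z0 bF F0; rewrite /Defs.conv -!/(Rintegral mu setT _) -RintegralZl//; last exact: integrable_conv.
apply: le_Rintegral => //; first exact: integrable_conv.
- have := integrableZl measurableT (expR z) (integrable_conv x bF).
  by apply: eq_integrable => // y _ /=; rewrite EFinM.
move=> y _; rewrite mulrA ler_wpM2r// /Gker mulrCA ler_wpM2l ?invr_ge0// -expRD ler_expR.
rewrite lerNl opprD opprK addrC lerBlDl.
have -> : x - y = (x + z - y) - z by ring.
by rewrite (le_trans (ler_normB _ _))// [`|z|]ger0_norm// addrC.
Qed.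
(* The part of [Gker * F] coming from [y <= x]; the part from [y >= x] is
   its mirror image. *)
Definition lconv F x := 2^-1 * (expR (- x) * \int[mu]_(y in `]-oo, x]) (expR y * F y)).
Definition rconv F x := lconv (F \o -%R) (- x).

Lemma bcont_opp F : bcont F -> bcont (F \o -%R).
Proof.
move=> [cF [C FC]]; split; last by exists C => x; exact: FC.
by move=> x; apply: continuous_comp; [exact: opp_continuous|exact: cF].
Qed.

Lemma Gker_sub_le x y : y <= x -> Gker (x - y) = 2^-1 * (expR (- x) * expR y) :> R.
Proof. by move=> yx; rewrite /Gker ger0_norm ?subr_ge0// opprB addrC expRD. Qed.

Lemma integrable_expR_mul F x : bcont F ->
  mu.-integrable `]-oo, x] (EFin \o (fun y => expR y * F y)).
Proof.
move=> bF.
have icx : mu.-integrable `]-oo, x] (EFin \o (fun y => Gker (x - y) * F y)).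
  by apply: integrableS (integrable_conv x bF).
have : mu.-integrable `]-oo, x] (fun y => (2 * expR x)%:E * (Gker (x - y) * F y)%:E)%E.
  exact: integrableZl.
apply: eq_integrable => // y; rewrite inE/= in_itv/= => yx.
rewrite /= -EFinM Gker_sub_le//; congr EFin.
have := expR_gt0 x; rewrite expRN => /gt_eqF/negbT e0.
by field.
Qed.

Lemma is_derive_lconv F x : bcont F ->
  is_derive x 1 (lconv F) (2^-1 * F x - lconv F x).
Proof.
move=> bF; have [cF _] := bF.
have [d1 d2] : derivable (fun x => \int[mu]_(y in `]-oo, x]) (expR y * F y)) x 1 /\
    (fun x => \int[mu]_(y in `]-oo, x]) (expR y * F y))^`()%classic x = expR x * F x.
  apply: (@continuous_FTC1 _ (fun y => expR y * F y) -oo%O x (x + 1)).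
  - by rewrite ltrDl.
  - exact: integrable_expR_mul.
  - by rewrite ltNyr.
  - by apply: continuousM; [exact: continuous_expR|exact: cF].
have dI : is_derive x 1 (fun x => \int[mu]_(y in `]-oo, x]) (expR y * F y)) (expR x * F x).
  by split; [exact: d1|rewrite -derive1E; exact: d2].
apply: is_derive_eq; rewrite /lconv /GRing.scale/=.
have e0 : expR (- x) * expR x = 1 by rewrite -expRD addNr expR0.
by rewrite [expR (- x) * (expR x * _)]mulrA e0; ring.
Qed.

Lemma is_derive_rconv F x : bcont F ->
  is_derive x 1 (rconv F) (rconv F x - 2^-1 * F x).
Proof.
move=> bF; have := is_derive_lconv (- x) (bcont_opp bF); rewrite /= opprK => d.
have -> : rconv F x - 2^-1 * F x = (2^-1 * F x - lconv (F \o -%R) (- x)) * -1.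
  by rewrite mulrN1 opprB.
exact: (is_derive1_comp d).
Qed.

Lemma convE F x : bcont F -> Defs.conv Gker F x = lconv F x + rconv F x.
Proof.
move=> bF; have icF := integrable_conv x bF.
have -> : Defs.conv Gker F x = \int[mu]_y (Gker (x - y) * F y) by [].
rewrite -(setUv `]-oo, x]) Rintegral_setU//=; last 3 first.
- exact: measurableC.
- by rewrite setUv.
- by apply/disj_setPCl.
congr (_ + _).
  rewrite /lconv -RintegralZl//; last exact: integrable_expR_mul.
  rewrite -RintegralZl//; last first.
    have : mu.-integrable `]-oo, x] (fun y => (expR (- x))%:E * (expR y * F y)%:E)%E.
      by apply: integrableZl => //; exact: integrable_expR_mul.
    by apply: eq_integrable => // y _ /=; rewrite EFinM.
  apply: eq_Rintegral => y; rewrite inE/= in_itv/= => yx.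
  by rewrite Gker_sub_le// !mulrA.
have -> : ~` `]-oo, x] = `]x, +oo[%classic :> set R.
  by rewrite setCitvl.
rewrite Rintegral_mkcond -Rintegral_opp; last first.
  apply/(measurable_restrictT _ _).1 => //; apply: measurable_funTS.
  by have /measurable_int/measurable_EFinP := icF.
have irF : mu.-integrable `]-oo, (- x)%R] (EFin \o (fun y => 2^-1 * (expR x * (expR y * F (- y))))).
  have : mu.-integrable `]-oo, (- x)%R]
      (fun y => (2^-1 * expR x)%:E * (expR y * (F \o -%R) y)%:E)%E.
    by apply: integrableZl => //; exact: integrable_expR_mul (bcont_opp bF).
  by apply: eq_integrable => // y _ /=; rewrite -EFinM -mulrA.
rewrite /rconv /lconv opprK.
transitivity (\int[mu]_(y in `]-oo, (- x)%R]) (2^-1 * (expR x * (expR y * F (- y))))).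
  rewrite -Rintegral_itv_bndo_bndc; last first.
    by apply: integrableS irF => //; apply: subset_itvl; rewrite bnd_simp.
  rewrite [RHS]Rintegral_mkcond; apply: eq_Rintegral => y _.
  rewrite !patchE; have -> : (- y \in `]x, +oo[%classic) = (y \in `]-oo, (- x)%R[%classic).
    by rewrite !mem_setE/= !in_itv/= andbT ltrNr.
  case: ifPn => //; rewrite mem_setE/= in_itv/= => yx.
  have xy : x + y <= 0 by rewrite -lerBrDl sub0r ltW.
  rewrite /Gker opprK (ler0_norm xy).
  by rewrite opprK expRD !mulrA.
rewrite RintegralZl//; last first.
  have : mu.-integrable `]-oo, (- x)%R]
      (fun y => (expR x)%:E * (expR y * (F \o -%R) y)%:E)%E.
    by apply: integrableZl => //; exact: integrable_expR_mul (bcont_opp bF).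
  by apply: eq_integrable => // y _ /=; rewrite -EFinM.
by rewrite RintegralZl//; exact: integrable_expR_mul (bcont_opp bF).
Qed.

Definition dconv F x := rconv F x - lconv F x.

(** The boundary terms [F / 2] of the two halves have opposite signs and cancel, since [G] is
    continuous at 0. *)
Lemma is_derive_conv F x : bcont F -> is_derive x 1 (Defs.conv Gker F) (dconv F x).
Proof.
move=> bF; have -> : Defs.conv Gker F = (fun x => lconv F x + rconv F x).
  by apply/funext => z; exact: convE.
have d1 := is_derive_lconv x bF; have d2 := is_derive_rconv x bF.
by apply: is_derive_eq; rewrite /dconv; ring.
Qed.

(** Here the two boundary terms add up to [- F]: this is [G'' = G - delta]. *)
Lemma is_derive_dconv F x : bcont F ->
  is_derive x 1 (dconv F) (Defs.conv Gker F x - F x).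
Proof.
move=> bF; rewrite (convE x bF).
have d1 := is_derive_lconv x bF; have d2 := is_derive_rconv x bF.
by apply: is_derive_eq; field.
Qed.

Lemma normr_lconv F x : bcont F -> `|lconv F x| <= lconv (fun y => `|F y|) x.
Proof.
move=> bF; rewrite /lconv normrM [`|2^-1|]ger0_norm ?invr_ge0//.
rewrite ler_wpM2l ?invr_ge0// normrM [`|expR _|]ger0_norm ?expR_ge0//.
rewrite ler_wpM2l ?expR_ge0//.
apply: le_trans; first by apply: le_normr_Rintegral => //; exact: integrable_expR_mul.
rewrite le_eqVlt; apply/orP; left; apply/eqP; apply: eq_Rintegral => y _.
by rewrite normrM [`|expR _|]ger0_norm ?expR_ge0.
Qed.

(** [dconv] has the odd kernel [G'], and [|G'| = G] away from 0. *)
Lemma normr_dconv F x : bcont F -> `|dconv F x| <= Defs.conv Gker (fun y => `|F y|) x.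
Proof.
move=> bF; rewrite convE; last exact: bcont_norm.
rewrite addrC (le_trans (ler_normB _ _))//; apply: lerD.
  exact: normr_lconv (bcont_opp bF).
exact: normr_lconv.
Qed.

Lemma normr_conv F x : bcont F ->
  `|Defs.conv Gker F x| <= Defs.conv Gker (fun y => `|F y|) x.
Proof.
move=> bF; rewrite [leRHS]convE; last exact: bcont_norm.
rewrite (convE x bF) addrC [leRHS]addrC (le_trans (ler_normD _ _))//; apply: lerD.
  exact: normr_lconv (bcont_opp bF).
exact: normr_lconv.
Qed.

Lemma lconvB F1 F2 x : bcont F1 -> bcont F2 ->
  lconv (fun y => F1 y - F2 y) x = lconv F1 x - lconv F2 x.
Proof.
move=> b1 b2; rewrite /lconv -!mulrBr; do 2 congr (_ * _).
rewrite -RintegralB//; [|exact: integrable_expR_mul..].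
by apply: eq_Rintegral => y _; rewrite mulrBr.
Qed.

Lemma dconvB F1 F2 x : bcont F1 -> bcont F2 ->
  dconv (fun y => F1 y - F2 y) x = dconv F1 x - dconv F2 x.
Proof.
move=> b1 b2; rewrite /dconv lconvB// /rconv.
rewrite -[(fun y => F1 y - F2 y) \o -%R]/(fun y => (F1 \o -%R) y - (F2 \o -%R) y).
by rewrite lconvB; [ring|exact: bcont_opp..].
Qed.

Lemma bcont_dconv F : bcont F -> bcont (dconv F).
Proof.
move=> bF; split; first by move=> x; exact: is_derive1_continuous (is_derive_dconv x bF).
have [_ [C FC]] := bF; exists C => x.
by rewrite (le_trans (normr_dconv x bF))//; exact: conv_le_sup.
Qed.
(** * Sobolev embedding through B-spline averages *)

Lemma max0E x : Num.max x 0 = 2^-1 * (x + `|x|).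
Proof. by rewrite maxr_absE addr0 subr0 mulrC. Qed.

(** At the kink, [max(y, 0)^(n+1)] is a Caratheodory slope function; it is continuous and vanishes
    there because the exponent is positive. *)
Lemma is_derive_max0X n x :
  is_derive x 1 (fun y => Num.max y 0 ^+ n.+2) (n.+2%:R * Num.max x 0 ^+ n.+1).
Proof.
have [x0|x0|->] := ltgtP x 0.
- rewrite expr0n mulr0.
  apply: (@near_eq_is_derive _ _ _ (cst 0)).
  near=> y; rewrite max_r ?expr0n// ltW//; near: y; exact: lt_nbhsl.
- apply: (@near_eq_is_derive _ _ _ (fun y => y ^+ n.+2)).
    near=> y; rewrite max_l// ltW//; near: y; exact: lt_nbhsr.
  apply: DeriveDef; first exact: exprn_derivable.
  by rewrite exp_derive /GRing.scale/= mulr1.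
- apply/is_derive1_caratheodory; exists (fun y => Num.max y 0 ^+ n.+1); split.
  + move=> z; rewrite maxxx expr0n/= !subr0 exprSr.
    have [z0|z0] := leP z 0; first by rewrite !expr0n/= !mul0r.
    by [].
  + apply: (@continuous_comp _ _ _ (fun y : R => Num.max y 0) (fun z => z ^+ n.+1)); last exact: exprn_continuous.
    have -> : (fun z => Num.max z 0) = (fun z => 2^-1 * (z + `|z|)).
      by apply/funext => z; exact: max0E.
    apply: continuousM; first exact: cst_continuous.
    by apply: continuousD; [exact: cvg_id|exact: norm_continuous].
  + by rewrite maxxx !expr0n/= mulr0.
Unshelve. all: by end_near. Qed.
(* The quadratic B-spline with knots 0, 1, 2, 3, its derivative and its
   primitive. *)
Definition third_diff f x := f x - 3 * f (x - 1) + 3 * f (x - 2) - f (x - 3).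
Definition bspline x := 2^-1 * third_diff (fun y => Num.max y 0 ^+ 2) x.
Definition bspline' x := third_diff (fun y => Num.max y 0 ^+ 1) x.
Definition bspline_primitive x := 6^-1 * third_diff (fun y => Num.max y 0 ^+ 3) x.

Lemma is_derive_third_diff f f' x : (forall y, is_derive y 1 f (f' y)) ->
  is_derive x 1 (third_diff f) (third_diff f' x).
Proof.
move=> df.
have d k : is_derive x 1 (fun y => f (y - k)) (f' (x - k)).
  rewrite -[f' _]mulr1; apply: (@is_derive1_comp _ f (fun y => y - k)) => //.
  by apply: is_derive_eq; rewrite oppr0 addr0.
have d0 := df x; have d1 := d 1; have d2 := d 2; have d3 := d 3.
by apply: is_derive_eq; rewrite /GRing.scale/= /third_diff; ring.
Qed.

Lemma is_derive_bspline x : is_derive x 1 bspline (bspline' x).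
Proof.
have d := is_derive_third_diff x (@is_derive_max0X 0).
by apply: is_derive_eq; rewrite /GRing.scale/= /bspline' /third_diff; field.
Qed.

Lemma is_derive_bspline_primitive x : is_derive x 1 bspline_primitive (bspline x).
Proof.
have d := is_derive_third_diff x (@is_derive_max0X 1).
by apply: is_derive_eq; rewrite /GRing.scale/= /bspline /third_diff; field.
Qed.

Lemma max0_le0 x : x <= 0 -> Num.max x 0 = 0 :> R. Proof. by move=> /max_r. Qed.
Lemma max0_ge0 x : 0 <= x -> Num.max x 0 = x :> R. Proof. by move=> /max_l. Qed.

Lemma third_diff_max0_le0 n x : x <= 0 -> third_diff (fun y => Num.max y 0 ^+ n.+1) x = 0.
Proof. by move=> x0; rewrite /third_diff !max0_le0 ?expr0n/=; try lra. Qed.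

Lemma bspline_le0 x : x <= 0 -> bspline x = 0.
Proof. by move=> x0; rewrite /bspline third_diff_max0_le0// mulr0. Qed.

Lemma bspline'_le0 x : x <= 0 -> bspline' x = 0.
Proof. by move=> x0; rewrite /bspline' third_diff_max0_le0. Qed.

Lemma bspline_primitive_le0 x : x <= 0 -> bspline_primitive x = 0.
Proof. by move=> x0; rewrite /bspline_primitive third_diff_max0_le0// mulr0. Qed.

(** Beyond the last knot the truncated powers are genuine powers. A third difference kills
    polynomials of degree at most 2 and sends [x^3] to 6, so there the spline vanishes and its
    primitive equals 1. *)
Lemma third_diff_max0_ge3 n x : 3 <= x ->
  third_diff (fun y => Num.max y 0 ^+ n) x = third_diff (fun y => y ^+ n) x.
Proof. by move=> x3; rewrite /third_diff !max0_ge0; lra. Qed.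

Lemma bspline_ge3 x : 3 <= x -> bspline x = 0.
Proof. by move=> x3; rewrite /bspline third_diff_max0_ge3// /third_diff; ring. Qed.

Lemma bspline'_ge3 x : 3 <= x -> bspline' x = 0.
Proof. by move=> x3; rewrite /bspline' third_diff_max0_ge3// /third_diff; ring. Qed.

Lemma bspline_primitive_ge3 x : 3 <= x -> bspline_primitive x = 1.
Proof. by move=> x3; rewrite /bspline_primitive third_diff_max0_ge3// /third_diff; field. Qed.

(** [8 = 1 + 3 + 3 + 1] is the sum of the absolute coefficients. With the prefactors 1/2, 1 and 1/6
    this crude bound gives the constants 36, 24 and 36 below. *)
Lemma third_diff_max0_bound n x : 0 <= x <= 3 ->
  `|third_diff (fun y => Num.max y 0 ^+ n) x| <= 8 * 3 ^+ n.
Proof.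
move=> /andP[x0 x3].
have h k : 0 <= k -> 0 <= Num.max (x - k) 0 ^+ n <= 3 ^+ n.
  move=> k0; rewrite exprn_ge0 ?le_max ?lexx ?orbT//=.
  apply: lerXn2r; rewrite ?nnegrE ?le_max ?lexx ?orbT//.
  by rewrite ge_max; apply/andP; split; lra.
have := h 0 (lexx _); have := h 1 ler01; have := h 2 (ler0n _ _); have := h 3 (ler0n _ _).
rewrite subr0 /third_diff ler_norml.
move: (Num.max x 0 ^+ n) (Num.max (x - 1) 0 ^+ n) (Num.max (x - 2) 0 ^+ n)
  (Num.max (x - 3) 0 ^+ n) (3 ^+ n : R) => a b c d e.
by move=> /andP[d0 de] /andP[c0 ce] /andP[b0 be] /andP[a0 ae]; apply/andP; split; lra.
Qed.

Lemma bspline_bound x : `|bspline x| <= 36.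
Proof.
have [x0|x0] := leP x 0; first by rewrite bspline_le0// normr0.
have [x3|x3] := leP 3 x; first by rewrite bspline_ge3// normr0.
rewrite normrM ger0_norm ?invr_ge0//.
have x03 : 0 <= x <= 3 by rewrite !ltW.
by have := third_diff_max0_bound 2 x03; lra.
Qed.

Lemma bspline'_bound x : `|bspline' x| <= 24.
Proof.
have [x0|x0] := leP x 0; first by rewrite bspline'_le0// normr0.
have [x3|x3] := leP 3 x; first by rewrite bspline'_ge3// normr0.
have x03 : 0 <= x <= 3 by rewrite !ltW.
by have := third_diff_max0_bound 1 x03; rewrite /bspline'; lra.
Qed.

Lemma bspline_primitive_bound x : `|bspline_primitive x| <= 36.
Proof.
have [x0|x0] := leP x 0; first by rewrite bspline_primitive_le0// normr0.
have [x3|x3] := leP 3 x; first by rewrite bspline_primitive_ge3// normr1; lra.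
rewrite normrM ger0_norm ?invr_ge0//.
have x03 : 0 <= x <= 3 by rewrite !ltW.
by have := third_diff_max0_bound 3 x03; lra.
Qed.

Lemma continuous_bspline' : continuous bspline'.
Proof.
have cm : continuous (fun y => Num.max y 0 ^+ 1 : R).
  have -> : (fun z => Num.max z 0 ^+ 1) = (fun z => 2^-1 * (z + `|z|)).
    by apply/funext => z; rewrite expr1 max0E.
  apply: continuous_mul; first exact: cst_continuous.
  by apply: continuous_add => y; [exact: cvg_id|exact: norm_continuous].
have cs k : continuous (fun y => Num.max (y - k) 0 ^+ 1 : R).
  move=> y; apply: (@continuous_comp _ _ _ (fun y => y - k) (fun y => Num.max y 0 ^+ 1)).
    by apply: continuousB; [exact: cvg_id|exact: cvg_cst].
  exact: cm.
have -> : bspline' = (fun x => Num.max x 0 ^+ 1 + (-3) * (Num.max (x - 1) 0 ^+ 1) +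
    3 * (Num.max (x - 2) 0 ^+ 1) + (-1) * (Num.max (x - 3) 0 ^+ 1)).
  by apply/funext => x; rewrite /bspline' /third_diff; ring.
do 3 (apply: continuous_add; last by apply: continuous_mul; [exact: cst_continuous|exact: cs]).
exact: cm.
Qed.

(** * Averaging kernels at scale [r] *)

Implicit Types (r lam : R).

(** A bump of mass 1 on [[a, a + 3 r]]. The quadratic spline is exactly smooth enough to be a C^1
    test function for [weak_deriv]. *)
Definition avg_kernel a r y := r^-1 * bspline (r^-1 * (y - a)).
Definition avg_kernel' a r y := r^-1 * (r^-1 * bspline' (r^-1 * (y - a))).
Definition avg_step a r y := bspline_primitive (r^-1 * (y - a)).

Lemma is_derive_affine a r y : is_derive y 1 (fun z => r^-1 * (z - a)) r^-1.
Proof. by apply: is_derive_eq; rewrite /GRing.scale/= oppr0 addr0 mulr1. Qed.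

Lemma is_derive_avg_kernel a r y :
  is_derive y 1 (avg_kernel a r) (avg_kernel' a r y).
Proof.
have d1 : is_derive y 1 (fun z => bspline (r^-1 * (z - a)))
    (bspline' (r^-1 * (y - a)) * r^-1).
  exact: (is_derive1_comp (is_derive_bspline _) (is_derive_affine a r y)).
by apply: is_derive_eq; rewrite /GRing.scale/= /avg_kernel'; ring.
Qed.

Lemma is_derive_avg_step a r y : is_derive y 1 (avg_step a r) (avg_kernel a r y).
Proof.
rewrite /avg_kernel mulrC.
exact: (is_derive1_comp (is_derive_bspline_primitive _) (is_derive_affine a r y)).
Qed.

Lemma continuous_avg_kernel a r : continuous (avg_kernel a r).
Proof. by move=> y; exact: is_derive1_continuous (is_derive_avg_kernel a r y). Qed.

Lemma continuous_avg_step a r : continuous (avg_step a r).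
Proof. by move=> y; exact: is_derive1_continuous (is_derive_avg_step a r y). Qed.

Lemma continuous_avg_kernel' a r : continuous (avg_kernel' a r).
Proof.
apply: continuous_mul; first exact: cst_continuous.
apply: continuous_mul; first exact: cst_continuous.
move=> y; apply: (@continuous_comp _ _ _ (fun z => r^-1 * (z - a)) bspline').
  exact: is_derive1_continuous (is_derive_affine a r y).
exact: continuous_bspline'.
Qed.

Section avg_kernel_bounds.
Variables (a r : R).
Hypothesis r0 : 0 < r.

Let scale_le0 y : y <= a -> r^-1 * (y - a) <= 0.
Proof. by move=> ya; rewrite mulr_ge0_le0 ?invr_ge0 ?(ltW r0)// subr_le0. Qed.

Let scale_ge3 y : a + 3 * r <= y -> 3 <= r^-1 * (y - a).
Proof. by move=> ya; rewrite mulrC ler_pdivlMr// lerBrDl. Qed.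

Lemma avg_kernel_out y : ~~ (a <= y <= a + 3 * r) -> avg_kernel a r y = 0.
Proof.
rewrite negb_and -!ltNge => /orP[/ltW/scale_le0 h|/ltW/scale_ge3 h].
  by rewrite /avg_kernel bspline_le0// mulr0.
by rewrite /avg_kernel bspline_ge3// mulr0.
Qed.

Lemma avg_kernel'_out y : ~~ (a <= y <= a + 3 * r) -> avg_kernel' a r y = 0.
Proof.
rewrite negb_and -!ltNge => /orP[/ltW/scale_le0 h|/ltW/scale_ge3 h].
  by rewrite /avg_kernel' bspline'_le0// !mulr0.
by rewrite /avg_kernel' bspline'_ge3// !mulr0.
Qed.

Lemma avg_step_le y : y <= a -> avg_step a r y = 0.
Proof. by move=> /scale_le0 h; rewrite /avg_step bspline_primitive_le0. Qed.

Lemma avg_step_ge y : a + 3 * r <= y -> avg_step a r y = 1.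
Proof. by move=> /scale_ge3 h; rewrite /avg_step bspline_primitive_ge3. Qed.

Lemma avg_kernel_bound y : `|avg_kernel a r y| <= 36 / r.
Proof.
rewrite normrM gtr0_norm ?invr_gt0// mulrC ler_wpM2r ?invr_ge0 ?(ltW r0)//.
exact: bspline_bound.
Qed.

Lemma avg_kernel'_bound y : `|avg_kernel' a r y| <= 24 / r ^+ 2.
Proof.
rewrite normrM [`|r^-1|]gtr0_norm ?invr_gt0// normrM [`|r^-1|]gtr0_norm ?invr_gt0//.
rewrite mulrA -invfM -expr2 mulrC ler_wpM2r ?invr_ge0 ?exprn_ge0 ?(ltW r0)//.
exact: bspline'_bound.
Qed.

Lemma test_fun_avg_kernel : test_fun (avg_kernel a r).
Proof.
split; first by move=> y; have [] := is_derive_avg_kernel a r y.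
split.
  have -> : derive1 (avg_kernel a r) = avg_kernel' a r.
    by apply/funext => y; exact: is_derive1E (is_derive_avg_kernel a r y).
  exact: continuous_avg_kernel'.
exists (`|a| + 3 * r) => y yar; apply: avg_kernel_out.
apply/negP => /andP[ay yr]; move: yar; apply/negP; rewrite -leNgt ler_norml.
have := ler_norm a; have := ler_norm (- a); rewrite normrN => h1 h2.
by apply/andP; split; have := r0; lra.
Qed.

End avg_kernel_bounds.

(** A single step stays equal to 1 on the right; only the difference of two steps has compact
    support. Its derivative is the difference of two averaging kernels, so a weak derivative can be
    used to compare two scales. *)
Lemma test_fun_avg_step a r r' : 0 < r' -> r' <= r ->
  test_fun (fun y => avg_step a r y - avg_step a r' y).
Proof.
move=> r'0 r'r; have r0 : 0 < r by exact: lt_le_trans r'r.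
have d y : is_derive y 1 (fun y => avg_step a r y - avg_step a r' y)
    (avg_kernel a r y - avg_kernel a r' y).
  have d1 := is_derive_avg_step a r y; have d2 := is_derive_avg_step a r' y.
  by apply: is_derive_eq.
split; first by move=> y; have [] := d y.
split.
  have -> : derive1 (fun y => avg_step a r y - avg_step a r' y) =
      (fun y => avg_kernel a r y - avg_kernel a r' y).
    by apply/funext => y; exact: is_derive1E (d y).
  by move=> y; apply: continuousB; exact: continuous_avg_kernel.
exists (`|a| + 3 * r) => y yar.
have := ler_norm a; have := ler_norm (- a); rewrite normrN => h1 h2.
have [ya|ya] := leP y a; first by rewrite !avg_step_le// subr0.
have y3 : a + 3 * r <= y.
  move: yar; have [y0|y0] := leP 0 y; first by rewrite (ger0_norm y0); lra.
  by rewrite (ltr0_norm y0); lra.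
by rewrite !avg_step_ge// ?subrr//; lra.
Qed.

Lemma avg_step_sub_out a r r' y : 0 < r' -> r' <= r ->
  ~~ (a <= y <= a + 3 * r) -> avg_step a r y - avg_step a r' y = 0.
Proof.
move=> r'0 r'r; have r0 : 0 < r by exact: lt_le_trans r'r.
rewrite negb_and -!ltNge => /orP[/ltW h|/ltW h].
  by rewrite !avg_step_le// subr0.
by rewrite !avg_step_ge// ?subrr//; lra.
Qed.

Lemma avg_step_sub_bound a r r' y : `|avg_step a r y - avg_step a r' y| <= 72.
Proof.
have -> : 72 = 36 + 36 :> R by ring.
by rewrite (le_trans (ler_normB _ _))// lerD// bspline_primitive_bound.
Qed.

Lemma integral_indic_itv a b : a <= b ->
  (\int[mu]_x (\1_(`[a, b]%classic : set R) x)%:E = (b - a)%:E)%E.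
Proof.
move=> ab; rewrite integral_indic// setIT.
have := @lebesgue_measure_itv R `[a, b]; rewrite /= lte_fin => ->.
by case: ltgtP ab => // -> _; rewrite subrr.
Qed.

(* AM-GM: [|g h| <= c / 2 * (lambda + g^2 / lambda)] on the support of [h]. *)
Lemma integral_amgm (g h : R -> R) a b c S lam :
  measurable_fun setT g -> measurable_fun setT h -> a <= b -> 0 < lam ->
  (forall x, `|h x| <= c) -> (forall x, ~~ (a <= x <= b) -> h x = 0) ->
  (\int[mu]_x (g x ^+ 2)%:E <= S%:E)%E ->
  (\int[mu]_x `|(g x * h x)%:E| <= (c / 2 * (lam * (b - a) + S / lam))%:E)%E.
Proof.
move=> mg mh ab lam0 hc h0 gS.
have c0 : 0 <= c by exact: le_trans (hc 0).
have mg2 : measurable_fun setT (fun x => g x ^+ 2).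
  by apply: measurable_funX.
have cl : 0 <= c / 2 * lam by rewrite mulr_ge0 ?divr_ge0// ltW.
have cl' : 0 <= c / 2 / lam by rewrite divr_ge0 ?divr_ge0// ltW.
pose u x : \bar R := ((c / 2 * lam)%:E * (\1_(`[a, b]%classic : set R) x)%:E +
   (c / 2 / lam)%:E * (g x ^+ 2)%:E)%E.
apply: (@le_trans _ _ (\int[mu]_x u x)%E).
  apply: ge0_le_integral => //.
  - apply: measurableT_comp => //; apply/measurable_EFinP; exact: measurable_funM.
  - apply: emeasurable_funD.
      apply: emeasurable_funM => //; apply/measurable_EFinP.
      exact: measurable_indic.
    by apply: emeasurable_funM => //; exact/measurable_EFinP.
  move=> x _; rewrite /u -!EFinM -EFinD lee_fin.
  have [xab|xab] := boolP (a <= x <= b); last first.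
    by rewrite h0// mulr0 normr0; apply: addr_ge0; apply: mulr_ge0 => //; exact: sqr_ge0.
  rewrite indicE mem_set/=; last by rewrite in_itv.
  rewrite mulr1 normrM.
  apply: (@le_trans _ _ (`|g x| * c)); first exact: ler_wpM2l.
  rewrite -(real_normK (num_real (g x))).
  have H : 0 <= c / 2 / lam * (lam - `|g x|) ^+ 2.
    by rewrite mulr_ge0 ?sqr_ge0.
  rewrite -subr_ge0; suff -> : c / 2 * lam + c / 2 / lam * `|g x| ^+ 2 - `|g x| * c =
     c / 2 / lam * (lam - `|g x|) ^+ 2 by [].
  by field; rewrite gt_eqF.
rewrite ge0_integralD//; last 4 first.
- by move=> x _; rewrite -EFinM lee_fin mulr_ge0.
- apply: emeasurable_funM => //; apply/measurable_EFinP; exact: measurable_indic.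
- by move=> x _; rewrite -EFinM lee_fin mulr_ge0 ?sqr_ge0.
- by apply: emeasurable_funM => //; exact/measurable_EFinP.
rewrite mulrDr EFinD; apply: leeD.
  rewrite ge0_integralZl_EFin//; last first.
    apply/measurable_EFinP; exact: measurable_indic.
  by rewrite integral_indic_itv// -EFinM mulrA.
rewrite ge0_integralZl_EFin//; last 2 first.
- by move=> x _; rewrite lee_fin sqr_ge0.
- exact/measurable_EFinP.
have -> : c / 2 * (S / lam) = c / 2 / lam * S by rewrite mulrCA mulrC.
by rewrite [in leRHS]EFinM; apply: lee_wpmul2l.
Qed.
Lemma derive_bound_lipschitz (h h' : R -> R) (L : R) :
  (forall x, is_derive x 1 h (h' x)) -> (forall x, `|h' x| <= L) ->
  forall x y, `|h x - h y| <= L * `|x - y|.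
Proof.
move=> dh hL; have key x y : x <= y -> `|h y - h x| <= L * `|y - x|.
  move=> xy; have [|c _ ->] := @MVT_segment R h h' x y xy.
    by apply: continuous_subspaceT => z; exact: is_derive1_continuous (dh z).
  by rewrite normrM ler_wpM2r.
move=> x y; have [xy|/ltW yx] := leP x y; last exact: key.
by rewrite distrC [`|x - y|]distrC; exact: key.
Qed.

Lemma geometric_tail (u : nat -> R) (l K q : R) : 0 <= q < 1 ->
  (forall n, `|u n - u n.+1| <= K * q ^+ n) -> u @ \oo --> l ->
  forall n, `|u n - l| <= K * q ^+ n / (1 - q).
Proof.
move=> /andP[q0 q1] uq ul n.
have K0 : 0 <= K by have := uq 0%N; rewrite expr0 mulr1; exact: le_trans.
have q1' : 0 < 1 - q by rewrite subr_gt0.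
have Kq m : 0 <= K * q ^+ m by rewrite mulr_ge0// exprn_ge0.
have part k : `|u n - u (n + k)%N| <= K * q ^+ n * (1 - q ^+ k) / (1 - q).
  elim: k => [|k ih]; first by rewrite addn0 subrr normr0 expr0 subrr mulr0 mul0r.
  have -> : u n - u (n + k.+1)%N = (u n - u (n + k)%N) + (u (n + k)%N - u (n + k).+1).
    by rewrite addnS; ring.
  rewrite (le_trans (ler_normD _ _))//; apply: (le_trans (lerD ih (uq _))).
  rewrite le_eqVlt; apply/orP; left; apply/eqP; rewrite exprD exprS; field.
  by rewrite gt_eqF.
apply/ler_addgt0Pr => e e0.
have /cvgrPdist_le/(_ _ e0) [N _ uN] := ul.
have -> : u n - l = (u n - u (n + N)%N) - (l - u (n + N)%N) by ring.
rewrite (le_trans (ler_normB _ _))// lerD//; last by apply: uN; rewrite /= leq_addl.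
apply: (le_trans (part N)); rewrite ler_wpM2r ?invr_ge0 ?(ltW q1')// ler_piMr//.
by rewrite gerBl exprn_ge0.
Qed.

Lemma cvg_pow4V : (4 ^+ n : R)^-1 @[n --> \oo] --> 0.
Proof.
under eq_cvg do rewrite -exprVn.
by apply: cvg_expr; rewrite ger0_norm ?invr_ge0// invf_lt1// ltr1n.
Qed.

Lemma near_derive1 f a e : derivable f a 1 -> 0 < e ->
  exists2 d : R, 0 < d & forall y, `|y - a| < d ->
    `|f y - (f a + derive1 f a * (y - a))| <= e * `|y - a|.
Proof.
move=> df e0; have : is_derive a 1 f (derive1 f a).
  by split => //; rewrite derive1E.
move=> /is_derive1_caratheodory[G [fG cG <-]].
have /cvgrPdist_le/(_ _ e0)/nbhs_ballP[d /= d0 dG] := cG.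
exists d => // y yd.
have -> : f y - (f a + G a * (y - a)) = - ((G a - G y) * (y - a)).
  by rewrite mulrBl -(fG y); ring.
rewrite normrN normrM ler_wpM2r//; apply: dG.
by rewrite /ball/= distrC.
Qed.

Lemma integrable_itv_continuous f a b : continuous f ->
  mu.-integrable `[a, b] (EFin \o f).
Proof.
move=> cf; apply: continuous_compact_integrable; first exact: segment_compact.
exact: continuous_subspaceT.
Qed.

Lemma Rintegral_support f a b : (forall x, ~~ (a <= x <= b) -> f x = 0) ->
  \int[mu]_x f x = \int[mu]_(x in `[a, b]) f x.
Proof.
move=> f0; rewrite [RHS]Rintegral_mkcond; apply: eq_Rintegral => x _.
rewrite patchE; case: ifPn => //; rewrite notin_setE/= in_itv/= => /negP h.
exact: f0.
Qed.

(** * Averages of a weak derivative at shrinking scales *)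

Section weak_derivative.
Variables (f g : R -> R) (e : R).
Hypothesis df : forall x, derivable f x 1.
Hypothesis mg : measurable_fun setT g.
Hypothesis wfg : weak_deriv f g.
Hypothesis e0 : 0 < e.
Hypothesis ge : (\int[mu]_x (g x ^+ 2)%:E <= (e ^+ 2)%:E)%E.

Let cf : continuous f.
Proof. by move=> x; exact/differentiable_continuous/derivable1_diffP. Qed.

(** [g] is only square integrable and has no value at [a]; its averages to the right of [a] take
    over that role. *)
Definition local_avg r a := \int[mu]_x (g x * avg_kernel a r x).

Lemma integrable_local_avg r a : 0 < r ->
  mu.-integrable setT (EFin \o (fun x => g x * avg_kernel a r x)).
Proof.
move=> r0; apply/integrableP; split.
  apply/measurable_EFinP; apply: measurable_funM => //.
  by apply: continuous_measurable_fun; exact: continuous_avg_kernel.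
have mh : measurable_fun setT (avg_kernel a r).
  by apply: continuous_measurable_fun; exact: continuous_avg_kernel.
have a3 : a <= a + 3 * r by rewrite lerDl mulr_ge0// ltW.
exact: le_lt_trans (integral_amgm mg mh a3 ltr01 (avg_kernel_bound a r0)
  (@avg_kernel_out a r r0) ge) (ltry _).
Qed.

(** [lam = e] balances the AM-GM bound: [36 / 2 (3 e + e) = 72 e]. *)
Lemma local_avg1_bound a : `|local_avg 1 a| <= 72 * e.
Proof.
rewrite -lee_fin EFin_normr_Rintegral//; last exact: integrable_local_avg.
have mh : measurable_fun setT (avg_kernel a 1).
  by apply: continuous_measurable_fun; exact: continuous_avg_kernel.
apply: le_trans.
  apply: le_abse_integral => //; apply/measurable_EFinP; exact: measurable_funM.
have a3 : a <= a + 3 * 1 by rewrite lerDl mulr1.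
apply: (le_trans (integral_amgm mg mh a3 e0 (avg_kernel_bound a ltr01)
  (@avg_kernel_out a 1 ltr01) ge)).
rewrite lee_fin (_ : 36 / 1 / 2 * _ = 72 * e)//.
by field; rewrite gt_eqF.
Qed.

Lemma local_avgE r a : 0 < r ->
  local_avg r a = - (\int[mu]_(x in `[a, (a + 3 * r)%R]) (f x * avg_kernel' a r x)).
Proof.
move=> r0; have := wfg (test_fun_avg_kernel a r0).
have -> : derive1 (avg_kernel a r) = avg_kernel' a r.
  by apply/funext => y; exact: is_derive1E (is_derive_avg_kernel a r y).
rewrite -Rintegral_support; last first.
  by move=> x xa; rewrite avg_kernel'_out// mulr0.
move=> /(congr1 fine); rewrite fineN => H.
by rewrite /local_avg /Rintegral H opprK.
Qed.

(** The derivative is moved onto the kernel and [f] is replaced by its tangent line at [a], for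
    which the average is exactly [f'(a)]. The error is at most [(eta / 216) (3 r)] for the function,
    times [24 / r^2] for the kernel, times the length [3 r]; hence [216 = 3 * 24 * 3]. *)
Lemma local_avg_cvg a (eta : R) : 0 < eta -> exists2 d : R, 0 < d & forall r, 0 < r -> r < d ->
  `|local_avg r a - derive1 f a| <= eta.
Proof.
move=> eta0; have p216 : (0 : R) < 216 by rewrite ltr0n.
have eta'0 : 0 < eta / 216 by exact: divr_gt0.
have [d d0 dE] := near_derive1 (@df a) eta'0.
exists (d / 3); first by rewrite divr_gt0 ?ltr0n.
move=> r r0 rd; rewrite local_avgE//.
set D : R := derive1 f a.
pose l y := f a + D * (y - a).
have cl : continuous l.
  by apply: continuous_add; [exact: cst_continuous|apply: continuous_mul;
    [exact: cst_continuous|move=> y; apply: continuousB; [exact: cvg_id|exact: cvg_cst]]].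
have ck : continuous (avg_kernel' a r) by exact: continuous_avg_kernel'.
have ar : a < a + 3 * r by rewrite ltrDl mulr_gt0.
have r3 : 0 <= 3 * r by rewrite mulr_ge0// ltW.
have I1 : \int[mu]_(x in `[a, (a + 3 * r)%R]) (l x * avg_kernel' a r x) = - D.
  pose Z y := l y * avg_kernel a r y - D * avg_step a r y.
  have dZ y : is_derive y 1 Z (l y * avg_kernel' a r y).
    have dl : is_derive y 1 l D.
      by apply: is_derive_eq; rewrite /GRing.scale/=; ring.
    have d1 := is_derive_avg_kernel a r y; have d2 := is_derive_avg_step a r y.
    by apply: is_derive_eq; rewrite /GRing.scale/=; ring.
  rewrite /Rintegral (@continuous_FTC2 _ _ Z)//=.
  - rewrite /Z (avg_step_le r0 (lexx a)) (avg_step_ge r0 (lexx _)) /avg_kernel.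
    have -> : r^-1 * (a + 3 * r - a) = 3 by field; rewrite gt_eqF.
    by rewrite subrr mulr0 bspline_ge3// bspline_le0//; ring.
  - by apply: continuous_subspaceT; exact: continuous_mul.
  - split; first by move=> y _; have [] := dZ y.
    + by apply: cvg_at_right_filter; exact: is_derive1_continuous (dZ a).
    + by apply: cvg_at_left_filter; exact: is_derive1_continuous (dZ _).
  - by move=> y _; exact: is_derive1E.
have cfl : continuous (fun x => f x - l x).
  by move=> y; apply: continuousB; [exact: cf|exact: cl].
have -> : - (\int[mu]_(x in `[a, (a + 3 * r)%R]) (f x * avg_kernel' a r x)) - D =
    - (\int[mu]_(x in `[a, (a + 3 * r)%R]) ((f x - l x) * avg_kernel' a r x)).
  under [in RHS]eq_Rintegral => x _ do rewrite mulrBl.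
  rewrite RintegralB//; last 2 first.
  - by apply: integrable_itv_continuous; exact: continuous_mul.
  - by apply: integrable_itv_continuous; exact: continuous_mul.
  by rewrite I1 opprD opprK.
rewrite normrN; apply: le_trans.
  apply: le_normr_Rintegral => //.
  by apply: integrable_itv_continuous; exact: continuous_mul.
apply: (@le_trans _ _ (\int[mu]_(x in `[a, (a + 3 * r)%R]) ((eta / 216 * (3 * r)) * (24 / r ^+ 2)))).
  apply: le_Rintegral => //.
  - by apply: integrable_itv_continuous; apply: continuous_normr; exact: continuous_mul.
  - by apply: integrable_itv_continuous; exact: cst_continuous.
  move=> x; rewrite /= in_itv/= => /andP[ax xr]; rewrite normrM.
  apply: ler_pM => //; last exact: avg_kernel'_bound.
  have xa : `|x - a| <= 3 * r by rewrite ger0_norm ?subr_ge0// lerBlDl.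
  apply: (le_trans (dE _ _)); first by apply: (le_lt_trans xa); rewrite mulrC -ltr_pdivlMr.
  exact: (ler_wpM2l (ltW eta'0)).
rewrite Rintegral_cst//= lebesgue_measure_itv/= lte_fin ar.
have -> : fine ((a + 3 * r)%:E + (- a)%:E) = 3 * r by rewrite -EFinD/=; ring.
by rewrite le_eqVlt; apply/orP; left; apply/eqP; field; rewrite gt_eqF.
Qed.

Lemma integrable_avg_kernel r a : 0 < r ->
  mu.-integrable setT (EFin \o avg_kernel a r).
Proof.
move=> r0; apply: (@eq_integrable _ _ R mu setT measurableT
  ((EFin \o avg_kernel a r) \_ `[a, (a + 3 * r)%R])).
  move=> x _; rewrite patchE; case: ifPn => //.
  by rewrite notin_setE/= in_itv/= => /negP h; rewrite avg_kernel_out.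
apply/integrable_restrict => //; rewrite setTI.
by apply: integrable_itv_continuous; exact: continuous_avg_kernel.
Qed.

Lemma Rintegral_avg_kernel r a : 0 < r -> \int[mu]_x avg_kernel a r x = 1.
Proof.
move=> r0; rewrite (Rintegral_support (avg_kernel_out r0)).
have ar : a < a + 3 * r by rewrite ltrDl mulr_gt0.
rewrite /Rintegral (@continuous_FTC2 _ _ (avg_step a r))//=.
- by rewrite (avg_step_le r0 (lexx a)) (avg_step_ge r0 (lexx _)) subr0.
- by apply: continuous_subspaceT; exact: continuous_avg_kernel.
- split; first by move=> y _; have [] := is_derive_avg_step a r y.
  + by apply: cvg_at_right_filter; exact: continuous_avg_step.
  + by apply: cvg_at_left_filter; exact: continuous_avg_step.
- by move=> y _; exact: is_derive1E (is_derive_avg_step a r y).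
Qed.

(** The difference of the averages is minus the integral of [g2] against a difference of steps,
    which is bounded by 72 and lives on a length [3 r]. AM-GM with [lam = e / s] gives order
    [e sqrt(r)]; writing [r = s^2] makes the bound linear in [s]. *)
Lemma local_avg_osc_weak g2 s a : measurable_fun setT g2 -> weak_deriv g g2 ->
  (\int[mu]_x (g2 x ^+ 2)%:E <= (e ^+ 2)%:E)%E -> 0 < s ->
  `|local_avg (s ^+ 2) a - local_avg (s ^+ 2 / 4) a| <= 144 * e * s.
Proof.
move=> mg2 w2 g2e s0.
have r0 : 0 < s ^+ 2 by rewrite exprn_gt0.
have r'0 : 0 < s ^+ 2 / 4 by rewrite divr_gt0.
have r'r : s ^+ 2 / 4 <= s ^+ 2.
  by rewrite ler_piMr ?(ltW r0)// invf_le1 ?ler1n.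
move: r0 r'0 r'r; have [r rs] : {r : R | r = s ^+ 2} by exists (s ^+ 2).
rewrite -!rs => r0 r'0 r'r.
pose psi y := avg_step a r y - avg_step a (r / 4) y.
have cpsi : continuous psi.
  by move=> y; apply: continuousB; exact: continuous_avg_step.
have mpsi : measurable_fun setT psi by exact: continuous_measurable_fun.
have -> : local_avg r a - local_avg (r / 4) a = - \int[mu]_x (g2 x * psi x).
  rewrite /local_avg -RintegralB//; [|exact: integrable_local_avg..].
  have := w2 psi (test_fun_avg_step a r'0 r'r).
  have -> : derive1 psi = fun y => avg_kernel a r y - avg_kernel a (r / 4) y.
    apply/funext => y; apply: is_derive1E.
    have d1 := is_derive_avg_step a r y; have d2 := is_derive_avg_step a (r / 4) y.
    by apply: is_derive_eq.
  move=> /(congr1 fine); rewrite fineN => <-.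
  by apply: eq_Rintegral => x _; rewrite mulrBr.
have ar : a <= a + 3 * r by rewrite lerDl mulr_ge0// ltW.
have H lam : 0 < lam -> (\int[mu]_x `|(g2 x * psi x)%:E| <=
    (72 / 2 * (lam * (a + 3 * r - a) + e ^+ 2 / lam))%:E)%E.
  move=> lam0; apply: integral_amgm => //.
    by move=> x; exact: avg_step_sub_bound.
  by move=> x; exact: avg_step_sub_out.
have i2 : mu.-integrable setT (EFin \o (fun x => g2 x * psi x)).
  apply/integrableP; split; last exact: le_lt_trans (H 1 ltr01) (ltry _).
  by apply/measurable_EFinP; exact: measurable_funM.
have es : 0 < e / s by rewrite divr_gt0.
rewrite normrN -lee_fin EFin_normr_Rintegral//.
apply: le_trans; first by apply: le_abse_integral => //; exact: measurable_int i2.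
apply: (le_trans (H _ es)); rewrite lee_fin rs.
by rewrite le_eqVlt; apply/orP; left; apply/eqP; field; rewrite !gt_eqF.
Qed.
Lemma measurable_gagliardo_kernel sigma : measurable_fun setT
  (fun z : R * R => `|g z.1 - g z.2| ^+ 2 / (`|z.1 - z.2| `^ (1 + 2 * sigma))).
Proof.
have -> : (fun z : R * R => `|g z.1 - g z.2| ^+ 2 / (`|z.1 - z.2| `^ (1 + 2 * sigma))) =
    (fun z : R * R => `|g z.1 - g z.2| ^+ 2 * `|z.1 - z.2| `^ (- (1 + 2 * sigma))).
  by apply/funext => z; rewrite powRN.
apply: measurable_funM.
  apply: measurable_funX; apply: measurableT_comp; first exact: normr_measurable.
  apply: measurable_funB; first exact: measurableT_comp mg measurable_fst.
  exact: measurableT_comp mg measurable_snd.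
apply: (measurableT_comp (measurable_powR _)).
apply: measurableT_comp; first exact: normr_measurable.
by apply: measurable_funB; [exact: measurable_fst|exact: measurable_snd].
Qed.

(** A Campanato argument. With [m] the average at scale [r / 4], both [local_avg r a - m] and
    [g y - m] are averages of differences, which leaves a double average of [|g y - g z|] over
    [[a, a + 3 r]]. There [|y - z| <= 3 r], so [|g y - g z|^2] is at most [(3 r)^(1 + 2 sigma)]
    times the Gagliardo integrand. The factor 2592 is [36 * 72]: the kernel bounds are [36 / r] and
    [144 / r], the latter halved by AM-GM. *)
Lemma local_avg_osc_gagliardo sigma r a : 2^-1 < sigma ->
  (gagliardo sigma g <= (e ^+ 2)%:E)%E -> 0 < r ->
  `|local_avg r a - local_avg (r / 4) a| <=
    2592 * (9 + 3 `^ (1 + 2 * sigma)) * e * r `^ (sigma - 2^-1).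
Proof.
move=> sg He r0; set s := r `^ (sigma - 2^-1).
have s0 : 0 < s by exact: powR_gt0.
have r'0 : 0 < r / 4 by rewrite divr_gt0.
have r'r : r / 4 <= r by rewrite ler_piMr ?(ltW r0)// invf_le1 ?ler1n.
pose c3 := (3 * r) `^ (1 + 2 * sigma).
have c3E : c3 = 3 `^ (1 + 2 * sigma) * r ^+ 2 * s ^+ 2.
  rewrite /c3 powRM ?(ltW r0)// -mulrA; congr (_ * _).
  rewrite -[r ^+ 2]powR_mulrn ?(ltW r0)// -[s ^+ 2]powR_mulrn ?(ltW s0)// -powRrM.
  rewrite -powRD; last by rewrite (gt_eqF r0) implybT.
  by congr (_ `^ _); field.
have c30 : 0 <= c3 by exact: powR_ge0.
(* Balances AM-GM: the two terms of the final bound are of order [lam] and [e^2 s^2 / lam]. *)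
pose lam := e * s.
have lam0 : 0 < lam by exact: mulr_gt0.
pose H (z : R * R) : R := `|g z.1 - g z.2| ^+ 2 / (`|z.1 - z.2| `^ (1 + 2 * sigma)).
have H0 (z : R * R) : 0 <= H z by rewrite divr_ge0 ?sqr_ge0 ?powR_ge0.
have mH : measurable_fun setT (EFin \o H).
  by apply/measurable_EFinP; exact: measurable_gagliardo_kernel.
pose I := `[a, (a + 3 * r)%R]%classic : set R.
have mInd : measurable_fun setT (\1_I : R -> R).
  by apply: measurable_indic; exact: measurable_itv.
pose m := local_avg (r / 4) a.
pose P := avg_kernel a r; pose Q := avg_kernel a (r / 4).
pose N y := (\int[mu]_z (H (y, z))%:E)%E.
have mN : measurable_fun setT N.
  exact: (@measurable_fun_fubini_tonelli_F _ _ _ _ R mu _ mH).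
have N0 y : (0 <= N y)%E by apply: integral_ge0 => z _; rewrite lee_fin.
have mP : measurable_fun setT P by apply: continuous_measurable_fun; exact: continuous_avg_kernel.
have mQ : measurable_fun setT Q by apply: continuous_measurable_fun; exact: continuous_avg_kernel.
have iQ := integrable_local_avg a r'0.
have iP := integrable_local_avg a r0.
have Hyz y z : I y -> I z -> `|g y - g z| <= 2^-1 * (lam + c3 / lam * H (y, z)).
  rewrite /I/= !in_itv/= => yI zI.
  have key : `|g y - g z| ^+ 2 <= c3 * H (y, z).
    rewrite /H/=; have [->|yz] := eqVneq y z.
      by rewrite subrr normr0 expr0n/= mul0r mulr0.
    rewrite mulrCA ler_peMr ?sqr_ge0// ler_pdivlMr ?mul1r; last first.
      by rewrite powR_gt0// normr_gt0 subr_eq0.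
    apply: ge0_ler_powR.
    - by rewrite addr_ge0// mulr_ge0// ltW// (lt_trans _ sg)// invr_gt0.
    - by rewrite nnegrE.
    - by rewrite nnegrE mulr_ge0// ltW.
    - by rewrite ler_norml; move: yI zI => /andP[? ?] /andP[? ?]; apply/andP; split; lra.
  have : 0 <= lam^-1 * (lam - `|g y - g z|) ^+ 2.
    by rewrite mulr_ge0 ?sqr_ge0// invr_ge0 ltW.
  have -> : lam^-1 * (lam - `|g y - g z|) ^+ 2 =
      lam - 2 * `|g y - g z| + lam^-1 * `|g y - g z| ^+ 2.
    by field; rewrite gt_eqF.
  have : lam^-1 * `|g y - g z| ^+ 2 <= lam^-1 * (c3 * H (y, z)).
    by rewrite ler_wpM2l// invr_ge0 ltW.
  have -> : lam^-1 * (c3 * H (y, z)) = c3 / lam * H (y, z) by rewrite mulrA [lam^-1 * _]mulrC.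
  by move: (lam^-1 * _) (c3 / lam * _) => u v; lra.
(* The inner average, in [z], at the finer scale; the outer one, in [y], follows the same pattern
   and turns [N] into the Gagliardo seminorm. *)
have gm y : I y -> (`|g y - m|%:E <= (72 / r)%:E * ((3 * r * lam)%:E + (c3 / lam)%:E * N y))%E.
  move=> yI.
  have -> : g y - m = \int[mu]_z (Q z * (g y - g z)).
    have gyE : g y = \int[mu]_z (g y * Q z).
      rewrite RintegralZl//; last exact: integrable_avg_kernel.
      by rewrite Rintegral_avg_kernel// mulr1.
    rewrite [in LHS]gyE /m /local_avg -RintegralB//; last first.
      have : mu.-integrable setT (fun z => (g y)%:E * (Q z)%:E)%E.
        by apply: integrableZl => //; exact: integrable_avg_kernel.
      by apply: eq_integrable => // z _ /=; rewrite EFinM.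
    by apply: eq_Rintegral => z _; rewrite /Q; ring.
  have iQy : mu.-integrable setT (EFin \o (fun z => Q z * (g y - g z))).
    have : mu.-integrable setT ((fun z => (g y)%:E * (Q z)%:E) \- (EFin \o (fun z => (g z * Q z)%R)))%E.
      apply: integrableB => //; apply: integrableZl => //; exact: integrable_avg_kernel.
    by apply: eq_integrable => // z _ /=; rewrite -EFinM -EFinB mulrBr [g y * _]mulrC [g z * _]mulrC.
  rewrite EFin_normr_Rintegral//.
  apply: le_trans; first by apply: le_abse_integral => //; exact: measurable_int iQy.
  apply: (@le_trans _ _ (\int[mu]_z ((72 / r * lam)%:E * (\1_I z)%:E +
      (72 / r * (c3 / lam))%:E * (H (y, z))%:E))%E).
    apply: ge0_le_integral => //.
    - by apply: measurableT_comp => //; exact: measurable_int iQy.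
    - apply: emeasurable_funD.
        by apply: emeasurable_funM => //; apply/measurable_EFinP; exact: mInd.
      apply: emeasurable_funM => //.
      exact: (measurableT_comp mH (measurable_pair1 y)).
    move=> z _; rewrite /= -!EFinM -EFinD lee_fin.
    have cH : 0 <= 72 / r * (c3 / lam) * H (y, z).
      by rewrite mulr_ge0// mulr_ge0 ?divr_ge0// ltW.
    have [zI|zI] := boolP (z \in I); last first.
      rewrite indicE (negbTE zI) mulr0 add0r /Q avg_kernel_out ?mul0r ?normr0//.
      apply: contraNN zI => /andP[az zr]; rewrite mem_set// /I/= in_itv/= az/=.
      by rewrite (le_trans zr)// lerD2l ler_wpM2l.
    rewrite indicE zI mulr1 normrM.
    apply: (@le_trans _ _ (36 / (r / 4) * (2^-1 * (lam + c3 / lam * H (y, z))))).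
      apply: ler_pM => //; first exact: avg_kernel_bound.
      by apply: Hyz => //; exact: set_mem zI.
    rewrite le_eqVlt; apply/orP; left; apply/eqP; field.
    by rewrite !gt_eqF.
  rewrite ge0_integralD//; last 4 first.
  - by move=> z _; rewrite -EFinM lee_fin mulr_ge0// mulr_ge0 ?divr_ge0// ltW.
  - by apply: emeasurable_funM => //; apply/measurable_EFinP; exact: mInd.
  - by move=> z _; rewrite -EFinM lee_fin mulr_ge0// mulr_ge0 ?divr_ge0// ltW.
  - by apply: emeasurable_funM => //; exact: (measurableT_comp mH (measurable_pair1 y)).
  have mHy : measurable_fun setT (fun z => (H (y, z))%:E).
    exact: (measurableT_comp mH (measurable_pair1 y)).
  rewrite ge0_integralZl_EFin//; last 2 first.
  - by apply/measurable_EFinP; exact: mInd.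
  - by rewrite mulr_ge0 ?divr_ge0// ltW.
  rewrite ge0_integralZl_EFin//; last 2 first.
  - by move=> z _; rewrite lee_fin.
  - by rewrite mulr_ge0 ?divr_ge0// ltW.
  rewrite integral_indic_itv; last by rewrite lerDl mulr_ge0// ltW.
  rewrite -/(N y) [leRHS]ge0_muleDr; last 2 first.
  - by rewrite lee_fin !mulr_ge0// ltW.
  - by rewrite mule_ge0// lee_fin divr_ge0// ltW.
  rewrite muleA -!EFinM; apply: leeD => //.
  by rewrite lee_fin le_eqVlt; apply/orP; left; apply/eqP; ring.
have -> : local_avg r a - local_avg (r / 4) a = \int[mu]_y (P y * (g y - m)).
  have mE : local_avg (r / 4) a = \int[mu]_z (m * P z).
    rewrite RintegralZl//; last exact: integrable_avg_kernel.
    by rewrite Rintegral_avg_kernel// mulr1.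
  rewrite mE {1}/local_avg -RintegralB//; last first.
    have : mu.-integrable setT (fun z => m%:E * (P z)%:E)%E.
      by apply: integrableZl => //; exact: integrable_avg_kernel.
    by apply: eq_integrable => // z _ /=; rewrite EFinM.
  by apply: eq_Rintegral => z _; rewrite /P; ring.
have iPm : mu.-integrable setT (EFin \o (fun y => P y * (g y - m))).
  have : mu.-integrable setT ((EFin \o (fun z => (g z * P z)%R)) \- (fun z => m%:E * (P z)%:E))%E.
    apply: integrableB => //; apply: integrableZl => //; exact: integrable_avg_kernel.
  by apply: eq_integrable => // z _ /=; rewrite mulrBr [m * _]mulrC [g z * _]mulrC.
rewrite -lee_fin EFin_normr_Rintegral//.
apply: le_trans; first by apply: le_abse_integral => //; exact: measurable_int iPm.
have k1 : 0 <= 36 / r * (72 / r) * (3 * r * lam) by rewrite !mulr_ge0 ?invr_ge0// ltW.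
have k2 : 0 <= 36 / r * (72 / r) * (c3 / lam) by rewrite !mulr_ge0 ?invr_ge0// ltW.
apply: (@le_trans _ _ (\int[mu]_y ((36 / r * (72 / r) * (3 * r * lam))%:E * (\1_I y)%:E +
    (36 / r * (72 / r) * (c3 / lam))%:E * N y))%E).
  apply: ge0_le_integral => //.
  - by apply: measurableT_comp => //; exact: measurable_int iPm.
  - apply: emeasurable_funD.
      by apply: emeasurable_funM => //; apply/measurable_EFinP; exact: mInd.
    exact: emeasurable_funM.
  move=> y _ /=; have [yI|yI] := boolP (y \in I); last first.
    rewrite indicE (negbTE yI) mule0 add0e /P avg_kernel_out ?mul0r ?normr0//.
      by apply: mule_ge0 => //; rewrite lee_fin.
    by apply: contraNN yI => yI; rewrite mem_set// /I/= in_itv/=.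
  rewrite indicE yI mule1 normrM EFinM.
  apply: (@le_trans _ _ ((36 / r)%:E * ((72 / r)%:E * ((3 * r * lam)%:E + (c3 / lam)%:E * N y)))%E).
    apply: lee_pmul => //; first by rewrite lee_fin; exact: avg_kernel_bound.
    by apply: gm; exact: set_mem yI.
  rewrite muleA -EFinM [leLHS]ge0_muleDr; last 2 first.
  - by rewrite lee_fin !mulr_ge0// ltW.
  - by rewrite mule_ge0// lee_fin divr_ge0// ltW.
  by rewrite muleA -!EFinM.
rewrite ge0_integralD//; last 4 first.
- by move=> z _; rewrite -EFinM lee_fin mulr_ge0.
- by apply: emeasurable_funM => //; apply/measurable_EFinP; exact: mInd.
- by move=> z _; rewrite mule_ge0// lee_fin.
- exact: emeasurable_funM.
rewrite ge0_integralZl_EFin//; last first.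
  by apply/measurable_EFinP; exact: mInd.
rewrite ge0_integralZl_EFin// integral_indic_itv; last by rewrite lerDl mulr_ge0// ltW.
have -> : 2592 * (9 + 3 `^ (1 + 2 * sigma)) * e * s =
    36 / r * (72 / r) * (3 * r * lam) * (3 * r) + 36 / r * (72 / r) * (c3 / lam) * e ^+ 2.
  by rewrite c3E /lam; field; rewrite !gt_eqF.
rewrite [leRHS]EFinD; apply: leeD.
  by rewrite -EFinM lee_fin le_eqVlt; apply/orP; left; apply/eqP; congr (_ * _); ring.
by rewrite [leRHS]EFinM; apply: lee_wpmul2l.
Qed.
(** At a fixed scale the kernel is Lipschitz in its base point with constant [24 / r^2]. Two kernels
    with base points at distance at most 1 live on a common interval of length at most [2 + 3 r],
    and AM-GM with [lam = 1] gives [L]. *)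
Lemma continuous_local_avg r : 0 < r -> continuous (local_avg r).
Proof.
move=> r0 a; apply/cvgrPdist_le => eta eta0.
pose L := 24 / r ^+ 2 / 2 * (2 + 3 * r + e ^+ 2).
have L0 : 0 <= L.
  by rewrite mulr_ge0 ?divr_ge0 ?exprn_ge0 ?addr_ge0 ?mulr_ge0 ?exprn_ge0// ltW.
have bound b : `|b - a| <= 1 -> `|local_avg r a - local_avg r b| <= L * `|b - a|.
  move=> ba; rewrite /local_avg -RintegralB//; [|exact: integrable_local_avg..].
  pose h x := avg_kernel a r x - avg_kernel b r x.
  have mh : measurable_fun setT h.
    apply: continuous_measurable_fun => x.
    by apply: continuousB; exact: continuous_avg_kernel.
  have hc x : `|h x| <= 24 / r ^+ 2 * `|b - a|.
    have kE c y : avg_kernel c r y = avg_kernel 0 r (y - c) by rewrite /avg_kernel subr0.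
    rewrite /h (kE a) (kE b).
    apply: (le_trans (derive_bound_lipschitz (is_derive_avg_kernel 0 r) (avg_kernel'_bound 0 r0) _ _)).
    by rewrite (_ : x - a - (x - b) = b - a)//; ring.
  pose c := a - `|b - a|; pose d := a + `|b - a| + 3 * r.
  have cd : c <= d.
    by rewrite /c /d -addrA lerD2l (@le_trans _ _ 0) ?oppr_le0 ?addr_ge0 ?mulr_ge0// ltW.
  have h0 x : ~~ (c <= x <= d) -> h x = 0.
    have := ler_norm (b - a); have := ler_norm (- (b - a)); rewrite normrN => n1 n2.
    have n0 : 0 <= `|b - a| by [].
    move=> xcd; rewrite /h !avg_kernel_out ?subrr//; apply: contraNN xcd => /andP[x1 x2];
      rewrite /c /d; move: (`|b - a|) n0 n1 n2 => N n0 n1 n2; apply/andP; split; lra.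
  have ih : mu.-integrable setT (EFin \o (fun x => g x * avg_kernel a r x - g x * avg_kernel b r x)).
    have : mu.-integrable setT ((EFin \o (fun x => (g x * avg_kernel a r x)%R)) \-
        (EFin \o (fun x => (g x * avg_kernel b r x)%R)))%E.
      by apply: integrableB => //; exact: integrable_local_avg.
    by apply: eq_integrable => // z _ /=; rewrite EFinB.
  rewrite -lee_fin EFin_normr_Rintegral//.
  apply: le_trans; first by apply: le_abse_integral => //; exact: measurable_int ih.
  under eq_integral => x _ do rewrite -mulrBr.
  apply: (le_trans (integral_amgm mg mh cd ltr01 hc h0 ge)).
  rewrite lee_fin /L /c /d divr1 mul1r.
  have -> : 24 / r ^+ 2 / 2 * (2 + 3 * r + e ^+ 2) * `|b - a| =
    24 / r ^+ 2 * `|b - a| / 2 * (2 + 3 * r + e ^+ 2) by ring.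
  apply: ler_wpM2l.
    by rewrite !mulr_ge0 ?invr_ge0 ?exprn_ge0// ltW.
  rewrite lerD2r.
  have -> : a + `|b - a| + 3 * r - (a - `|b - a|) = 2 * `|b - a| + 3 * r by ring.
  by rewrite lerD2r ler_piMr.
have d0 : 0 < Num.min 1 (eta / (L + 1)).
  by rewrite lt_min ltr01 divr_gt0// ltr_wpDl.
exists (Num.min 1 (eta / (L + 1))) => //= b; rewrite /ball/= distrC lt_min => /andP[b1 b2].
apply: (le_trans (bound _ (ltW b1))).
rewrite (@le_trans _ _ ((L + 1) * `|b - a|))// ?ler_wpM2r ?lerDl//.
by rewrite mulrC -ler_pdivlMr ?ltr_wpDl// ltW.
Qed.

Section oscillation.
Variables K q : R.
Hypothesis q01 : 0 <= q < 1.
Hypothesis osc : forall n a,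
  `|local_avg (4 ^+ n)^-1 a - local_avg ((4 ^+ n)^-1 / 4) a| <= K * e * q ^+ n.

Let pow4_gt0 n : 0 < (4 ^+ n)^-1 :> R.
Proof. by rewrite invr_gt0 exprn_gt0. Qed.

(** The oscillation bounds are summed over all finer scales, and the limit is [f'(a)]. The rate does
    not depend on [a], so [f'] is a uniform limit of continuous functions; at scale 1 the same
    inequality bounds [f']. *)
Lemma local_avg_uniform a n :
  `|local_avg (4 ^+ n)^-1 a - derive1 f a| <= K * e * q ^+ n / (1 - q).
Proof.
apply: (@geometric_tail (fun n => local_avg (4 ^+ n)^-1 a) (derive1 f a) (K * e) q) => // [k|].
  by apply: le_trans (osc k a); rewrite exprSr invfM.
apply/cvgrPdist_le => eta eta0.
have [d d0 dE] := local_avg_cvg a eta0.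
have /cvgrPdist_lt/(_ _ d0) [N _ NE] := cvg_pow4V.
exists N => // k /= Nk; rewrite distrC; apply: dE => //.
by have := NE _ Nk; rewrite sub0r normrN gtr0_norm.
Qed.

Lemma derive1_bound a : `|derive1 f a| <= (72 + K / (1 - q)) * e.
Proof.
have -> : derive1 f a = local_avg 1 a - (local_avg 1 a - derive1 f a) by ring.
rewrite (le_trans (ler_normB _ _))// mulrDl lerD ?local_avg1_bound//.
have := local_avg_uniform a 0; rewrite expr0 invr1 mulr1 => /le_trans; apply.
by rewrite mulrAC.
Qed.

Lemma continuous_derive1 : continuous (derive1 f).
Proof.
move: q01 => /andP[q0 q1]; have q1' : 0 < 1 - q by rewrite subr_gt0.
have K0 : 0 <= K * e by have := osc 0%N 0; rewrite [q ^+ 0]expr0 mulr1; exact: le_trans.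
move=> a; apply/cvgrPdist_le => eta eta0.
have : K * e * q ^+ n / (1 - q) @[n --> \oo] --> K * e * 0 / (1 - q).
  apply: cvgM; last exact: cvg_cst.
  by apply: cvgM; [exact: cvg_cst|apply: cvg_expr; rewrite ger0_norm].
rewrite mulr0 mul0r.
have eta3 : 0 < eta / 3 by rewrite divr_gt0.
move=> /cvgrPdist_le/(_ _ eta3)[N _ /(_ N (leqnn N))].
rewrite sub0r normrN => kN.
have /cvgrPdist_le/(_ _ eta3) := continuous_local_avg (pow4_gt0 N) (x := a).
apply: filterS => b; move: (local_avg_uniform a N) (local_avg_uniform b N).
move: (local_avg _ a) (local_avg _ b) => u v ua vb uv.
have -> : derive1 f a - derive1 f b = (v - derive1 f b) - (u - derive1 f a) + (u - v) by ring.
have := le_trans (ler_norm _) kN => {}kN.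
apply: (le_trans (ler_normD _ _)); apply: (le_trans (lerD (ler_normB _ _) (lexx _))).
by move: (K * e * _ / _) kN ua vb => k; lra.
Qed.

End oscillation.

(** On [[a, a + 1]] the function moves by at most [D], so [f(a)^2 <= 2 f(y)^2 + 2 D^2]; integrating
    in [y] over this unit interval brings in the L^2 norm. *)
Lemma derivable_L2_bound D : (\int[mu]_x (f x ^+ 2)%:E <= (e ^+ 2)%:E)%E ->
  (forall a, `|derive1 f a| <= D) -> forall a, `|f a| <= 2 * (e + D).
Proof.
move=> fe fD a; have D0 : 0 <= D by exact: le_trans (fD 0).
have lip x y : `|f x - f y| <= D * `|x - y|.
  apply: (@derive_bound_lipschitz f (derive1 f)) => // z.
  by split; [exact: df|rewrite derive1E].
have H y : `[a, (a + 1)%R]%classic y -> f a ^+ 2 <= 2 * f y ^+ 2 + 2 * D ^+ 2.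
  rewrite /= in_itv/= => /andP[ay y1].
  have : `|f a - f y| <= D.
    apply: (le_trans (lip _ _)); rewrite ler_piMr// distrC ger0_norm ?subr_ge0//.
    by rewrite lerBlDl.
  rewrite ler_norml => /andP[h1 h2].
  have h : (f a - f y) ^+ 2 <= D ^+ 2.
    by rewrite -subr_ge0 subr_sqr mulr_ge0//; lra.
  have : 0 <= (f a - 2 * f y) ^+ 2 by exact: sqr_ge0.
  by move: h; rewrite !expr2; nra.
have fa2 : f a ^+ 2 <= 2 * e ^+ 2 + 2 * D ^+ 2.
  have aa : a < a + 1 by rewrite ltrDl.
  have muI : mu `[a, (a + 1)%R]%classic = 1%:E.
    by rewrite lebesgue_measure_itv/= lte_fin aa -EFinD addrAC subrr add0r.
  have mf2 : measurable_fun `[a, (a + 1)%R]%classic (fun y => (f y ^+ 2)%:E).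
    by apply/measurable_EFinP; apply: measurable_funTS; apply: measurable_funX;
      exact: continuous_measurable_fun.
  rewrite -lee_fin; apply: (@le_trans _ _
    (\int[mu]_(y in `[a, (a + 1)%R]) (2%:E * (f y ^+ 2)%:E + (2 * D ^+ 2)%:E))%E).
    apply: (@le_trans _ _ (\int[mu]_(y in `[a, (a + 1)%R]) (f a ^+ 2)%:E)%E).
      by rewrite integral_cst//= muI mule1.
    apply: ge0_le_integral => //.
    - by move=> y _; rewrite lee_fin sqr_ge0.
    - by apply: emeasurable_funD => //; exact: emeasurable_funM.
  rewrite ge0_integralD//; last 3 first.
  - by move=> y _; rewrite -EFinM lee_fin mulr_ge0// sqr_ge0.
  - exact: emeasurable_funM.
  - by move=> y _; rewrite lee_fin mulr_ge0// sqr_ge0.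
  rewrite ge0_integralZl_EFin//; last by move=> y _; rewrite lee_fin sqr_ge0.
  rewrite integral_cst//= muI mule1 [leRHS]EFinD; apply: leeD => //.
  rewrite [leRHS]EFinM; apply: lee_wpmul2l => //; apply: le_trans fe.
  apply: ge0_subset_integral => //.
  - by apply/measurable_EFinP; apply: measurable_funX; exact: continuous_measurable_fun.
  - by move=> y _; rewrite lee_fin sqr_ge0.
rewrite -(@ler_pXn2r _ 2)// ?nnegrE ?mulr_ge0 ?addr_ge0 ?(ltW e0)//.
rewrite real_normK ?num_real//; apply: (le_trans fa2).
rewrite exprMn sqrrD; have := mulr_ge0 (ltW e0) D0; have := sqr_ge0 D; have := sqr_ge0 e.
by rewrite !expr2; nra.
Qed.

End weak_derivative.

(** * The embedding of [H^s], [s > 3/2], into C^1 *)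

Lemma L2sq_ge0 f : (0 <= L2sq f)%E.
Proof. by apply: integral_ge0 => x _; rewrite lee_fin sqr_ge0. Qed.

Lemma gagliardo_ge0 (sigma : R) f : (0 <= gagliardo sigma f)%E.
Proof.
apply: integral_ge0 => x _; apply: integral_ge0 => y _.
by rewrite lee_fin divr_ge0 ?sqr_ge0 ?powR_ge0.
Qed.

Lemma L2sq_le_Hs_sq k (sigma : R) (g : nat -> R -> R) j : (j <= k)%N ->
  (L2sq (g j) <= Hs_sq k sigma g)%E.
Proof.
move=> jk; rewrite /Hs_sq; apply: (@le_trans _ _ (\sum_(0 <= i < k.+1) L2sq (g i))%E).
  rewrite (bigD1_seq j _ (iota_uniq _ _)); last by rewrite mem_iota add0n subn0 ltnS.
  by rewrite leeDl// sume_ge0// => i _; exact: L2sq_ge0.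
by rewrite leeDl//; case: ifP => // _; exact: gagliardo_ge0.
Qed.

Lemma gagliardo_le_Hs_sq k (sigma : R) (g : nat -> R -> R) : 0 < sigma ->
  (gagliardo sigma (g k) <= Hs_sq k sigma g)%E.
Proof.
by move=> s0; rewrite /Hs_sq s0 leeDr// sume_ge0// => i _; exact: L2sq_ge0.
Qed.

(** Since [sigma < 1], the case [k = 0] is impossible. For [k = 1] one has [sigma > 1/2] and the
    Gagliardo seminorm gives the ratio [q = 4^-(sigma - 1/2)]; for [k >= 2] the second weak
    derivative gives [q = 1/2], the square root of 1/4. The bound is linear in [e] with [C]
    depending on [k] and [sigma] only, so it also applies to differences of two functions. *)
Lemma sobolev_C1 k (sigma : R) : 0 <= sigma < 1 -> 3 / 2 < k%:R + sigma ->
  exists2 C : R, 0 < C & forall f (g : nat -> R -> R) e, 0 < e ->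
    (forall x, derivable f x 1) -> g 0%N = f ->
    (forall j : nat, (j < k)%N -> weak_deriv (g j) (g j.+1)) ->
    (forall j : nat, (j <= k)%N -> measurable_fun setT (g j)) ->
    (Hs_sq k sigma g <= (e ^+ 2)%:E)%E ->
    continuous (derive1 f) /\ forall x, `|f x| <= C * e /\ `|derive1 f x| <= C * e.
Proof.
move=> /andP[s0 s1] ks.
have [K [q [K0 q01 osc]]] : exists K q : R, [/\ 0 <= K, 0 <= q < 1 &
  forall (g : nat -> R -> R) e, 0 < e ->
    (forall j : nat, (j < k)%N -> weak_deriv (g j) (g j.+1)) ->
    (forall j : nat, (j <= k)%N -> measurable_fun setT (g j)) ->
    (Hs_sq k sigma g <= (e ^+ 2)%:E)%E -> forall n a,
    `|local_avg (g 1%N) (4 ^+ n)^-1 a - local_avg (g 1%N) ((4 ^+ n)^-1 / 4) a| <= K * e * q ^+ n].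
  case: k ks => [|[|k]] ks.
  - by exfalso; move: ks s1; rewrite add0r; lra.
  - have sg : 2^-1 < sigma by move: ks; rewrite mulr1n; lra.
    exists (2592 * (9 + 3 `^ (1 + 2 * sigma))), (4^-1 `^ (sigma - 2^-1)); split.
    + by apply: mulr_ge0; [exact: ler0n|apply: addr_ge0; [exact: ler0n|exact: powR_ge0]].
    + rewrite powR_ge0/=; apply: (@lt_le_trans _ _ (1 `^ (sigma - 2^-1))); last by rewrite powR1.
      by apply: gt0_ltr_powR; rewrite ?nnegrE ?invr_ge0 ?subr_gt0// invf_lt1// ltr1n.
    + move=> g e e0 wg mg Hg n a.
      have L1 : (\int[mu]_x (g 1%N x ^+ 2)%:E <= (e ^+ 2)%:E)%E.
        by apply: le_trans Hg; exact: (@L2sq_le_Hs_sq 1 sigma g 1).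
      have gg : (gagliardo sigma (g 1%N) <= (e ^+ 2)%:E)%E.
        by apply: le_trans Hg; apply: gagliardo_le_Hs_sq; rewrite (lt_trans _ sg)// invr_gt0.
      have p4 : 0 < (4 ^+ n)^-1 :> R by rewrite invr_gt0 exprn_gt0.
      have := local_avg_osc_gagliardo (mg _ (leqnn 1)) e0 L1 a sg gg p4.
      move=> /le_trans; apply; rewrite le_eqVlt; apply/orP; left; apply/eqP; congr (_ * _).
      rewrite -powR_mulrn ?powR_ge0// -!powRrM mulrC powRrM; congr (_ `^ _).
      by rewrite powR_mulrn ?invr_ge0// exprVn.
  - exists 144, 2^-1; split => //.
      by rewrite invr_ge0 ler0n/= invf_lt1// ltr1n.
    move=> g e e0 wg mg Hg n a.
    have L1 : (\int[mu]_x (g 1%N x ^+ 2)%:E <= (e ^+ 2)%:E)%E.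
      by apply: le_trans Hg; exact: (@L2sq_le_Hs_sq k.+2 sigma g 1).
    have L2 : (\int[mu]_x (g 2%N x ^+ 2)%:E <= (e ^+ 2)%:E)%E.
      by apply: le_trans Hg; exact: (@L2sq_le_Hs_sq k.+2 sigma g 2).
    have p2 : 0 < 2^-1 ^+ n :> R by rewrite exprn_gt0// invr_gt0.
    have := local_avg_osc_weak (mg 1%N isT) e0 L1 a (mg 2%N isT) (wg 1%N isT) L2 p2.
    have -> : (2^-1 ^+ n) ^+ 2 = (4 ^+ n)^-1 :> R.
      by rewrite -exprM mulnC exprM -exprVn; congr (_ ^+ _); field.
    by [].
have k1 : (1 <= k)%N.
  by case: k ks {osc} => // ks; exfalso; move: ks s1; rewrite add0r; lra.
move: (q01) => /andP[q0 q1]; have q1' : 0 < 1 - q by rewrite subr_gt0.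
pose D := 72 + K / (1 - q).
have D0 : 0 < D by rewrite ltr_wpDr// divr_ge0// ltW.
exists (2 * (1 + D)); first by rewrite mulr_gt0// addr_gt0.
move=> f g e e0 df g0 wg mg Hg.
have L0 : (\int[mu]_x (f x ^+ 2)%:E <= (e ^+ 2)%:E)%E.
  by apply: le_trans Hg; rewrite -g0; exact: (@L2sq_le_Hs_sq k sigma g 0).
have L1 : (\int[mu]_x (g 1%N x ^+ 2)%:E <= (e ^+ 2)%:E)%E.
  by apply: le_trans Hg; exact: (@L2sq_le_Hs_sq k sigma g 1).
have w1 : weak_deriv f (g 1%N) by rewrite -g0; exact: wg.
have osc1 := osc g e e0 wg mg Hg.
have fD a : `|derive1 f a| <= D * e.
  exact: (derive1_bound df (mg _ k1) w1 e0 L1 q01 osc1).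
split; first exact: (continuous_derive1 df (mg _ k1) w1 e0 L1 q01 osc1).
move=> x; split.
  have := derivable_L2_bound df e0 L0 fD x.
  by have -> : 2 * (e + D * e) = 2 * (1 + D) * e by ring.
by rewrite (le_trans (fD x))// ler_wpM2r ?(ltW e0)//; lra.
Qed.
(** * Weights *)

(** Induction along an interval through the supremum of the good points. The step goes from a good
    [x] left of [z] to any [y] right of it, which fits estimates centred at [z], such as one from a
    derivative at [z]; it is used once to reach the supremum and once to pass it. *)
Lemma straddle_induction (P : R -> Prop) a b : a <= b -> P a ->
  (forall z, a <= z <= b -> exists2 r : R, 0 < r & forall x y,
     a <= x -> x <= z -> z <= y -> y <= b -> z - r < x -> y < z + r -> P x -> P y) -> P b.
Proof.
move=> ab Pa step; pose S := [set x | a <= x <= b /\ P x].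
have Sa : S a by split=> //; rewrite lexx.
have ubS : ubound S b by move=> x [/andP[]].
have hS : has_sup S by split; [exists a|exists b].
have as_ : a <= sup S by apply: ub_le_sup => //; exists b.
have sb : sup S <= b by apply: ge_sup => //; exists a.
have [r r0 rP] := step _ (introT andP (conj as_ sb)).
have [x [/andP[ax xb] Px] sx] := sup_adherent r0 hS.
have xs : x <= sup S by apply: ub_le_sup; [exists b|split=> //; rewrite ax].
have Ps : P (sup S) by apply: (rP x) => //; rewrite ltrDl.
have yb : Num.min b (sup S + r / 2) <= b by rewrite ge_min lexx.
have sy : sup S <= Num.min b (sup S + r / 2) by rewrite le_min sb/= lerDl divr_ge0// ltW.
have Py : P (Num.min b (sup S + r / 2)).
  apply: (rP (sup S)) => //; first by rewrite ltrBlDr ltrDl.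
  by rewrite gt_min orbC ltrD2l; apply/orP; left; lra.
have : Num.min b (sup S + r / 2) <= sup S.
  by apply: ub_le_sup; [exists b|split=> //; rewrite yb (le_trans as_)].
rewrite ge_min => /orP[bs|]; last by lra.
by have -> : b = sup S by apply/eqP; rewrite eq_le bs sb.
Qed.

(* Continuous induction: near a good point the increment is at most [A + e1]
   times the length; the exceptional null set lies in an open set of measure
   less than [d], where absolute continuity bounds the total increment. *)
Lemma abs_cont_lipschitz f (A : R) a b : 0 <= A -> loc_abs_cont f ->
  {ae mu, forall x, derivable f x 1 /\ `|derive1 f x| <= A} -> a <= b ->
  `|f b - f a| <= A * (b - a).
Proof.
move=> A_ge0 acf [N [mN N0 fN]] ab; apply/ler_addgt0Pr => e e0.
have b1 : 0 < b - a + 1 by rewrite ltr_wpDl// subr_ge0.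
pose e1 := e / 2 / (b - a + 1).
have e10 : 0 < e1 by rewrite !divr_gt0.
have e1b : e1 * (b - a) <= e / 2.
  rewrite /e1 mulrAC ler_pdivrMr// ler_wpM2l ?divr_ge0 ?(ltW e0)//; lra.
have e20 : 0 < e / 2 by rewrite divr_gt0.
have [d d0 dP] := acf a b ab _ e20.
have Nfin : (mu N < +oo)%E by rewrite N0 ltry.
have [U [oU NU Ud]] := lebesgue_regularity_outer mN Nfin d0.
have mU : measurable U by exact: open_measurable.
have {}Ud : (mu U < d%:E)%E.
  rewrite (measureDI mu mU mN); apply: le_lt_trans Ud.
  rewrite -[leRHS]adde0 -[in leRHS]N0; apply: leeD => //.
  by apply: le_measure; rewrite ?inE//; exact: measurableI.
have mUi x : measurable (U `&` [set` `[a, x[]) by exact: measurableI.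
(* The listed intervals are those where the increment is not controlled by a derivative. Their total
   length is charged to the part of [U] left of [x], so it stays below [d] and absolute continuity
   applies at the end. *)
pose P x := exists n (c l : nat -> R), [/\
  forall i, (i < n)%N -> a <= c i /\ c i <= l i /\ l i <= x,
  forall i, (i.+1 < n)%N -> l i <= c i.+1,
  ((\sum_(i < n) (l i - c i))%:E <= mu (U `&` [set` `[a, x[]))%E &
  `|f x - f a| <= (A + e1) * (x - a) + \sum_(i < n) `|f (l i) - f (c i)|].
have : P b.
  apply: (straddle_induction ab).
    exists 0%N, (fun=> 0), (fun=> 0); split=> //; rewrite big_ord0 ?measure_ge0//.
    by rewrite !subrr normr0 mulr0 addr0.
  move=> z _; have [Nz|Nz] := pselect (N z).
    have /nbhs_ballP[r /= r0 rU] := oU _ (NU _ Nz).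
    exists r => // x y ax xz zy yb zx yz [n [c [l [h1 h2 h3 h4]]]].
    have xy : x <= y := le_trans xz zy.
    exists n.+1, (fun i => if (i < n)%N then c i else x), (fun i => if (i < n)%N then l i else y).
    split.
    - move=> i; rewrite ltnS leq_eqVlt => /orP[/eqP->|iln]; first by rewrite ltnn.
      by rewrite iln; have [? [? ?]] := h1 _ iln; split=> //; split=> //; apply: le_trans xy.
    - move=> i; rewrite ltnS => iln; rewrite iln; case: ifP => [|_]; first exact: h2.
      by have [? [? ?]] := h1 _ iln.
    - rewrite big_ord_recr/= ltnn EFinD.
      have -> : \sum_(i < n) ((if (i < n)%N then l i else y) - (if (i < n)%N then c i else x)) =
                \sum_(i < n) (l i - c i) by apply: eq_bigr => i _; rewrite ltn_ord.
      apply: (@le_trans _ _ (mu (U `&` [set` `[a, x[]) + mu [set` `[x, y[])%E).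
        apply: leeD => //; rewrite lebesgue_measure_itv/= lte_fin; case: ifPn => // xy'.
        by rewrite lee_fin subr_le0 leNgt.
      have dis : (U `&` [set` `[a, x[]) `&` [set` `[x, y[] = set0.
        apply/seteqP; split=> // w [[_ /=]]; rewrite !in_itv/= => /andP[_ wx] /andP[xw _].
        by move: (le_lt_trans xw wx); rewrite ltxx.
      rewrite -(measureU mu (mUi x) (measurable_itv _) dis).
      have mUU := measurableU _ _ (mUi x) (measurable_itv `[x, y[).
      apply: le_measure; rewrite ?inE//; first exact: mUi.
      move=> w [[Uw /=]|/=]; rewrite in_itv/= => /andP[w1 w2].
        by split=> //=; rewrite in_itv/= w1 (lt_le_trans w2).
      split=> /=; last by rewrite in_itv/= w2 (le_trans ax).
      by apply: rU; rewrite /ball/= distrC ltr_norml; apply/andP; split; lra.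
    - rewrite big_ord_recr/= ltnn.
      have -> : \sum_(i < n) `|f (if (i < n)%N then l i else y) - f (if (i < n)%N then c i else x)| =
                \sum_(i < n) `|f (l i) - f (c i)| by apply: eq_bigr => i _; rewrite ltn_ord.
      have A0 : 0 <= (A + e1) * (y - x).
        by rewrite mulr_ge0 ?subr_ge0// addr_ge0// ltW.
      have := ler_normD (f y - f x) (f x - f a).
      by rewrite addrA subrK => h5; move: h4 h5 A0; rewrite !mulrBr; lra.
  have [df fA] : derivable f z 1 /\ `|derive1 f z| <= A.
    by apply/not_notP => h; apply: Nz; exact: fN.
  have [r r0 rP] := near_derive1 df e10.
  have near w : `|w - z| < r -> `|f w - f z| <= (A + e1) * `|w - z|.
    move=> /rP h; have -> : f w - f z = (f w - (f z + derive1 f z * (w - z))) + derive1 f z * (w - z).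
      by ring.
    rewrite (le_trans (ler_normD _ _))// mulrDl addrC lerD// normrM.
    by rewrite ler_wpM2r.
  exists r => // x y ax xz zy yb zx yz [n [c [l [h1 h2 h3 h4]]]].
  exists n, c, l; split=> //.
  - by move=> i /h1[? [? ?]]; split=> //; split=> //; lra.
  - apply: le_trans h3 _; apply: le_measure; rewrite ?inE//; [exact: mUi|exact: mUi|].
    move=> w [Uw /=]; rewrite in_itv/= => /andP[w1 w2]; split=> //=.
    by rewrite in_itv/= w1; lra.
  - have hy : `|f y - f z| <= (A + e1) * (y - z).
      by rewrite -[y - z]ger0_norm ?subr_ge0//; apply: near; rewrite ger0_norm ?subr_ge0//; lra.
    have hx : `|f z - f x| <= (A + e1) * (z - x).
      have nx : `|x - z| = z - x by rewrite distrC ger0_norm ?subr_ge0.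
      by rewrite distrC -nx; apply: near; rewrite nx; lra.
    have h5 := ler_normD (f y - f z) (f z - f a).
    have h6 := ler_normD (f z - f x) (f x - f a).
    rewrite !addrA !subrK in h5 h6.
    by move: h4 h5 h6 hx hy; rewrite !mulrBr; lra.
move=> [n [c [l [h1 h2 h3 h4]]]].
have : \sum_(i < n) `|f (l i) - f (c i)| < e / 2.
  apply: dP => //; rewrite -lte_fin; apply: le_lt_trans h3 _; apply: le_lt_trans Ud.
  by apply: le_measure; rewrite ?inE//; exact: mUi.
by move: h4; rewrite mulrDl; lra.
Qed.

Lemma normr_ln_sub a b c : 0 < c -> c <= a -> c <= b -> `|ln a - ln b| <= c^-1 * `|a - b|.
Proof.
move=> c0; wlog ab : a b / b <= a => [h ca cb|ca cb].
  by have [?|/ltW ?] := leP b a; [exact: h|rewrite distrC (distrC a); exact: h].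
have b0 : 0 < b := lt_le_trans c0 cb; have a0 := lt_le_trans c0 ca.
rewrite !ger0_norm ?subr_ge0 ?ler_ln//.
rewrite -ln_div ?posrE//; have -> : a / b = 1 + (a - b) / b by field; rewrite gt_eqF.
apply: le_trans (le_ln1Dx _) _.
  by rewrite (@lt_le_trans _ _ 0) ?ltrN10// divr_ge0 ?subr_ge0// ltW.
by rewrite mulrC ler_wpM2r ?subr_ge0// lef_pV2 ?posrE.
Qed.

(** On a segment [f] is bounded below by its positive minimum, above which the logarithm is
    Lipschitz. *)
Lemma loc_abs_cont_ln f : continuous f -> (forall x, 0 < f x) -> loc_abs_cont f ->
  loc_abs_cont (fun x => ln (f x)).
Proof.
move=> cf f0 acf a b ab e e0.
have [z /[!in_itv]/= zab fz] := EVT_min ab (@continuous_subspaceT _ _ `[a, b] _ cf).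
have [d d0 dP] := acf a b ab (f z * e) (mulr_gt0 (f0 z) e0).
exists d => // n c l h1 h2 h3.
have in_ab i : (i < n)%N -> a <= c i <= b /\ a <= l i <= b.
  move=> /h1[ac [cl lb]]; split; apply/andP; split=> //; [exact: le_trans lb|exact: le_trans cl].
apply: (@le_lt_trans _ _ ((f z)^-1 * \sum_(i < n) `|f (l i) - f (c i)|)).
  rewrite mulr_sumr; apply: ler_sum => i _; have [ci li] := in_ab _ (ltn_ord i).
  by apply: normr_ln_sub; [exact: f0|apply: fz; rewrite in_itv|apply: fz; rewrite in_itv].
by rewrite mulrC ltr_pdivrMr// mulrC; exact: dP.
Qed.

(** The logarithm of [f] is absolutely continuous and its derivative [f' / f] is bounded by [A]
    almost everywhere, so it is [A]-Lipschitz. This is the only form in which the differential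
    inequality for [phi] is used later. *)
Lemma abs_cont_exp_bound f (A : R) x y : continuous f -> (forall x, 0 < f x) -> loc_abs_cont f ->
  0 <= A -> {ae mu, forall x, derivable f x 1 /\ `|derive1 f x| <= A * `|f x|} ->
  f x <= expR (A * `|x - y|) * f y.
Proof.
move=> cf f0 acf A0 aef.
have ael : {ae mu, forall x, derivable (fun x => ln (f x)) x 1 /\
    `|derive1 (fun x => ln (f x)) x| <= A}.
  case: aef => N [mN N0 NP]; exists N; split=> // z nz; apply: NP => -[df fA]; apply: nz => /=.
  have /is_derive1_ln dl := f0 z.
  have dz : is_derive z 1 f (derive1 f z) by split=> //; rewrite derive1E.
  have dlz := is_derive1_comp dl dz.
  split; first by case: dlz.
  rewrite (is_derive1E dlz) normrM normfV mulrC ler_pdivrMr ?normr_gt0 ?gt_eqF//.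
have lip a b : a <= b -> `|ln (f b) - ln (f a)| <= A * (b - a).
  by move=> ab; exact: (abs_cont_lipschitz A0 (loc_abs_cont_ln cf f0 acf) ael ab).
have : ln (f x) <= A * `|x - y| + ln (f y).
  rewrite -lerBlDr; apply: le_trans (ler_norm _) _.
  have [xy|/ltW xy] := leP y x; first by rewrite [`|x - y|]ger0_norm ?subr_ge0//; exact: lip.
  by rewrite distrC (distrC x) [`|y - x|]ger0_norm ?subr_ge0//; exact: lip.
by rewrite -ler_expR expRD !lnK ?posrE.
Qed.
(** The mean value theorem for [F2 - F1]. With primitives as [F1] and [F2] it compares integrals
    over short intervals. *)
Lemma increment_le (F1 F2 f1 f2 : R -> R) (d : R) : 0 < d ->
  (forall s : R, is_derive s 1 F1 (f1 s)) -> (forall s : R, is_derive s 1 F2 (f2 s)) ->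
  (forall s : R, 0 < s < d -> f1 s <= f2 s) -> F1 d - F1 0 <= F2 d - F2 0.
Proof.
move=> d0 D1 D2 f12.
have D s : is_derive s 1 (fun r => F2 r - F1 r) (f2 s - f1 s).
  by have := D1 s; have := D2 s => ? ?; exact: is_deriveB.
have [|c cd E] := @MVT R (fun r => F2 r - F1 r) (fun r => f2 r - f1 r) 0 d d0 (fun s _ => D s).
  by apply: continuous_subspaceT => z; exact: is_derive1_continuous (D z).
have : 0 <= (F2 d - F1 d) - (F2 0 - F1 0).
  by rewrite E subr0 mulr_ge0 ?(ltW d0)// subr_ge0 f12//; move: cd; rewrite in_itv.
by lra.
Qed.

Definition primitive f x := \int[mu]_(y in `]-oo, x]) f y.

Lemma is_derive_primitive f x : expdecay f -> is_derive x 1 (primitive f) (f x).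
Proof.
move=> ef; have [cf _] := ef.
have [d1 d2] : derivable (primitive f) x 1 /\ (primitive f)^`()%classic x = f x.
  apply: (@continuous_FTC1 _ f -oo%O x (x + 1)).
  - by rewrite ltrDl.
  - exact: integrableS (expdecay_integrable ef).
  - by rewrite ltNyr.
  - exact: cf.
by split; [exact: d1|rewrite -derive1E; exact: d2].
Qed.

(* The average of [f] over [[x, x + d]] is C^1 and differs from [f] by a factor
   [e^(L d)] at most. *)
Lemma average_weight f (L : R) (V : R -> R) (d : R) : expdecay f -> (forall x, 0 < f x) ->
  0 <= L -> (forall x y, f x <= expR (L * `|x - y|) * f y) ->
  (forall x y, f x <= V (x - y) * f y) -> 0 < d -> L * d <= 1 ->
  exists w w' : R -> R, [/\ smooth_weight (L * expR 2) w w',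
    (forall x y, w x <= expR (L * `|x - y|) * w y),
    (forall x y, w x <= V (x - y) * w y) &
    forall x, w x <= expR (L * d) * f x /\ f x <= expR (L * d) * w x].
Proof.
move=> ef f0 L0 fL fV d0 Ld; have [cf [C C_ge0 fC]] := ef.
pose H := primitive f.
have dH x : is_derive x 1 H (f x) by exact: is_derive_primitive.
have dHs c x (s : R) : is_derive s 1 (fun r => c * H (x + r)) (c * f (x + s)).
  by apply: is_derive_eq; rewrite /GRing.scale/=; ring.
have dlin c (s : R) : is_derive s 1 (fun r => c * r) c.
  by apply: is_derive_eq; rewrite /GRing.scale/= mulr1.
pose w x := d^-1 * (H (x + d) - H x).
have di : 0 <= d^-1 by rewrite invr_ge0 ltW.
(* A comparison that holds along a common shift survives averaging; it serves both the exponential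
   and the [V] bound. *)
have shift c x y : (forall s, f (x + s) <= c * f (y + s)) -> w x <= c * w y.
  move=> h; rewrite /w mulrCA ler_wpM2l//.
  have : 1 * H (x + d) - 1 * H (x + 0) <= c * H (y + d) - c * H (y + 0).
    by apply: (increment_le d0 (dHs 1 x) (dHs c y)) => s _; rewrite mul1r; exact: h.
  by rewrite !mul1r !addr0 -mulrBr.
have upper x : w x <= expR (L * d) * f x.
  rewrite /w ler_pdivrMl//.
  have : 1 * H (x + d) - 1 * H (x + 0) <= expR (L * d) * f x * d - expR (L * d) * f x * 0.
    apply: (increment_le d0 (dHs 1 x) (dlin (expR (L * d) * f x))) => s /andP[s0 sd].
    rewrite mul1r (le_trans (fL _ x))// ler_wpM2r ?(ltW (f0 _))// ler_expR ler_wpM2l//.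
    by rewrite addrC addKr ger0_norm (ltW s0, ltW sd).
  by rewrite !mul1r !addr0 mulr0 subr0 mulrC.
have lower x : f x <= expR (L * d) * w x.
  rewrite /w mulrCA ler_pdivlMl//.
  have : f x * d - f x * 0 <= expR (L * d) * H (x + d) - expR (L * d) * H (x + 0).
    apply: (increment_le d0 (dlin (f x)) (dHs (expR (L * d)) x)) => s /andP[s0 sd].
    rewrite (le_trans (fL _ (x + s)))// ler_wpM2r ?(ltW (f0 _))// ler_expR ler_wpM2l//.
    by rewrite distrC [x + s]addrC addrK ger0_norm (ltW s0, ltW sd).
  by rewrite !addr0 mulr0 subr0 -mulrBr mulrC.
have w0 x : 0 < w x.
  by have := lt_le_trans (f0 x) (lower x); rewrite pmulr_rgt0// expR_gt0.
have dw x : is_derive x 1 w (d^-1 * (f (x + d) - f x)).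
  have d1 : is_derive x 1 (fun y => H (y + d)) (f (x + d)).
    have := dHs 1 d x; rewrite !mul1r.
    by under [X in is_derive _ _ X _]eq_fun => r do rewrite mul1r addrC; rewrite addrC.
  have := dH x => d2.
  exact: (is_deriveZ _ (is_deriveB d1 d2)).
have cfd : continuous (fun x => f (x + d)).
  move=> x; apply: continuous_comp; last exact: cf.
  by apply: continuousD; [exact: cvg_id|exact: cvg_cst].
exists w, (fun x => d^-1 * (f (x + d) - f x)); split=> //; first split=> //.
- apply: continuous_mul; first exact: cst_continuous.
  by move=> x; apply: continuousB; [exact: cfd|exact: cf].
- move=> x; rewrite normrM ger0_norm// ler_pdivrMl//.
  set E := expR (L * d) in upper lower.
  have E1 : 1 <= E by rewrite -expR0 ler_expR mulr_ge0// ltW.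
  (* A form of [1 - x <= e^(-x)] at [x = L d]; it yields [e^x - 1 <= x e^x], which bounds the
     increment of [f] by a multiple of [d]. *)
  have LE : (1 - L * d) * E <= 1.
    have := expR_ge1Dx (- (L * d)); rewrite expRN => h1.
    by rewrite -ler_pdivlMr ?expR_gt0// div1r.
  (* One factor [E] comes from the increment of [f], the other from replacing [f] by [w]; with
     [L d <= 1] this is the origin of [e^2] in the smoothed weight. *)
  have EE : E * E <= expR 2.
    by rewrite -expRD ler_expR; lra.
  have xd : `|x + d - x| = d by rewrite addrC addKr gtr0_norm.
  have h1 : f (x + d) <= E * f x by have := fL (x + d) x; rewrite xd.
  have h2 : f x <= E * f (x + d) by have := fL x (x + d); rewrite distrC xd.
  have Ld0 : 0 <= L * d by rewrite mulr_ge0// ltW.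
  have fE : f x <= E * f x by rewrite ler_peMl// ltW.
  have h3 : L * d * f x <= L * d * (E * f x) by rewrite ler_wpM2l.
  have bound : `|f (x + d) - f x| <= L * d * (E * f x).
    rewrite ler_norml; apply/andP; split.
      have := ler_wpM2l (_ : 0 <= 1 - L * d) h2; rewrite subr_ge0 => /(_ Ld).
      rewrite mulrA => h4; have := ler_wpM2r (ltW (f0 (x + d))) LE.
      by rewrite mul1r; move: h3 h4; rewrite mulrBl; lra.
    by have := ler_wpM2r (ltW (f0 x)) LE; move: h1; rewrite !mulrBl -!mulrA; lra.
  rewrite (le_trans bound)// mulrA [L * d]mulrC -!mulrA ler_wpM2l ?(ltW d0)// ler_wpM2l//.
  apply: (@le_trans _ _ (E * E * w x)); last by rewrite ler_wpM2r// ltW.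
  by rewrite -mulrA ler_wpM2l ?expR_ge0.
- split; first by move=> x; exact: is_derive1_continuous (dw x).
  exists (expR (L * d) * C) => [|x]; first by rewrite mulr_ge0 ?expR_ge0.
  rewrite ger0_norm ?(ltW (w0 x))// (le_trans (upper x))// -mulrA ler_wpM2l ?expR_ge0//.
  exact: le_trans (ler_norm _) (fC x).
- move=> x y; apply: shift => s; have -> : x - y = (x + s) - (y + s) by ring.
  exact: fL.
- move=> x y; apply: shift => s; have -> : x - y = (x + s) - (y + s) by ring.
  exact: fV.
Qed.
(* The truncation makes every weighted norm finite, so that no decay of the
   solution is needed. *)
Definition truncated_weight (n : R) (phi : R -> R) x :=
  Num.min (phi x) (n * expR (- (2^-1 * `|x|))).

(** A minimum of two weights is moderate for the sum of their bounds: [C0 v] serves [phi], and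
    [e^(|x|/2)] serves the exponential envelope. *)
Definition moderate_bound (C0 : R) (v : R -> R) x := C0 * v x + expR (2^-1 * `|x|).

(** At [y] the minimum equals one of its two terms, and at [x] it lies below the same term, so each
    bound is inherited from that term. The constant [A + 1] dominates both [A] and the rate 1/2 of
    the envelope. *)
Lemma truncated_weightP (n A C0 : R) (phi v : R -> R) : 0 < n -> 0 <= A -> continuous phi ->
  (forall x, 0 < phi x) -> (forall x, 0 <= v x) -> 0 <= C0 ->
  (forall x y, phi x <= expR (A * `|x - y|) * phi y) ->
  (forall x y, phi (x + y) <= C0 * v x * phi y) ->
  let w := truncated_weight n phi in
  [/\ expdecay w, forall x, 0 < w x,
    forall x y, w x <= expR ((A + 1) * `|x - y|) * w y &
    forall x y, w x <= moderate_bound C0 v (x - y) * w y].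
Proof.
move=> n0 A0 cphi phi0 v0 C00 phiA phiv w.
have nx x : 0 < n * expR (- (2^-1 * `|x|)) by rewrite mulr_gt0 ?expR_gt0.
have w0 x : 0 < w x by rewrite /w /truncated_weight lt_min phi0 nx.
have wphi x : w x <= phi x by rewrite /w /truncated_weight ge_min lexx.
have wn x : w x <= n * expR (- (2^-1 * `|x|)) by rewrite /w /truncated_weight ge_min lexx orbT.
have wcase y : w y = phi y \/ w y = n * expR (- (2^-1 * `|y|)).
  by rewrite /w /truncated_weight minElt; case: ifP; [left|right].
have tri x y : expR (- (2^-1 * `|x|)) <= expR (2^-1 * `|x - y|) * expR (- (2^-1 * `|y|)).
  by rewrite -expRD ler_expR; have := ler_normD (y - x) x; rewrite subrK distrC; lra.
split=> //.
- split.
    have cn : continuous (fun x => n * expR (- (2^-1 * `|x|))).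
      by apply: continuous_mul; [exact: cst_continuous|exact: continuous_exp_norm].
    move=> x; exact: (@continuous_min R _ phi _ x (cphi x) (cn x)).
  by exists n => [|x]; [exact: ltW|rewrite ger0_norm ?(ltW (w0 x))].
- move=> x y; case: (wcase y) => ->.
    rewrite (le_trans (wphi x))// (le_trans (phiA x y))// ler_wpM2r ?(ltW (phi0 _))//.
    by rewrite ler_expR ler_wpM2r// lerDl.
  rewrite (le_trans (wn x))// mulrCA ler_wpM2l ?(ltW n0)// (le_trans (tri x y))//.
  rewrite ler_wpM2r ?expR_ge0// ler_expR ler_wpM2r//; lra.
- move=> x y; rewrite /moderate_bound; case: (wcase y) => ->.
    rewrite (le_trans (wphi x))//; have := phiv (x - y) y; rewrite subrK => /le_trans; apply.
    by rewrite ler_wpM2r ?(ltW (phi0 _))// lerDl expR_ge0.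
  rewrite (le_trans (wn x))// mulrCA ler_wpM2l ?(ltW n0)// (le_trans (tri x y))//.
  by rewrite ler_wpM2r ?expR_ge0// lerDr mulr_ge0.
Qed.

Lemma continuous_moderate_bound (C0 : R) (v : R -> R) : continuous v -> continuous (moderate_bound C0 v).
Proof.
move=> cv; apply: continuous_add.
  by apply: continuous_mul; [exact: cst_continuous|exact: cv].
have := @continuous_exp_norm (- 2^-1).
by under [X in continuous X -> _]eq_fun => x do rewrite mulNr opprK.
Qed.

(** The summand 2 is half the integral of [e^(-|x|/2)], what remains of [e^(-|x|) e^(|x|/2)]. *)
Lemma integral_Gker_moderate_bound (C0 I : R) (v : R -> R) : continuous v -> (forall x, 0 <= v x) ->
  0 <= C0 -> (\int[mu]_x (v x * expR (- `|x|))%:E = I%:E)%E ->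
  (\int[mu]_x (Gker x * moderate_bound C0 v x)%:E = (2^-1 * (C0 * I) + 2)%:E)%E.
Proof.
move=> cv v0 C00 vI.
have mv : measurable_fun setT (fun x => v x * expR (- `|x|)).
  apply: continuous_measurable_fun; apply: continuous_mul => //.
  by have := @continuous_exp_norm 1; under [X in continuous X -> _]eq_fun => x do rewrite mul1r.
have me : measurable_fun setT (fun x => expR (- (2^-1 * `|x|)) : R).
  by apply: continuous_measurable_fun; exact: continuous_exp_norm.
transitivity (\int[mu]_x ((2^-1 * C0)%:E * (v x * expR (- `|x|))%:E +
    (2^-1)%:E * (expR (- (2^-1 * `|x|)))%:E))%E.
  apply: eq_integral => x _; rewrite -!EFinM -EFinD; congr EFin.
  have -> : expR (- (2^-1 * `|x|)) = expR (- `|x|) * expR (2^-1 * `|x|) :> R.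
    by rewrite -expRD; congr expR; field.
  by rewrite /Gker /moderate_bound; ring.
have h : (0 <= 2^-1 :> R) by rewrite invr_ge0.
rewrite ge0_integralD//; last 3 first.
- by move=> x _; rewrite -EFinM lee_fin !mulr_ge0 ?expR_ge0.
- by apply/measurable_EFinP; apply: measurable_funM.
- by apply/measurable_EFinP; apply: measurable_funM.
rewrite ge0_integralZl_EFin//; last 3 first.
- by move=> x _; rewrite lee_fin mulr_ge0 ?expR_ge0.
- exact/measurable_EFinP.
- by rewrite mulr_ge0.
rewrite ge0_integralZl_EFin//; last first.
- exact/measurable_EFinP.
rewrite vI integral_exp_norm// -!EFinM -EFinD; congr EFin.
by field.
Qed.

(** * Essential suprema of continuous functions, and pairing with test functions *)

Lemma lebesgue_measure_setT_gt0 : (0 < mu setT)%E.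
Proof.
apply: (@lt_le_trans _ _ (mu [set` `[0, 1 : R]])); last by apply: le_measure; rewrite ?inE.
by rewrite lebesgue_measure_itv/= lte_fin ltr01 oppr0 adde0 lte_fin ltr01.
Qed.

Lemma continuous_le_ae f b : continuous f -> {ae mu, forall x, f x <= b} -> forall x, f x <= b.
Proof.
move=> cf [N [mN N0 fN]] x; rewrite leNgt; apply/negP => bf.
have /nbhs_ballP[r /= r0 rP] : \forall y \near x, b < f y.
  by have /cvgr_gt/(_ b bf) := cf x.
have sub : [set` `]x - r, x + r[] `<=` N.
  move=> y /=; rewrite in_itv/= => /andP[xy yx]; apply: fN => /=.
  by apply/negP; rewrite -ltNge; apply: rP; rewrite /ball/= ltr_norml; apply/andP; split; lra.
have : (mu [set` `](x - r)%R, (x + r)%R[] <= mu N)%E by apply: le_measure; rewrite ?inE.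
rewrite N0 lebesgue_measure_itv/= lte_fin ltrD2l gtrN// -EFinD lee_fin leNgt.
by move=> /negP; apply; lra.
Qed.

Lemma Lp_norm_oo_le f (b : \bar R) : (forall x, (`|f x|%:E <= b)%E) -> (Lp_norm +oo f <= b)%E.
Proof.
move=> fb; rewrite /Lp_norm unlock lebesgue_measure_setT_gt0.
by apply/ess_sup_inf.ess_supP; exists set0; split=> // x /= /(_ (fb x)).
Qed.

(** For a continuous function an almost everywhere bound holds everywhere, so sup norms can be read
    pointwise. The value [-oo] of the essential supremum is excluded because it would make the whole
    line a null set. *)
Lemma le_Lp_norm_oo f x : continuous f -> (`|f x|%:E <= Lp_norm +oo f)%E.
Proof.
move=> cf; rewrite /Lp_norm unlock lebesgue_measure_setT_gt0.
have := ess_sup_inf.ess_sup_ge mu (abse \o (fun x => (f x)%:E)).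
case: (ess_sup_inf.ess_sup _ _) => [b|_|]; last 2 first.
- exact: leey.
- case=> N [mN N0 NP]; exfalso; have := lebesgue_measure_setT_gt0.
  rewrite (_ : setT = N) ?N0 ?ltxx//.
  by apply/seteqP; split=> // y _; apply: NP => /=; rewrite leeNy_eq.
case=> N [mN N0 NP]; rewrite lee_fin.
apply: (@continuous_le_ae (fun x => `|f x|) b (continuous_normr cf)).
by exists N; split=> // y /= fy; apply: NP => /=; rewrite lee_fin.
Qed.

Lemma compact_support_expdecay psi (K : R) : continuous psi ->
  (forall x, K < `|x| -> psi x = 0) -> expdecay psi.
Proof.
move=> cpsi psi0; split=> //.
have KK : - `|K| <= `|K| by rewrite lerNl (le_trans _ (normr_ge0 K))// oppr_le0.
have cn := continuous_normr cpsi.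
have [z _ zP] := EVT_max KK (@continuous_subspaceT _ _ `[- `|K|, `|K|] _ cn).
exists (`|psi z| * expR (2^-1 * `|K|)) => [|x]; first by rewrite mulr_ge0 ?expR_ge0.
have [Kx|xK] := ltP `|K| `|x|.
  by rewrite psi0 ?normr0 ?mulr_ge0 ?expR_ge0// (le_lt_trans (ler_norm _)).
rewrite -mulrA -expRD -[leLHS]mulr1 ler_pM//; first by apply: zP; rewrite in_itv/= -ler_norml.
by rewrite -expR0 ler_expR subr_ge0 ler_wpM2l ?invr_ge0.
Qed.

Lemma test_fun_expdecay psi : test_fun psi -> expdecay psi /\ expdecay (derive1 psi).
Proof.
move=> [dpsi [cpsi' [K psi0]]]; split.
  apply: compact_support_expdecay psi0 => x.
  exact/differentiable_continuous/derivable1_diffP.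
apply: (@compact_support_expdecay _ K) => // x Kx.
apply: is_derive1E; apply: (@near_eq_is_derive _ _ _ (cst 0)).
  have : \forall y \near x, K < `|y|.
    by have /cvgr_gt/(_ K Kx) := @norm_continuous _ R x.
  by apply: filterS => y Ky; rewrite psi0.
Qed.

Lemma in_L2_integrable f psi : in_L2 f -> expdecay psi ->
  mu.-integrable setT (fun x => (f x * psi x)%:E).
Proof.
move=> [mf f2] epsi.
have if2 : mu.-integrable setT (fun x => (f x ^+ 2)%:E).
  apply/integrableP; split; first by apply/measurable_EFinP; apply: measurable_funX.
  by under eq_integral => x _ do rewrite gee0_abs ?lee_fin ?sqr_ge0//.
have [C C0 psiC] := expdecay_bounded epsi.
have ip2 : mu.-integrable setT (fun x => (psi x * psi x)%:E).
  by apply: expdecay_integrable; apply: (expdecayM psiC) => //; case: epsi.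
apply: (@le_integrable _ _ R mu setT measurableT _
  (fun x => (f x ^+ 2)%:E + (psi x * psi x)%:E)%E) => //; last exact: integrableD.
- apply/measurable_EFinP; apply: measurable_funM => //.
  by apply: continuous_measurable_fun; case: epsi.
- move=> x _ /=; rewrite lee_fin [leRHS]ger0_norm; last first.
    by rewrite addr_ge0 ?sqr_ge0// -expr2 sqr_ge0.
  rewrite ler_norml; have := sqr_ge0 (f x - psi x); have := sqr_ge0 (f x + psi x).
  have := sqr_ge0 (f x); have := sqr_ge0 (psi x); rewrite !expr2 => *.
  by apply/andP; split; nra.
Qed.

(** The integrals take extended real values and can be subtracted only when finite; square
    integrability of all four functions ensures this. *)
Lemma weak_derivB f1 g1 f2 g2 : in_L2 f1 -> in_L2 g1 -> in_L2 f2 -> in_L2 g2 ->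
  weak_deriv f1 g1 -> weak_deriv f2 g2 ->
  weak_deriv (fun x => f1 x - f2 x) (fun x => g1 x - g2 x).
Proof.
move=> L1 G1 L2 G2 w1 w2 psi tpsi; have [e0 e1] := test_fun_expdecay tpsi.
have sub h1 h2 chi : in_L2 h1 -> in_L2 h2 -> expdecay chi ->
    (\int[mu]_x ((h1 x - h2 x) * chi x)%:E =
     \int[mu]_x (h1 x * chi x)%:E - \int[mu]_x (h2 x * chi x)%:E)%E.
  move=> i1 i2 ec; rewrite -integralB//; [|exact: in_L2_integrable|exact: in_L2_integrable].
  by apply: eq_integral => x _; rewrite mulrBl EFinB.
rewrite !sub// w1// w2//.
have fin h : in_L2 h -> (\int[mu]_x (h x * psi x)%:E)%E \is a fin_num.
  by move=> ih; apply: integrable_fin_num => //; exact: in_L2_integrable.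
move: (fin _ G1) (fin _ G2).
by case: (\int[mu]_x _)%E => // r _; case: (\int[mu]_x _)%E => // r' _ /=; congr EFin; ring.
Qed.

(** * Uniform regularity in time *)

Lemma sob_data_Hs_sq k (sigma : R) f (g : nat -> R -> R) : sob_data k sigma f g -> (Hs_sq k sigma g < +oo)%E.
Proof.
move=> [_ [_ [L2 Gg]]]; rewrite /Hs_sq lte_add_pinfty//.
  by rewrite big_nat_cond; apply: lte_sum_pinfty => j /andP[/andP[_ jk] _]; case: (L2 _ jk).
by case: ifP => // /Gg.
Qed.

(** The embedding is used twice: on [u t], for boundedness and continuity of the derivative, and on
    [u t - u t0], whose Sobolev data are the differences of the data, for continuity in time with
    values in C^1. *)
Lemma C_Hs_regular (T s : R) (u : R -> R -> R) : 3 / 2 < s -> C_Hs T s u ->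
  (forall t, 0 <= t <= T -> forall x, derivable (u t) x 1) ->
  (forall t, 0 <= t <= T -> continuous (derive1 (u t)) /\
     exists B : R, forall x, `|u t x| <= B /\ `|derive1 (u t) x| <= B) /\
  (forall t0, 0 <= t0 <= T -> forall e, 0 < e -> exists2 d : R, 0 < d &
     forall t, 0 <= t <= T -> `|t - t0| < d -> forall x,
       `|u t x - u t0 x| <= e /\ `|derive1 (u t) x - derive1 (u t0) x| <= e).
Proof.
move=> s32 [k [sigma [sE [s01 [g [gsob gC]]]]]] du.
have [|C C0 sob] := @sobolev_C1 k sigma s01; first by rewrite -sE.
split=> [t tT|t0 t0T e e0].
  have [g0 [gw [gL gG]]] := gsob _ tT.
  have Hfin := sob_data_Hs_sq (gsob _ tT).
  have H0 : (0 <= Hs_sq k sigma (g t))%E.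
    rewrite /Hs_sq adde_ge0//; last by case: ifP => // _; exact: gagliardo_ge0.
    by rewrite sume_ge0// => j _; exact: L2sq_ge0.
  have S0 : 0 <= fine (Hs_sq k sigma (g t)) by exact: fine_ge0.
  (* With [S] the squared norm, [S <= (S + 1)^2] provides the squared bound asked for, and [S + 1]
     is positive even when [S = 0]. *)
  have S1 : 0 < fine (Hs_sq k sigma (g t)) + 1 by rewrite ltr_wpDl.
  have [|cu uB] := sob (u t) (g t) _ S1 (du _ tT) g0 gw (fun j jk => (gL j jk).1).
    rewrite -[leLHS]fineK ?ge0_fin_numE// lee_fin; nra.
  by split=> //; eexists; exact: uB.
have eC : 0 < e / C by rewrite divr_gt0.
have [d d0 dP] := gC _ t0T _ (exprn_gt0 2 eC).
exists d => // t tT tt0 x.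
have [g0 [gw [gL gG]]] := gsob _ tT; have [g0' [gw' [gL' gG']]] := gsob _ t0T.
have dB y : is_derive y 1 (fun y => u t y - u t0 y) (derive1 (u t) y - derive1 (u t0) y).
  have d1 : is_derive y 1 (u t) (derive1 (u t) y) by split; [exact: du|rewrite derive1E].
  have d2 : is_derive y 1 (u t0) (derive1 (u t0) y) by split; [exact: du|rewrite derive1E].
  exact: is_deriveB.
have [||j jk|j jk||_ /(_ x)] := sob (fun y => u t y - u t0 y) (fun j y => g t j y - g t0 j y)
    (e / C) eC.
- by move=> y; case: (dB y).
- by rewrite g0 g0'.
- by apply: weak_derivB; [exact: gL (ltnW _)|exact: gL|exact: gL' (ltnW _)|exact: gL'|
    exact: gw|exact: gw'].
- by apply: measurable_funB; [case: (gL _ jk)|case: (gL' _ jk)].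
- by apply/ltW/dP.
by rewrite (is_derive1E (dB x)) mulrC divfK ?gt_eqF.
Qed.

(** Compactness of [[0, T]] by continuous induction: near [z] every [h t] is within 1 of [h z]. *)
Lemma locally_bounded_bounded (T : R) (h : R -> R -> R) : 0 <= T ->
  (forall t, 0 <= t <= T -> exists B : R, forall x, `|h t x| <= B) ->
  (forall t0, 0 <= t0 <= T -> exists2 d : R, 0 < d &
     forall t, 0 <= t <= T -> `|t - t0| < d -> forall x, `|h t x - h t0 x| <= 1) ->
  exists B : R, forall t x, 0 <= t <= T -> `|h t x| <= B.
Proof.
move=> T0 hB hC.
apply: (@straddle_induction (fun z => exists B : R, forall t x, 0 <= t <= z -> `|h t x| <= B) 0 T) => //.
  have [B BP] := hB 0 (introT andP (conj (lexx _) T0)).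
  by exists B => t x t0; rewrite (_ : t = 0)//; apply/eqP; rewrite eq_le andbC.
move=> z zT; have [d d0 dP] := hC _ zT; have [B BP] := hB _ zT.
exists d => // x y x0 xz zy yT zx yz [B' B'P].
exists (Num.max B' (B + 1)) => t w /andP[t0 ty]; rewrite le_max.
have [tx|xt] := leP t x; first by rewrite B'P ?t0.
apply/orP; right; have := dP t; rewrite t0 (le_trans ty yT) => /(_ isT).
rewrite ltr_norml => /(_ _ w) h1.
have {}h1 : `|h t w - h z w| <= 1 by apply: h1; apply/andP; split; lra.
by have := ler_normD (h t w - h z w) (h z w); rewrite subrK; have := BP w; lra.
Qed.
(** * Gronwall's inequality from backward Euler steps *)

Implicit Types (T : R).

Definition econtinuous T (f : R -> R) := forall t0, 0 <= t0 <= T -> forall e : R, 0 < e ->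
  exists2 d : R, 0 < d & forall t, 0 <= t <= T -> `|t - t0| < d -> `|f t - f t0| <= e.

(** Consider the infimum of the times [s <= t] with [f t <= f s]. By continuity it is such a time,
    and if it were positive the local hypothesis would supply an earlier one. *)
Lemma left_monotone_le T f : econtinuous T f ->
  (forall t, 0 < t <= T -> exists2 d : R, 0 < d &
     forall s, 0 <= s < t -> t - s < d -> f t <= f s) ->
  forall t, 0 <= t <= T -> f t <= f 0.
Proof.
move=> cf step t /andP[t0 tT]; pose S := [set s | 0 <= s <= t /\ f t <= f s].
have hS : has_inf S.
  by split; [exists t; split=> //; rewrite t0 lexx|exists 0 => s [/andP[]]].
have St : S t by split=> //; rewrite t0 lexx.
have i0 : 0 <= inf S by apply: lb_le_inf => [|s [/andP[]]//]; exists t.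
have it : inf S <= t by apply: ge_inf => //; case: hS.
have fi : f t <= f (inf S).
  apply/ler_addgt0Pr => e e0.
  have [|d d0 dP] := cf (inf S) _ e e0; first by rewrite i0 (le_trans it).
  have [s [/andP[s0 st] fs] si] := inf_adherent d0 hS.
  have is_ : inf S <= s by apply: ge_inf; [case: hS|split=> //; rewrite s0].
  have := dP s; rewrite s0 (le_trans st tT) ger0_norm ?subr_ge0// => /(_ isT).
  by rewrite ltrBlDl => /(_ si); rewrite ler_norml => /andP[]; lra.
have [<-//|i0'] := eqVneq (inf S) 0.
have {}i0' : 0 < inf S by rewrite lt0r i0' i0.
have [|d d0 dP] := step (inf S); first by rewrite i0' (le_trans it).
pose s := Num.max 0 (inf S - d / 2).
have s0 : 0 <= s by rewrite le_max lexx.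
have si : s < inf S by rewrite gt_max i0'; lra.
have fs : f (inf S) <= f s.
  by apply: dP; rewrite ?s0// ltrBlDr -ltrBlDl lt_max; apply/orP; right; lra.
have : inf S <= s.
  by apply: ge_inf; [case: hS|split; [rewrite s0 (le_trans (ltW si))|exact: le_trans fs]].
by rewrite leNgt si.
Qed.

(** A substitute for [z' <= K z + b] when [z] need not be differentiable: the rate is taken at the
    later time [t], and [d] may depend on [t]. *)
Definition backward_euler T (K : R) (b z : R -> R) := forall t, 0 < t <= T ->
  forall e : R, 0 < e -> exists2 d : R, 0 < d &
  forall s, 0 <= s < t -> t - s < d -> z t <= z s + (t - s) * (K * z t + b t + e).

Lemma econtinuous_expRM T (lam : R) (z : R -> R) : 0 <= lam -> econtinuous T z ->
  econtinuous T (fun t => z t * expR (- (lam * t))).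
Proof.
move=> l0 cz t0 t0T e e0; have e2 : 0 < e / 2 by rewrite divr_gt0.
have [d d0 dP] := cz _ t0T _ e2.
have z1 : 0 < `|z t0| + 1 by rewrite ltr_wpDl.
have /cvgrPdist_le/(_ (e / 2 / (`|z t0| + 1)) (divr_gt0 e2 z1))/nbhs_ballP[r /= r0 rP] :
    (expR (- (lam * t)) : R) @[t --> t0] --> expR (- (lam * t0)).
  have ce : is_derive t0 1 (fun t => expR (- (lam * t))) (- lam * expR (- (lam * t0))).
    by apply: is_derive_eq; rewrite /GRing.scale/=; ring.
  exact: (is_derive1_continuous ce).
exists (Num.min d r); first by rewrite lt_min d0.
move=> t tT; rewrite lt_min => /andP[td tr].
have -> : z t * expR (- (lam * t)) - z t0 * expR (- (lam * t0)) =
  (z t - z t0) * expR (- (lam * t)) + z t0 * (expR (- (lam * t)) - expR (- (lam * t0))) by ring.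
rewrite (le_trans (ler_normD _ _))// !normrM [e]splitr lerD//.
  rewrite -[leRHS]mulr1 ler_pM//; first exact: dP.
  rewrite ger0_norm ?expR_ge0// -expR0 ler_expR oppr_le0 mulr_ge0//.
  by case/andP: tT.
have := rP t; rewrite /ball/= distrC => /(_ tr); rewrite distrC => h.
apply: (@le_trans _ _ (`|z t0| * (e / 2 / (`|z t0| + 1)))); first by rewrite ler_wpM2l.
rewrite mulrA ler_pdivrMr// mulrC ler_wpM2l ?(ltW e2)//; lra.
Qed.

Lemma econtinuous_max T (c : R) (z : R -> R) : econtinuous T z -> econtinuous T (fun t => Num.max (z t) c).
Proof.
move=> cz t0 t0T e e0; have [d d0 dP] := cz _ t0T _ e0.
exists d => // t tT td; have := dP t tT td.
by rewrite !maxEle; case: (leP (z t) c); case: (leP (z t0) c);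
  rewrite !ler_norml => ? ? /andP[? ?]; apply/andP; split; lra.
Qed.

(** As long as [z(t) e^(-lam t)] exceeds [c], its growth rate [K g + b] is below the discount rate
    [lam g], so earlier values were at least as large. Hence the maximum of this quantity and [c] is
    left monotone in the sense of [left_monotone_le]. *)
Lemma backward_euler_barrier T (K lam b c : R) (z : R -> R) : 0 <= K -> K < lam -> 0 <= b -> 0 <= c ->
  b < (lam - K) * c -> z 0 <= c -> econtinuous T z ->
  backward_euler T K (fun t => b * expR (lam * t)) z ->
  forall t, 0 <= t <= T -> z t <= c * expR (lam * t).
Proof.
move=> K0 Kl b0 c0 bc z0 cz ez.
have l0 : 0 <= lam by rewrite (le_trans K0)// ltW.
pose f t := Num.max (z t * expR (- (lam * t))) c.
have E t : expR (- (lam * t)) * expR (lam * t) = 1 by rewrite -expRD addNr expR0.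
suff fle t : 0 <= t <= T -> f t <= f 0.
  move=> t tT; have := fle t tT; rewrite {2}/f mulr0 oppr0 expR0 mulr1 (max_r z0).
  rewrite /f ge_max lexx andbT => /(ler_wpM2r (expR_ge0 (lam * t))).
  by rewrite -mulrA E mulr1.
apply: (@left_monotone_le T); first exact/econtinuous_max/econtinuous_expRM.
move=> {}t /andP[t0 tT].
have [gt|gt] := leP (z t * expR (- (lam * t))) c.
  by exists 1 => // s _ _; rewrite /f (max_r gt) le_max lexx orbT.
set g := z t * expR (- (lam * t)) in gt.
have g0 : 0 < g by exact: le_lt_trans c0 gt.
(* The margin of the discount over the growth; half of it is spent on the error of the Euler
   step. *)
pose eta := (lam - K) * g - b.
have eta0 : 0 < eta.
  by rewrite subr_gt0 (lt_trans bc)// ltr_pM2l// subr_gt0.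
have ee0 : 0 < eta / 2 * expR (lam * t) by rewrite mulr_gt0 ?expR_gt0// divr_gt0.
have [d d0 dP] := ez t (introT andP (conj t0 tT)) _ ee0.
have N0 : 0 < K * g + b + eta / 2.
  apply: ltr_wpDl; last by rewrite divr_gt0.
  by rewrite addr_ge0// mulr_ge0// ltW.
pose D := lam * (K * g + b + eta / 2).
have D0 : 0 <= D by rewrite mulr_ge0// ltW.
have D1 : 0 < D + 1 by rewrite ltr_wpDl.
(* Three smallness conditions on the step [h]: the Euler inequality holds, the second-order term
   [h D] is at most [eta / 2], and the lower bound for [gs] stays nonnegative so that it can be
   multiplied by [1 + lam h <= e^(lam h)]. *)
exists (Num.min d (Num.min (eta / 2 / (D + 1)) (g / (K * g + b + eta / 2)))).
  by rewrite !lt_min d0 !divr_gt0.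
move=> s /andP[s0 st]; rewrite !lt_min => /andP[hd /andP[h1 h2]].
have := dP s; rewrite s0 st => /(_ isT hd) => zE.
set h := t - s in hd h1 h2 zE *; have h0 : 0 < h by rewrite subr_gt0.
have zg : z t = g * expR (lam * t) by rewrite /g -mulrA E mulr1.
pose gs := z s * expR (- (lam * s)).
have key : g - h * (K * g + b + eta / 2) <= gs * expR (- (lam * h)).
  have /(ler_wpM2r (expR_ge0 (- (lam * t)))) := zE.
  have -> : (z s + h * (K * z t + b * expR (lam * t) + eta / 2 * expR (lam * t))) * expR (- (lam * t)) =
    z s * expR (- (lam * t)) + h * (K * g + b + eta / 2) * (expR (- (lam * t)) * expR (lam * t)).
    by rewrite zg; ring.
  rewrite E mulr1 -/g -lerBlDr.
  have -> : gs * expR (- (lam * h)) = z s * expR (- (lam * t)).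
    by rewrite /gs -mulrA -expRD; congr (_ * expR _); rewrite /h; ring.
  by [].
have kb : 0 <= g - h * (K * g + b + eta / 2).
  by rewrite subr_ge0 -ler_pdivlMr// (ltW h2).
suff gg : g <= gs by rewrite /f -/gs -/g (max_l (ltW gt)) le_max gg.
have h4 : (g - h * (K * g + b + eta / 2)) * expR (lam * h) <= gs.
  have /(ler_wpM2r (expR_ge0 (lam * h))) := key; by rewrite -mulrA E mulr1.
apply: le_trans h4.
apply: (@le_trans _ _ ((g - h * (K * g + b + eta / 2)) * (1 + lam * h))); last first.
  by rewrite ler_wpM2l// expR_ge1Dx.
have -> : (g - h * (K * g + b + eta / 2)) * (1 + lam * h) = g + h * (eta / 2 - h * D).
  by rewrite /D /eta; field.
rewrite lerDl mulr_ge0 ?(ltW h0)// subr_ge0.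
move: h1; rewrite ltr_pdivlMr// => /ltW; apply: le_trans.
by rewrite ler_wpM2l ?(ltW h0)// lerDl.
Qed.

(* With [Q = sup (Y t e^(- lam t))], the barrier lemma applied to [z] gives
   [Q <= c] as soon as [Y 0 < c] and [b0 Q < (lam - K) c]; since
   [b0 < lam - K], this forces [Q <= Y 0]. *)
Lemma gronwall_approx T (K b0 lam Ymax : R) (Y : R -> R) : 0 <= K -> 0 <= b0 -> K + b0 < lam ->
  (forall t, 0 <= t <= T -> 0 <= Y t <= Ymax) ->
  (forall e, 0 < e -> forall t, 0 <= t <= T -> exists z : R -> R,
    [/\ econtinuous T z, z 0 <= Y 0 + e, backward_euler T K (fun r => (b0 + e) * Y r) z &
        Y t <= z t + e]) ->
  forall t, 0 <= t <= T -> Y t <= Y 0 * expR (lam * t).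
Proof.
move=> K0 b00 Kbl YB approx.
have Kl : 0 < lam - K by rewrite subr_gt0 (le_lt_trans _ Kbl)// lerDl.
have l0 : 0 <= lam by rewrite (le_trans K0)// -subr_ge0 ltW.
have E t : expR (- (lam * t)) * expR (lam * t) = 1 by rewrite -expRD addNr expR0.
move=> t tT; have /andP[t0 t1] := tT; have T0 : (0 : R) <= 0 <= T by rewrite lexx (le_trans t0).
pose S := [set Y r * expR (- (lam * r)) | r in [set r | 0 <= r <= T]].
have hS : has_sup S.
  split; first by exists (Y 0 * expR (- (lam * 0))); exists 0.
  exists Ymax => _ [r rT <-]; have /andP[y0 yB] := YB _ rT; have /andP[r0 _] := rT.
  rewrite (le_trans _ yB)// ler_piMr// -expR0 ler_expR oppr_le0 mulr_ge0//.
have YS r : 0 <= r <= T -> Y r <= sup S * expR (lam * r).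
  move=> rT; have : Y r * expR (- (lam * r)) <= sup S.
    by apply: ub_le_sup; [case: hS|exists r].
  by move=> /(ler_wpM2r (expR_ge0 (lam * r))); rewrite -mulrA E mulr1.
have S0 : Y 0 <= sup S by have := YS 0 T0; rewrite mulr0 expR0 mulr1.
have Y00 : 0 <= Y 0 by case/andP: (YB 0 T0).
have SS : 0 <= sup S := le_trans Y00 S0.
suff le c : Y 0 < c -> b0 * sup S < (lam - K) * c -> sup S <= c.
  apply: le_trans (YS t tT) _; rewrite ler_wpM2r ?expR_ge0// leNgt; apply/negP => YS0.
  have S1 : 0 < sup S := le_lt_trans Y00 YS0.
  have bS : b0 * sup S / (lam - K) < sup S.
    by rewrite ltr_pdivrMr// mulrC ltr_pM2l//; lra.
  pose c := (Num.max (Y 0) (b0 * sup S / (lam - K)) + sup S) / 2.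
  have mS : Num.max (Y 0) (b0 * sup S / (lam - K)) < sup S by rewrite gt_max YS0.
  have cS : c < sup S by rewrite /c; lra.
  have mc : Num.max (Y 0) (b0 * sup S / (lam - K)) < c by rewrite /c; lra.
  move: mc; rewrite gt_max => /andP[Yc bc].
  have := le c Yc; rewrite ltr_pdivrMr// [c * _]mulrC in bc => /(_ bc).
  by rewrite leNgt cS.
move=> Yc bc; apply: ge_sup; first by case: hS.
move=> _ [r rT <-]; have /andP[r0 _] := rT.
suff : Y r <= c * expR (lam * r).
  move=> /(ler_wpM2r (expR_ge0 (- (lam * r)))).
  by rewrite -[c * _ * _]mulrA [expR _ * expR (- _)]mulrC E mulr1.
have c0 : 0 <= c by rewrite (le_trans Y00)// ltW.
have gap : 0 < (lam - K) * c - b0 * sup S by rewrite subr_gt0.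
have S1 : 0 < sup S + 1 by rewrite ltr_wpDl.
apply/ler_addgt0Pr => e e0.
(* Room for the final error [e], for the initial value [Y 0 + e' <= c], and for
   [(b0 + e') sup S < (lam - K) c]; the last inequality is strict thanks to [sup S + 1]. *)
pose e' := Num.min e (Num.min (c - Y 0) (((lam - K) * c - b0 * sup S) / (sup S + 1))).
have e'0 : 0 < e' by rewrite !lt_min e0 subr_gt0 Yc divr_gt0.
have : e' <= e' by [].
rewrite {2}/e' !le_min ler_pdivlMr// => /andP[e'e /andP[e'c e'S]].
have [z [cz z0 zE Yz]] := approx _ e'0 _ rT.
apply: le_trans Yz _; apply: lerD => //.
apply: (@backward_euler_barrier T K lam ((b0 + e') * sup S) c z) => //.
- by rewrite -subr_gt0.
- by rewrite mulr_ge0// addr_ge0// ltW.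
- by rewrite mulrDr in e'S; rewrite mulrDl; lra.
- by rewrite (le_trans z0)//; lra.
- move=> q qT a a0; have [d d0 dP] := zE q qT a a0; exists d => // w wq qw.
  apply: le_trans (dP w wq qw) _; rewrite lerD2l ler_wpM2l//.
    by case/andP: wq => _ /ltW; rewrite subr_ge0.
  rewrite lerD2r lerD2l -mulrA ler_wpM2l// ?addr_ge0 ?(ltW e'0)//.
  by apply: YS; case/andP: qT => /ltW -> ->.
Qed.

(** * Schur bounds on p-norms, and moving averages as convolutions *)

Lemma measurable_fun_convolution (k h : R -> R) : measurable_fun setT k -> continuous h ->
  (forall x, 0 <= k x) -> measurable_fun setT (fun x => \int[mu]_y (k (x - y) * `|h y|)%:E)%E.
Proof.
move=> mk ch k0.
have mh : measurable_fun setT (fun x => `|h x|).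
  by apply: continuous_measurable_fun; exact: continuous_normr.
have msub : measurable_fun [set: R * R] (fun z : R * R => z.1 - z.2).
  by apply: measurable_funB; [exact: measurable_fst|exact: measurable_snd].
have mkxy : measurable_fun [set: R * R] (fun z : R * R => k (z.1 - z.2)).
  exact: measurableT_comp.
have mE : measurable_fun setT (fun z : R * R => (k (z.1 - z.2) * `|h z.2|)%:E).
  apply/measurable_EFinP; apply: measurable_funM => //.
  exact: measurableT_comp mh measurable_snd.
have E0 (z : R * R) : (0 <= (k (z.1 - z.2) * `|h z.2|)%:E)%E.
  by rewrite lee_fin mulr_ge0.
exact: (@measurable_fun_fubini_tonelli_F _ _ _ _ R mu _ mE).
Qed.

(** [D] need only be dominated by a convolution. As in Hoelder's inequality, a slack keeps [Z]
    positive if [h] vanishes; dividing it by [K + 1] makes its total cost at most [e]. *)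
Lemma schur_Rpairing p (k g h D : R -> R) (K : R) : 2 <= p -> measurable_fun setT k ->
  (forall x, 0 <= k x) -> (\int[mu]_x (k x)%:E <= K%:E)%E ->
  expdecay g -> expdecay h -> expdecay D ->
  (forall x, (`|D x|%:E <= \int[mu]_y (k (x - y) * `|h y|)%:E)%E) -> 0 < pnorm p g ->
  \int[mu]_x (`|g x| `^ (p - 1) * `|D x|) <= pnorm p g `^ (p - 1) * (K * pnorm p h).
Proof.
move=> p2 mk k0 kK eg eh eD Dk Y0; move: Y0; move YE: (pnorm p g) => Y Y0.
have K0 : 0 <= K.
  by rewrite -lee_fin (le_trans _ kK)// integral_ge0// => x _; rewrite lee_fin.
have Yp : 0 < Y `^ (p - 1) by exact: powR_gt0.
have K1 : 0 < K + 1 by rewrite ltr_wpDl.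
apply/ler_addgt0Pr => e e0; pose Z := pnorm p h + e / Y `^ (p - 1) / (K + 1).
have e1 : 0 < e / Y `^ (p - 1) / (K + 1) by rewrite !divr_gt0.
have Z0 : 0 < Z by rewrite ltr_wpDl ?pnorm_ge0.
have gY : pint p g <= Y `^ p by apply: pint_le_pnorm => //; rewrite YE.
have hZ : pint p h <= Z `^ p by apply: pint_le_pnorm => //; rewrite lerDl ltW.
have sch := schur_pairing p2 mk k0 kK eg eh Y0 Z0 gY hZ.
apply: (@le_trans _ _ (K * (Y `^ (p - 1) * Z))).
  rewrite -lee_fin; apply: le_trans sch.
  rewrite /Rintegral fineK; last first.
    by apply: integrable_fin_num => //; exact: (expdecay_integrable (expdecay_pairing p2 eg eD)).
  apply: ge0_le_integral => //.
  - by apply/measurable_EFinP; apply: continuous_measurable_fun; case: (expdecay_pairing p2 eg eD).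
  - apply: emeasurable_funM; last by apply: measurable_fun_convolution => //; case: eh.
    apply/measurable_EFinP; apply: measurable_norm_powR; by case: eg.
  - by move=> x _; rewrite EFinM lee_wpmul2l ?lee_fin ?powR_ge0.
rewrite /Z mulrDr mulrDr mulrCA lerD2l.
have -> : K * (Y `^ (p - 1) * (e / Y `^ (p - 1) / (K + 1))) = e * (K / (K + 1)).
  by field; rewrite !gt_eqF.
by rewrite ler_piMr ?(ltW e0)// ler_pdivrMr// mul1r lerDl.
Qed.

(** The pairing bound with [g = D], divided by the power [p - 1] of the norm of [D]. *)
Lemma schur_pnorm p (k D h : R -> R) (K : R) : 2 <= p -> measurable_fun setT k ->
  (forall x, 0 <= k x) -> (\int[mu]_x (k x)%:E <= K%:E)%E ->
  expdecay h -> expdecay D ->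
  (forall x, (`|D x|%:E <= \int[mu]_y (k (x - y) * `|h y|)%:E)%E) ->
  pnorm p D <= K * pnorm p h.
Proof.
move=> p2 mk k0 kK eh eD Dk.
have p0 : 0 < p by rewrite (lt_le_trans _ p2).
have K0 : 0 <= K.
  by rewrite -lee_fin (le_trans _ kK)// integral_ge0// => x _; rewrite lee_fin.
have [->|y0] := eqVneq (pnorm p D) 0; first by rewrite mulr_ge0 ?pnorm_ge0.
have {}y0 : 0 < pnorm p D by rewrite lt0r y0 pnorm_ge0.
have := schur_Rpairing p2 mk k0 kK eD eh eD Dk y0.
rewrite (_ : \int[mu]_x _ = pnorm p D `^ (p - 1) * pnorm p D).
  by rewrite ler_pM2l// powR_gt0.
rewrite mulrC mulr_powRB1 ?pnorm_ge0// pnorm_powR//; apply: eq_Rintegral => x _.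
by rewrite mulrC mulr_powRB1.
Qed.

(** The window lies to the left of 0 so that [avg_window d (x - y)] selects [y] in [[x, x + d]]. As
    a convolution kernel of mass 1 a moving average falls under the Schur test. *)
Definition avg_window (d : R) x : R := d^-1 * \1_([set` `[- d, 0]] : set R) x.

Lemma avg_window_ge0 (d : R) x : 0 < d -> 0 <= avg_window d x.
Proof. by move=> d0; rewrite mulr_ge0// invr_ge0 ltW. Qed.

Lemma measurable_avg_window (d : R) : measurable_fun setT (avg_window d).
Proof. by apply: measurable_funM => //; exact: measurable_indic. Qed.

Lemma integral_avg_window (d : R) : 0 < d -> (\int[mu]_x (avg_window d x)%:E = 1)%E.
Proof.
move=> d0; under eq_integral => x _ do rewrite EFinM.
have di : 0 <= d^-1 by rewrite invr_ge0 ltW.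
rewrite ge0_integralZl_EFin//; last first.
  by apply/measurable_EFinP; exact: measurable_indic.
by rewrite integral_indic_itv ?oppr_le0 ?ltW// sub0r opprK -EFinM mulVf ?gt_eqF.
Qed.

Lemma le_primitive_avg_window f (d : R) x : expdecay f -> (forall x, 0 <= f x) -> 0 < d ->
  ((d^-1 * (primitive f (x + d) - primitive f x))%:E <=
   \int[mu]_y (avg_window d (x - y) * f y)%:E)%E.
Proof.
move=> ef f0 d0; have ife := expdecay_integrable ef.
have di : 0 <= d^-1 by rewrite invr_ge0 ltW.
have cf : measurable_fun setT f by apply: continuous_measurable_fun; case: ef.
rewrite /primitive Rintegral_itvB ?bnd_simp//; last 2 first.
- exact: integrableS ife.
- by rewrite lerDl ltW.
have iA : mu.-integrable [set` `]x, (x + d)%R]] (EFin \o f) by exact: integrableS ife.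
rewrite EFinM /Rintegral fineK; last exact: integrable_fin_num.
rewrite -ge0_integralZl_EFin//; last 2 first.
- by move=> y _; rewrite lee_fin.
- by apply/measurable_EFinP; exact: measurable_funTS.
have mw : measurable_fun setT (fun y => avg_window d (x - y)).
  by apply: measurableT_comp; [exact: measurable_avg_window|exact: measurable_funB].
apply: (@le_trans _ _ (\int[mu]_(y in [set` `]x, (x + d)%R]]) (avg_window d (x - y) * f y)%:E)%E).
  rewrite le_eqVlt; apply/orP; left; apply/eqP; apply: eq_integral => y.
  rewrite inE/= in_itv/= => /andP[xy yx]; rewrite /avg_window indicE mem_set ?mulr1//=.
  by rewrite in_itv/=; apply/andP; split; lra.
apply: ge0_subset_integral => //.
- by apply/measurable_EFinP; exact: measurable_funM.
- by move=> y _; rewrite lee_fin mulr_ge0// avg_window_ge0.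
Qed.

Lemma increment_primitive_bound (f f' h : R -> R) (W c k d : R) x : 0 <= W -> 0 < d ->
  (forall y, is_derive y 1 f (f' y)) -> expdecay h ->
  (forall s : R, 0 < s < d -> `|f' (x + s)| * W <= c + k * h (x + s)) ->
  `|f (x + d) - f x| * W <= c * d + k * (primitive h (x + d) - primitive h x).
Proof.
move=> W0 d0 df eh bd.
have dsh (F F' : R -> R) a (s : R) : (forall y, is_derive y 1 F (F' y)) ->
    is_derive s 1 (fun r => a * F (x + r)) (a * F' (x + s)).
  move=> dF; have dFx := dF (x + s).
  by apply: is_derive_eq; rewrite /GRing.scale/=; ring.
have dR (s : R) : is_derive s 1 (fun r => c * r + k * primitive h (x + r)) (c + k * h (x + s)).
  have d1 := dsh _ _ k s (fun y => is_derive_primitive y eh).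
  by apply: is_derive_eq; rewrite /GRing.scale/=; ring.
have one a : `|a| = W -> a * (f (x + d) - f x) <= c * d + k * (primitive h (x + d) - primitive h x).
  move=> aW; have := increment_le d0 (fun s => dsh _ _ a s df) dR.
  rewrite !addr0 mulr0 add0r -!mulrBr => h1.
  suff : a * (f (x + d) - f x) <= c * d + k * primitive h (x + d) - k * primitive h x.
    by rewrite -addrA -mulrBr.
  apply: h1 => s sd; apply: le_trans (bd s sd).
  by rewrite (le_trans (ler_norm _))// normrM aW mulrC.
rewrite -[W]ger0_norm// -normrM ler_norml; apply/andP; split.
  rewrite lerNl; have := one (- W); rewrite normrN ger0_norm// => /(_ erefl).
  by rewrite mulNr mulrC.
by have := one W; rewrite ger0_norm// => /(_ erefl); rewrite mulrC.
Qed.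
End integrals_on_the_line.

(** * The energy estimate for the Camassa-Holm equation *)

Section camassa_holm.
Context {R : realType}.
Local Notation mu := (@lebesgue_measure R).
Implicit Types (f g h : R -> R) (x y z a b c : R).
Implicit Types (e d s t T B p : R).

Lemma expR_le1D2 x : 0 <= x -> x <= 2^-1 -> expR x <= 1 + 2 * x.
Proof.
move=> x0 x2; have := expR_ge1Dx (- x); rewrite expRN => h.
have : (1 - x) * expR x <= 1 by rewrite -ler_pdivlMr ?expR_gt0// div1r.
have := expR_gt0 x; nra.
Qed.

(** As [r] tends to 0 the factors [e^r] and [e^(l r)] produced by difference quotients tend to 1;
    [e^x <= 1 + 2 x] on [[0, 1/2]] makes the required smallness of [r] explicit. *)
Lemma small_step_bounds (l r k m y e : R) : 0 <= l -> 0 <= k -> 0 <= m -> 0 <= y -> 0 < r ->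
  r * (l + 1) < 2^-1 -> r * (2 * (l + 1) * (1 + y + (k + 1) * m)) < e ->
  expR (l * r) * y <= y + e /\ (expR r * k + expR (l * r)) * m <= (k + 1) * m + e.
Proof.
move=> l0 k0 m0 y0 r0 rl re.
have lr0 : 0 <= l * r by rewrite mulr_ge0// ltW.
have el : expR (l * r) <= 1 + 2 * (l * r).
  by apply: expR_le1D2 => //; move: rl; rewrite mulrDr mulr1 [r * l]mulrC; lra.
have er : expR r <= 1 + 2 * r.
  by apply: expR_le1D2; [exact: ltW|move: rl; rewrite mulrDr mulr1 [r * l]mulrC; lra].
have h1 := ler_wpM2r y0 el.
have h2 : (expR r * k + expR (l * r)) * m <= ((1 + 2 * r) * k + (1 + 2 * (l * r))) * m.
  by apply: ler_wpM2r => //; apply: lerD => //; apply: ler_wpM2r.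
have h3 : 0 <= r * y by rewrite mulr_ge0// ltW.
have k1 : 0 <= k + 1 by rewrite addr_ge0.
have h4 := mulr_ge0 (mulr_ge0 lr0 k1) m0.
have h5 := mulr_ge0 (mulr_ge0 (ltW r0) k1) m0.
have h6 := mulr_ge0 (mulr_ge0 lr0 k0) m0.
have h7 : 0 <= r * m by rewrite mulr_ge0// ltW.
have h8 : 0 <= l * r * y by rewrite mulr_ge0.
by move: (expR _) (expR _) h1 h2 => ? ? h1 h2; split; lra.
Qed.

(** Adds the Euler rates of [u] and of its difference quotient. The quotient has the extra [m yq]
    from [u_x(x + r)]; granting the same to [yu] gives the common growth rate [(b + 2) m], and the
    two convolution terms give the source rate [(2 k + 1) m] up to [e]. *)
Lemma sum_rates (k m e c b yu yq E a : R) : 0 <= m * yu -> c * m <= (k + 1) * m + e -> 0 <= E ->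
  ((b + 1) * m * yu + k * (m * E) + a / 2) + ((b + 1) * m * yq + (m * yq + c * (m * E)) + a / 2) <=
  (b + 2) * m * (yu + yq) + ((2 * k + 1) * m + e) * E + a.
Proof. by move=> h1 h2 E0; have := ler_wpM2r E0 h2; lra. Qed.

(** The interface between the Sobolev hypothesis and the energy argument: from here on only C^1
    regularity, continuous in time uniformly in [x], is used. *)
Definition regular_solution T (M : R) (u : R -> R -> R) := [/\
  forall t, 0 <= t <= T -> forall x, is_derive x 1 (u t) (derive1 (u t) x),
  forall t, 0 <= t <= T -> forall x, `|u t x| <= M /\ `|derive1 (u t) x| <= M,
  forall t, 0 <= t <= T -> continuous (derive1 (u t)),
  (forall t0, 0 <= t0 <= T -> forall e, 0 < e -> exists2 d : R, 0 < d &
     forall t, 0 <= t <= T -> `|t - t0| < d -> forall x,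
       `|u t x - u t0 x| <= e /\ `|derive1 (u t) x - derive1 (u t0) x| <= e) &
  forall t, 0 < t < T -> forall x, is_derive t 1 (fun r => u r x)
    (- (u t x * derive1 (u t) x + dconv (F_CH (u t)) x))].

Definition moderate_weight (L k0 : R) (V w : R -> R) := [/\
  forall x y, w x <= expR (L * `|x - y|) * w y,
  forall x y, w x <= V (x - y) * w y, continuous V, forall x, 0 <= V x &
  (\int[mu]_x (Gker x * V x)%:E <= k0%:E)%E].

Lemma econtinuous_within T f : econtinuous T f -> {within [set` `[0, T]], continuous f}.
Proof.
move=> cf; apply/subspace_continuousP => t0 /=; rewrite in_itv/= => t0T.
apply/cvgrPdist_le => e e0; have [d d0 dP] := cf _ t0T _ e0.
rewrite near_withinE; apply/nbhs_ballP; exists d => // t; rewrite /ball/= => td tT.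
by rewrite distrC dP ?in_itv// distrC.
Qed.

Section regular_solution_energy.
Context (T M : R) (u : R -> R -> R) (hu : regular_solution T M u).
Context (p B L k0 : R) (V w w' : R -> R) (p2 : 2 <= p) (B0 : 0 <= B) (L0 : 0 <= L).
Context (sw : smooth_weight B w w') (mw : moderate_weight L k0 V w).

Local Notation ux t := (derive1 (u t)).
Local Notation F t := (F_CH (u t)).

Let w0 x : 0 < w x. Proof. by case: sw. Qed.
Let ew : expdecay w. Proof. by case: sw. Qed.
Let p0 : 0 < p. Proof. by rewrite (lt_le_trans _ p2). Qed.

Lemma regular_bcont t : 0 <= t <= T -> bcont (u t).
Proof.
case: hu => du uM cu _ _ tT; split; last by exists M => x; case: (uM _ tT x).
by move=> x; exact: is_derive1_continuous (du _ tT x).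
Qed.

Lemma regular_bcont_derive1 t : 0 <= t <= T -> bcont (ux t).
Proof.
by case: hu => du uM cu _ _ tT; split; [exact: cu|exists M => x; case: (uM _ tT x)].
Qed.

Lemma bcont_F_CH t : 0 <= t <= T -> bcont (F t).
Proof.
move=> tT; have b1 := regular_bcont tT; have b2 := regular_bcont_derive1 tT.
exact: bcontD (bcontM b1 b1) (bcontZ 2^-1 (bcontM b2 b2)).
Qed.

Lemma regular_M_ge0 : 0 <= T -> 0 <= M.
Proof.
case: hu => _ uM _ _ _ T0; have [] := uM 0 _ 0; first by rewrite lexx.
by move=> /(le_trans (normr_ge0 _)).
Qed.

(** One factor of each square is bounded by [M]; the quadratic source thereby becomes linear in the
    energy. *)
Lemma normr_F_CH t x : 0 <= t <= T -> `|F t x| <= M * `|u t x| + M * `|ux t x|.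
Proof.
case: hu => _ uM _ _ _ tT; have [uM1 uM2] := uM _ tT x.
have M0 : 0 <= M by exact: le_trans uM1.
rewrite /F_CH (le_trans (ler_normD _ _))// lerD//.
  by rewrite normrX expr2 ler_wpM2r.
rewrite normrM normrX expr2 ger0_norm ?invr_ge0//.
by have := ler_wpM2r (normr_ge0 (ux t x)) uM2; have := sqr_ge0 `|ux t x|; rewrite expr2; nra.
Qed.

Definition energy t := pnorm p (fun x => u t x * w x) + pnorm p (fun x => ux t x * w x).

Lemma pnorm_F_CH t : 0 <= t <= T -> pnorm p (fun x => F t x * w x) <= M * energy t.
Proof.
move=> tT; have M0 : 0 <= M.
  by case: hu => _ uM _ _ _; have [+ _] := uM _ tT 0; exact: le_trans.
have e1 := bcont_expdecay (regular_bcont tT) ew.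
have e2 := bcont_expdecay (regular_bcont_derive1 tT) ew.
have mz h : expdecay h -> pnorm p (fun x => M * h x) = M * pnorm p h.
  by move=> eh; rewrite (pnormZ p2 _ eh) ger0_norm.
apply: (@le_trans _ _ (pnorm p (fun x => M * (u t x * w x)) +
    pnorm p (fun x => M * (ux t x * w x)))); last by rewrite (mz _ e1) (mz _ e2) -mulrDr.
apply: pnorm_leD => //; [exact: bcont_expdecay (bcont_F_CH tT) ew|exact: expdecayZ|exact: expdecayZ|].
move=> x; rewrite normrM !mulrA ![`|_ * w x|]normrM -mulrDl ler_wpM2r//.
by rewrite !normrM (ger0_norm M0); exact: normr_F_CH.
Qed.

Definition velocity t x := - (u t x * ux t x + dconv (F t) x).

Lemma velocity_uniform t0 : 0 <= t0 <= T -> forall e, 0 < e -> exists2 d : R, 0 < d &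
  forall t, 0 <= t <= T -> `|t - t0| < d -> forall x, `|velocity t x - velocity t0 x| <= e.
Proof.
case: (hu) => _ uM _ uc _ t0T e e0.
have M0 : 0 <= M by have [+ _] := uM _ t0T 0; exact: le_trans.
(* Of the 5, a product such as [u u_x] contributes 2, and [F] contributes [2 + 2 / 2 = 3]. *)
have M1 : 0 < 5 * M + 1 by rewrite ltr_wpDl// mulr_ge0.
have e1 : 0 < e / (5 * M + 1) by rewrite divr_gt0.
have [d d0 dP] := uc _ t0T _ e1; exists d => // t tT td x.
set e' := e / _ in e1 dP.
have prod a b c z : `|a| <= M -> `|z| <= M -> `|a - c| <= e' -> `|b - z| <= e' ->
    `|a * b - c * z| <= 2 * M * e'.
  move=> aM fM ac bf; have -> : a * b - c * z = a * (b - z) + (a - c) * z by ring.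
  rewrite (le_trans (ler_normD _ _))// !normrM.
  have := ler_pM (normr_ge0 a) (normr_ge0 (b - z)) aM bf.
  have := ler_pM (normr_ge0 (a - c)) (normr_ge0 z) ac fM.
  by lra.
have FF y : `|F t y - F t0 y| <= 3 * M * e'.
  have [h1 h2] := dP _ tT td y; have [m1 m2] := uM _ tT y; have [m3 m4] := uM _ t0T y.
  have -> : F t y - F t0 y = (u t y * u t y - u t0 y * u t0 y) +
      2^-1 * (ux t y * ux t y - ux t0 y * ux t0 y) by rewrite /F_CH; ring.
  rewrite (le_trans (ler_normD _ _))// normrM [`|2^-1|]ger0_norm ?invr_ge0//.
  by have := prod _ _ _ _ m1 m3 h1 h1; have := prod _ _ _ _ m2 m4 h2 h2; lra.
have bF := bcont_F_CH tT; have bF0 := bcont_F_CH t0T.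
have dd : `|dconv (F t) x - dconv (F t0) x| <= 3 * M * e'.
  rewrite -dconvB// (le_trans (normr_dconv _ (bcontB bF bF0)))//.
  by apply: conv_le_sup => //; exact: bcontB.
have [h1 h2] := dP _ tT td x; have [m1 m2] := uM _ tT x; have [m3 m4] := uM _ t0T x.
rewrite /velocity.
have oppB a b c z : - (a + b) - - (c + z) = - ((a - c) + (b - z)) by ring.
rewrite oppB normrN (le_trans (ler_normD _ _))//.
have h3 := prod _ _ _ _ m1 m4 h1 h2.
have -> : e = (5 * M + 1) * e' by rewrite /e' mulrC divfK ?gt_eqF.
by lra.
Qed.

(** Moderation, [w x <= V (x - y) * w y], carries the weight inside the integral: a weighted
    convolution with [G] is dominated by a convolution of the weighted function with [G V], whose
    mass is at most [k0]. *)
Lemma conv_moderate f x : bcont f ->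
  ((Defs.conv Gker (fun y => `|f y|) x * w x)%:E <=
   \int[mu]_y (Gker (x - y) * V (x - y) * `|f y * w y|)%:E)%E.
Proof.
case: (mw) => _ wV cV V0 _ bf; have [cf _] := bf.
rewrite EFinM EFin_conv; last exact: bcont_norm.
have mG : measurable_fun setT (fun y => Gker (x - y) * `|f y|).
  apply: measurable_funM; first exact: measurable_Gker_sub.
  by apply: continuous_measurable_fun; exact: continuous_normr.
rewrite muleC -ge0_integralZl_EFin//; last 3 first.
- by move=> y _; rewrite lee_fin mulr_ge0 ?Gker_ge0.
- exact/measurable_EFinP.
- exact: ltW.
apply: ge0_le_integral => //.
- by move=> y _; rewrite -EFinM lee_fin !mulr_ge0 ?Gker_ge0// ltW.
- by apply: emeasurable_funM => //; exact/measurable_EFinP.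
- apply/measurable_EFinP; apply: measurable_funM.
    apply: measurable_funM; first exact: measurable_Gker_sub.
    apply: (measurableT_comp (continuous_measurable_fun cV)).
    exact: measurable_funB.
  apply: continuous_measurable_fun; apply: continuous_normr; apply: continuous_mul => //.
  by case: ew.
- move=> y _; rewrite -EFinM lee_fin mulrC -[leLHS]mulrA -[leRHS]mulrA.
  apply: ler_wpM2l; first exact: Gker_ge0.
  by rewrite normrM (gtr0_norm (w0 y)) [leRHS]mulrCA ler_wpM2l.
Qed.

(** The transport step with velocity [u] and source [- dconv F]; the source is paired by the Schur
    test with kernel [G V]. *)
Lemma energy_euler_u t : 0 < t <= T -> forall e, 0 < e -> exists2 d : R, 0 < d &
  forall s, 0 <= s < t -> t - s < d ->
    pnorm p (fun x => u t x * w x) <= pnorm p (fun x => u s x * w x) +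
      (t - s) * ((B + 1) * M * pnorm p (fun x => u t x * w x) + k0 * (M * energy t) + e).
Proof.
move=> /andP[t0 tT]; have tT' : 0 <= t <= T by rewrite tT ltW.
have sT s : 0 <= s <= t -> 0 <= s <= T.
  by move=> /andP[s0 st]; rewrite s0 (le_trans st).
case: (hu) => du uM cu uc ut; case: (mw) => wL wV cV V0 Vk.
have bF := bcont_F_CH tT'; have bG := bcont_dconv bF.
have eFw := bcont_expdecay bF ew.
have mk : measurable_fun setT (fun x => Gker x * V x).
  apply: measurable_funM; apply: continuous_measurable_fun => //; exact: continuous_Gker.
have kk x : 0 <= Gker x * V x by rewrite mulr_ge0 ?Gker_ge0.
have k00 : 0 <= k0.
  by rewrite -lee_fin (le_trans _ Vk)// integral_ge0// => x _; rewrite lee_fin.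
have FM := pnorm_F_CH tT'.
have b0 : 0 <= k0 * (M * energy t).
  by rewrite mulr_ge0// (le_trans _ FM)// pnorm_ge0.
apply: (@transport_step R p B w w' M _ t u velocity (ux t) (u t) (ux t)
  (fun x => - dconv (F t) x)) => //.
- by move=> s st; exact: regular_bcont (sT _ st).
- exact: du.
- exact: regular_bcont_derive1.
- exact: du.
- exact: cu.
- by move=> x; case: (uM _ tT' x).
- by move=> x; case: (uM _ tT' x).
- by have := bcontZ (-1) bG; under [X in bcont X -> _]eq_fun => x do rewrite mulN1r.
- by move=> x; rewrite /velocity opprD.
- move=> x; apply: econtinuous_within => s0 s0t e e0.
  have [d d0 dP] := uc _ (sT _ s0t) _ e0; exists d => // s st sd.
  by case: (dP _ (sT _ st) sd x).
- move=> s x /andP[s0 st]; apply: ut; rewrite s0; exact: lt_le_trans st tT.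
- move=> e e0; have [d d0 dP] := velocity_uniform tT' e0; exists d => // s st sd x.
  apply: dP; first exact: sT.
  by case/andP: st => _ st; rewrite distrC ger0_norm ?subr_ge0.
move=> Y0; apply: le_trans (schur_Rpairing p2 mk kk Vk _ eFw _ _ Y0) _.
- exact: bcont_expdecay (regular_bcont tT') ew.
- have := bcont_expdecay (bcontZ (-1) bG) ew.
  by under [X in expdecay X -> _]eq_fun => x do rewrite mulN1r.
- move=> x; apply: le_trans (conv_moderate x bF); rewrite lee_fin.
  by rewrite normrM normrN (gtr0_norm (w0 x)) ler_wpM2r ?(ltW (w0 x))// normr_dconv.
by rewrite ler_wpM2l ?powR_ge0// ler_wpM2l.
Qed.

Definition diff_quotient (r : R) f x := r^-1 * (f (x + r) - f x).

Lemma bcont_shift f (r : R) : bcont f -> bcont (fun x => f (x + r)).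
Proof.
move=> [cf [C fC]]; split; last by exists C.
move=> x; apply: continuous_comp; last exact: cf.
by apply: continuousD; [exact: cvg_id|exact: cvg_cst].
Qed.

Lemma bcont_diff_quotient f (r : R) : bcont f -> bcont (diff_quotient r f).
Proof. by move=> bf; exact: bcontZ (bcontB (bcont_shift r bf) bf). Qed.

Lemma is_derive_shift f f' (r : R) x : (forall y, is_derive y 1 f (f' y)) ->
  is_derive x 1 (fun y => f (y + r)) (f' (x + r)).
Proof.
move=> df; pose k y := y + r.
have dx : is_derive x 1 k 1 by apply: is_derive_eq; rewrite addr0.
have dfx : is_derive (k x) 1 f (f' (k x)) by exact: df.
by have := is_derive1_comp dfx dx; rewrite mulr1.
Qed.

Lemma is_derive_diff_quotient f f' (r : R) x : (forall y, is_derive y 1 f (f' y)) ->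
  is_derive x 1 (diff_quotient r f) (diff_quotient r f' x).
Proof.
by move=> df; exact: is_deriveZ (is_deriveB (is_derive_shift r x df) (df x)).
Qed.

(** A quotient is a mean of [f'] over [[x, x + r]]. The part of [f'] bounded by the constant [c]
    keeps the weight at [x]; the part bounded by [|h|] takes the weight inside the mean at the price
    [e^(L r)] and becomes a convolution with the window. *)
Lemma diff_quotient_bound f f' (h : R -> R) (c r : R) x : 0 < r ->
  (forall y, is_derive y 1 f (f' y)) -> bcont h ->
  (forall s, 0 < s < r -> `|f' (x + s)| <= c + `|h (x + s)|) ->
  ((`|diff_quotient r f x * w x|)%:E <= (c * w x)%:E +
   \int[mu]_y (expR (L * r) * avg_window r (x - y) * `|h y * w y|)%:E)%E.
Proof.
move=> r0 df bh fh; case: (mw) => wL _ _ _ _.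
have ehw := expdecay_norm (bcont_expdecay bh ew).
have := @increment_primitive_bound R f f' _ (w x) (c * w x) (expR (L * r)) r x (ltW (w0 x)) r0 df ehw.
have E0 : 0 <= expR (L * r) by exact: expR_ge0.
move=> inc.
have hyp s : 0 < s < r ->
    `|f' (x + s)| * w x <= c * w x + expR (L * r) * `|h (x + s) * w (x + s)|.
  move=> /[dup] srr /andP[s0 sr].
  apply: (@le_trans _ _ ((c + `|h (x + s)|) * w x)); first by rewrite ler_wpM2r ?fh// ltW.
  rewrite mulrDl lerD2l normrM (gtr0_norm (w0 _)) mulrCA ler_wpM2l//.
  rewrite (le_trans (wL x (x + s)))// ler_wpM2r ?(ltW (w0 _))// ler_expR ler_wpM2l//.
  by rewrite opprD addrA subrr sub0r normrN gtr0_norm// ltW.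
have {inc hyp}h1 := inc hyp.
have ri : 0 <= r^-1 by rewrite invr_ge0 ltW.
have win := le_primitive_avg_window x ehw (fun y => normr_ge0 _) r0.
set P := primitive _ (x + r) - primitive _ x in h1 win.
apply: (@le_trans _ _ ((c * w x)%:E + (expR (L * r))%:E * (r^-1 * P)%:E)%E).
  rewrite -EFinM -EFinD lee_fin /diff_quotient !normrM (ger0_norm ri) (gtr0_norm (w0 x)).
  rewrite -mulrA; apply: le_trans (ler_wpM2l ri h1) _.
  rewrite le_eqVlt; apply/orP; left; apply/eqP; move: P h1 win => P _ _; field.
  by rewrite gt_eqF.
apply: leeD => //; under eq_integral => y _ do rewrite -mulrA EFinM.
rewrite ge0_integralZl_EFin//.
- by apply: lee_wpmul2l => //; rewrite lee_fin.
- by move=> y _; rewrite lee_fin mulr_ge0// avg_window_ge0.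
- apply/measurable_EFinP; apply: measurable_funM.
    by apply: measurableT_comp; [exact: measurable_avg_window|exact: measurable_funB].
  by apply: continuous_measurable_fun; case: ehw.
Qed.

Lemma pnorm_diff_quotient_le (r : R) t : 0 < r -> 0 <= t <= T ->
  pnorm p (fun x => diff_quotient r (u t) x * w x) <=
  expR (L * r) * pnorm p (fun x => ux t x * w x).
Proof.
move=> r0 tT; case: (hu) => du _ _ _ _.
have bx := regular_bcont_derive1 tT.
apply: (@schur_pnorm R p (fun x => expR (L * r) * avg_window r x)) => //.
- by apply: measurable_funM => //; exact: measurable_avg_window.
- by move=> x; rewrite mulr_ge0 ?expR_ge0// avg_window_ge0.
- under eq_integral => x _ do rewrite EFinM.
  rewrite ge0_integralZl_EFin ?expR_ge0//.
  + by rewrite integral_avg_window// mule1.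
  + by move=> x _; rewrite lee_fin avg_window_ge0.
  + by apply/measurable_EFinP; exact: measurable_avg_window.
- exact: bcont_expdecay.
- exact: bcont_expdecay (bcont_diff_quotient r (regular_bcont tT)) ew.
- move=> x; have := @diff_quotient_bound _ _ (ux t) 0 r x r0 (du _ tT) bx.
  by rewrite mul0r add0e; apply => s _; rewrite add0r.
Qed.

Lemma normr_diff_quotientB (f g : R -> R) (e r : R) x : 0 < r -> (forall y, `|f y - g y| <= e) ->
  `|diff_quotient r f x - diff_quotient r g x| <= 2 * e / r.
Proof.
move=> r0 fg; rewrite /diff_quotient.
have -> : r^-1 * (f (x + r) - f x) - r^-1 * (g (x + r) - g x) =
  ((f (x + r) - g (x + r)) - (f x - g x)) / r by ring.
rewrite normrM normfV (gtr0_norm r0) ler_wpM2r ?invr_ge0 ?(ltW r0)//.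
by rewrite (le_trans (ler_normB _ _))//; have := fg x; have := fg (x + r); lra.
Qed.

Lemma diff_quotient_uniform (f : R -> R -> R) (r : R) : 0 < r ->
  (forall t0, 0 <= t0 <= T -> forall e, 0 < e -> exists2 d : R, 0 < d &
     forall t, 0 <= t <= T -> `|t - t0| < d -> forall x, `|f t x - f t0 x| <= e) ->
  forall t0, 0 <= t0 <= T -> forall e, 0 < e -> exists2 d : R, 0 < d &
    forall t, 0 <= t <= T -> `|t - t0| < d -> forall x,
      `|diff_quotient r (f t) x - diff_quotient r (f t0) x| <= e.
Proof.
move=> r0 uf t0 t0T e e0; have e1 : 0 < e * r / 2 by rewrite !mulr_gt0.
have [d d0 dP] := uf _ t0T _ e1; exists d => // t tT td x.
have := normr_diff_quotientB x r0 (dP _ tT td).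
by have -> : 2 * (e * r / 2) / r = e by field; rewrite gt_eqF.
Qed.

Lemma regular_uniform t0 : 0 <= t0 <= T -> forall e, 0 < e -> exists2 d : R, 0 < d &
  forall t, 0 <= t <= T -> `|t - t0| < d -> forall x, `|u t x - u t0 x| <= e.
Proof.
case: hu => _ _ _ uc _ t0T e e0; have [d d0 dP] := uc _ t0T _ e0.
by exists d => // t tT td x; case: (dP _ tT td x).
Qed.

(* The derivative [u_x] is not differentiable in [x], but the quotient
   [q = (u(x + r) - u(x)) / r] solves
   [q_t = - u q_x - q u_x(x + r) - (P(x + r) - P(x)) / r] with [P = dconv F], and
   [P' = Gker * F - F] controls the last term. *)
Lemma energy_euler_diff_quotient (r : R) t : 0 < r -> 0 < t <= T ->
  forall e, 0 < e -> exists2 d : R, 0 < d & forall s, 0 <= s < t -> t - s < d ->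
    pnorm p (fun x => diff_quotient r (u t) x * w x) <=
    pnorm p (fun x => diff_quotient r (u s) x * w x) +
      (t - s) * ((B + 1) * M * pnorm p (fun x => diff_quotient r (u t) x * w x) +
        (M * pnorm p (fun x => diff_quotient r (u t) x * w x) +
         (expR r * k0 + expR (L * r)) * (M * energy t)) + e).
Proof.
move=> r0 /andP[t0 tT]; have tT' : 0 <= t <= T by rewrite tT ltW.
have sT s : 0 <= s <= t -> 0 <= s <= T.
  by move=> /andP[s0 st]; rewrite s0 (le_trans st).
case: (hu) => du uM cu uc ut; case: (mw) => wL wV cV V0 Vk.
have M0 : 0 <= M by have [+ _] := uM _ tT' 0; exact: le_trans.
have bF := bcont_F_CH tT'; have bD := bcont_diff_quotient r (bcont_dconv bF).
have eFw := bcont_expdecay bF ew.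
have bq := bcont_diff_quotient r (regular_bcont tT').
have bux := bcont_shift r (regular_bcont_derive1 tT').
have mGV : measurable_fun setT (fun x => Gker x * V x).
  apply: measurable_funM; apply: continuous_measurable_fun => //; exact: continuous_Gker.
have GV0 x : 0 <= Gker x * V x by rewrite mulr_ge0 ?Gker_ge0.
have k00 : 0 <= k0.
  by rewrite -lee_fin (le_trans _ Vk)// integral_ge0// => x _; rewrite lee_fin.
have FM := pnorm_F_CH tT'.
have ME : 0 <= M * energy t by rewrite (le_trans _ FM)// pnorm_ge0.
(* The two parts of [Gker * F - F] on [[x, x + r]]: the convolution is brought back to [x] with a
   factor [e^r], and the local term is averaged over the window. *)
pose k x := expR r * (Gker x * V x) + expR (L * r) * avg_window r x.
have mk1 : measurable_fun setT (fun x => expR r * (Gker x * V x)) by exact: measurable_funM.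
have mk2 : measurable_fun setT (fun x => expR (L * r) * avg_window r x).
  by apply: measurable_funM => //; exact: measurable_avg_window.
have k10 x : 0 <= expR r * (Gker x * V x) by rewrite mulr_ge0 ?expR_ge0.
have k20 x : 0 <= expR (L * r) * avg_window r x by rewrite mulr_ge0 ?expR_ge0// avg_window_ge0.
have kk x : 0 <= k x by rewrite addr_ge0.
have ik : (\int[mu]_x (k x)%:E <= (expR r * k0 + expR (L * r))%:E)%E.
  under eq_integral => x _ do rewrite EFinD.
  rewrite ge0_integralD//; last 4 first.
  - by move=> x _; rewrite lee_fin.
  - exact/measurable_EFinP.
  - by move=> x _; rewrite lee_fin.
  - exact/measurable_EFinP.
  rewrite EFinD; apply: leeD.
    under eq_integral => x _ do rewrite EFinM.
    rewrite ge0_integralZl_EFin ?expR_ge0//; last 2 first.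
    - by move=> x _; rewrite lee_fin.
    - exact/measurable_EFinP.
    by rewrite EFinM lee_wpmul2l// lee_fin expR_ge0.
  under eq_integral => x _ do rewrite EFinM.
  rewrite ge0_integralZl_EFin ?expR_ge0//; last 2 first.
  - by move=> x _; rewrite lee_fin avg_window_ge0.
  - by apply/measurable_EFinP; exact: measurable_avg_window.
  by rewrite integral_avg_window// mule1.
pose D := diff_quotient r (dconv (F t)).
have Dk x : ((`|D x * w x|)%:E <= \int[mu]_y (k (x - y) * `|F t y * w y|)%:E)%E.
  have bnF := bcont_norm bF.
  have hyp s : 0 < s < r -> `|Defs.conv Gker (F t) (x + s) - F t (x + s)| <=
      expR r * Defs.conv Gker (fun y => `|F t y|) x + `|F t (x + s)|.
    move=> /andP[s0 sr].
    rewrite (le_trans (ler_normB _ _))// lerD2r (le_trans (normr_conv _ bF))//.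
    rewrite (le_trans (conv_shift_le x (ltW s0) bnF (fun y => normr_ge0 _)))//.
    by rewrite ler_wpM2r ?conv_ge0// ler_expR ltW.
  apply: le_trans (diff_quotient_bound r0 (fun y => is_derive_dconv y bF) bF hyp) _.
  rewrite -mulrA EFinM.
  under [leRHS]eq_integral => y _ do rewrite /k mulrDl EFinD.
  have ms (k' : R -> R) : measurable_fun setT k' ->
      measurable_fun setT (fun y => (k' (x - y) * `|F t y * w y|)%:E).
    move=> mk'; apply/measurable_EFinP; apply: measurable_funM.
      by apply: measurableT_comp mk' _; exact: measurable_funB.
    by apply: continuous_measurable_fun; case: (expdecay_norm eFw).
  rewrite ge0_integralD//; last 4 first.
  - by move=> y _; rewrite lee_fin mulr_ge0.
  - exact: (ms _ mk1).
  - by move=> y _; rewrite lee_fin mulr_ge0.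
  - exact: (ms _ mk2).
  apply: leeD => //.
  under [leRHS]eq_integral => y _ do rewrite -[_ * _ * `|_|]mulrA EFinM.
  rewrite ge0_integralZl_EFin ?expR_ge0//; last 2 first.
  - by move=> y _; rewrite lee_fin mulr_ge0.
  - exact: (ms _ mGV).
  by apply: lee_wpmul2l; [rewrite lee_fin expR_ge0|exact: conv_moderate].
apply: (@transport_step R p B w w' M _ t (fun s => diff_quotient r (u s))
  (fun s => diff_quotient r (velocity s)) (diff_quotient r (ux t)) (u t) (ux t)
  (fun x => - (diff_quotient r (u t) x * ux t (x + r)) - D x)) => //.
- by move=> s st; exact: bcont_diff_quotient (regular_bcont (sT _ st)).
- by move=> x; exact: is_derive_diff_quotient (du _ tT').
- exact: bcont_diff_quotient (regular_bcont_derive1 tT').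
- exact: du.
- exact: cu.
- by move=> x; case: (uM _ tT' x).
- by move=> x; case: (uM _ tT' x).
- have := bcontB (bcontZ (-1) (bcontM bq bux)) bD.
  by under [X in bcont X -> _]eq_fun => x do rewrite mulN1r.
(* Discrete product rule: the increment of [u u_x] is [(u(x + r) - u(x)) u_x(x + r)] plus
   [u(x) (u_x(x + r) - u_x(x))]. *)
- move=> x; rewrite /D /diff_quotient /velocity.
  move: (u t x) (u t (x + r)) (ux t x) (ux t (x + r)) (dconv _ x) (dconv _ (x + r)) => *.
  by ring.
- move=> x; apply: econtinuous_within => s0 s0t e e0.
  have [d d0 dP] := diff_quotient_uniform r0 regular_uniform (sT _ s0t) e0.
  by exists d => // s st sd; apply: dP => //; exact: sT.
- move=> s x /andP[s0 st].
  have sT' : 0 < s < T by rewrite s0 (lt_le_trans st).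
  exact: is_deriveZ (is_deriveB (ut _ sT' (x + r)) (ut _ sT' x)).
- move=> e e0; have [d d0 dP] := diff_quotient_uniform r0 velocity_uniform tT' e0.
  exists d => // s st sd x; apply: dP; first exact: sT.
  by case/andP: st => _ st; rewrite distrC ger0_norm ?subr_ge0.
- move=> Y0.
  set g := fun x => diff_quotient r (u t) x * w x in Y0 *.
  have eg : expdecay g by exact: bcont_expdecay.
  have eD : expdecay (fun x => D x * w x) by exact: bcont_expdecay.
  have sch := schur_Rpairing p2 _ kk ik eg eFw eD Dk Y0.
  have e1 := expdecay_pairing p2 eg eg; have e2 := expdecay_pairing p2 eg eD.
  apply: (@le_trans _ _ (\int[mu]_x (M * (`|g x| `^ (p - 1) * `|g x|) +
      `|g x| `^ (p - 1) * `|D x * w x|))).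
    apply: expdecay_le_Rintegral.
    - apply: expdecay_pairing => //; apply: bcont_expdecay => //.
      have := bcontB (bcontZ (-1) (bcontM bq bux)) bD.
      by under [X in bcont X -> _]eq_fun => x do rewrite mulN1r.
    - by apply: expdecayD => //; exact: expdecayZ.
    move=> x; rewrite mulrCA -mulrDr ler_wpM2l ?powR_ge0//.
    rewrite mulrBl (le_trans (ler_normB _ _))// lerD2r mulNr normrN /g mulrAC normrM mulrC.
    by rewrite ler_wpM2r//; case: (uM _ tT' (x + r)).
  rewrite (expdecay_RintegralD (expdecayZ M e1) e2) (expdecay_RintegralZ M e1) mulrDr.
  apply: lerD.
    have -> : \int[mu]_x (`|g x| `^ (p - 1) * `|g x|) = pnorm p g `^ p.
      by rewrite pnorm_powR//; apply: eq_Rintegral => x _; rewrite mulrC mulr_powRB1.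
    by rewrite mulrCA [pnorm p g `^ (p - 1) * _]mulrC mulr_powRB1 ?pnorm_ge0.
  apply: le_trans (sch _) _; first exact: measurable_funD.
  by rewrite ler_wpM2l ?powR_ge0// ler_wpM2l// addr_ge0 ?expR_ge0// mulr_ge0 ?expR_ge0.
- apply: addr_ge0; first by apply: mulr_ge0 => //; exact: pnorm_ge0.
  apply: mulr_ge0 => //; apply: addr_ge0; last exact: expR_ge0.
  by apply: mulr_ge0 => //; exact: expR_ge0.
Qed.

Lemma pnorm_econtinuous (f : R -> R -> R) : (forall t, 0 <= t <= T -> bcont (f t)) ->
  (forall t0, 0 <= t0 <= T -> forall e, 0 < e -> exists2 d : R, 0 < d &
     forall t, 0 <= t <= T -> `|t - t0| < d -> forall x, `|f t x - f t0 x| <= e) ->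
  econtinuous T (fun t => pnorm p (fun x => f t x * w x)).
Proof.
move=> bf uf t0 t0T e e0.
have w1 : 0 < pnorm p w + 1 by rewrite ltr_wpDl ?pnorm_ge0.
have [d d0 dP] := uf _ t0T _ (divr_gt0 e0 w1); exists d => // t tT td.
set e' := e / _ in dP.
have e'0 : 0 <= e' by rewrite divr_ge0 ?(ltW e0)// ltW.
have ee : e' * pnorm p w <= e.
  by rewrite /e' mulrAC ler_pdivrMr// ler_wpM2l ?(ltW e0)// lerDl.
clearbody e'.
have one (a b : R -> R) : bcont a -> bcont b -> (forall x, `|a x - b x| <= e') ->
    pnorm p (fun x => a x * w x) <= pnorm p (fun x => b x * w x) + e.
  move=> ba bb ab.
  have h1 : pnorm p (fun x => a x * w x) <=
      pnorm p (fun x => b x * w x) + pnorm p (fun x => e' * w x).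
    apply: pnorm_leD => //; [exact: bcont_expdecay|exact: bcont_expdecay|exact: expdecayZ|].
    move=> x; rewrite !normrM -mulrDl ler_wpM2r// (ger0_norm e'0).
    by have := ler_normD (a x - b x) (b x); rewrite subrK; have := ab x; lra.
  by apply: le_trans h1 _; rewrite lerD2l pnormZ// ger0_norm.
have h1 := one _ _ (bf _ tT) (bf _ t0T) (dP _ tT td).
have h2 : pnorm p (fun x => f t0 x * w x) <= pnorm p (fun x => f t x * w x) + e.
  by apply: one; [exact: bf|exact: bf|move=> x; rewrite distrC; exact: dP].
by rewrite ler_distl lerBlDr; apply/andP; split; [exact: h2|exact: h1].
Qed.

(** Dominated convergence along [r_n] tending to 0: the quotients converge pointwise to [u_x], and
    the weighted difference is dominated by [2 M w]. A single good [r] below the threshold [d]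
    suffices. *)
Lemma pnorm_diff_quotient_lim t e d : 0 <= t <= T -> 0 < e -> 0 < d ->
  exists2 r : R, 0 < r < d & pnorm p (fun x => ux t x * w x) <=
    pnorm p (fun x => diff_quotient r (u t) x * w x) + e.
Proof.
move=> tT e0 d0; case: (hu) => du uM cu _ _.
have M0 : 0 <= M by have [+ _] := uM _ tT 0; exact: le_trans.
(* [n.+2] gives [r n < d] strictly from [n = 0] on. *)
pose r n : R := d / n.+2%:R.
have r0 n : 0 < r n by rewrite divr_gt0.
have rd n : r n < d by rewrite ltr_pdivrMr// ltr_pMr// ltr1n.
pose D n x := (ux t x - diff_quotient (r n) (u t) x) * w x.
have eD n : expdecay (D n).
  apply: bcont_expdecay ew; apply: bcontB; first exact: regular_bcont_derive1.
  exact: bcont_diff_quotient (regular_bcont tT).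
have xrx x z : x + z - x = z by rewrite addrC addKr.
have Dw n x : `|D n x| <= `|2 * M * w x|.
  rewrite !normrM ler_wpM2r//.
  rewrite (le_trans (ler_normB _ _))//.
  have h1 : `|diff_quotient (r n) (u t) x| <= M.
    have := derive_bound_lipschitz (du _ tT) (fun y => (uM _ tT y).2) (x + r n) x.
    rewrite xrx /diff_quotient [`|_^-1 * _|]normrM normfV (gtr0_norm (r0 n)) => h.
    by rewrite ler_pdivrMl// mulrC.
  have [_ h2] := uM _ tT x.
  by rewrite (ger0_norm M0) [`|2|]ger0_norm//; lra.
have D0 x : D n x @[n --> \oo] --> 0.
  apply/cvgrPdist_le => a a0.
  have a1 : 0 < a / w x by rewrite divr_gt0.
  have dux : derivable (u t) x 1 by case: (du _ tT x).
  have [rho rho0 rhoP] := near_derive1 dux a1.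
  near=> n; rewrite sub0r normrN normrM (gtr0_norm (w0 x)) -ler_pdivlMr//.
  have rn : r n < rho.
    rewrite /r ltr_pdivrMr// mulrC -ltr_pdivrMr//.
    apply: (@lt_trans _ _ n%:R); last by rewrite ltr_nat.
    by near: n; exact: nbhs_infty_gtr.
  have := rhoP (x + r n); rewrite xrx (gtr0_norm (r0 n)) => /(_ rn).
  rewrite distrC /diff_quotient.
  have alg (b1 b2 b3 q : R) : 0 < q -> b1 + b2 * q - b3 = (b2 - q^-1 * (b3 - b1)) * q.
    by move=> q0; field; rewrite gt_eqF.
  rewrite (alg _ _ _ _ (r0 n)) normrM (gtr0_norm (r0 n)) ler_pM2r//.
have edom := expdecay_norm_powR p2 (expdecayZ (2 * M) ew).
have cvg0 : pint p (D n) @[n --> \oo] --> 0.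
  suff : (\int[mu]_x (`|D n x| `^ p)%:E)%E @[n --> \oo] --> (\int[mu]_(x in setT) 0)%E.
    by rewrite integral0 => /fine_cvgP[].
  apply: (@dominated_cvg _ _ R mu setT measurableT (fun n x => (`|D n x| `^ p)%:E)
    (cst 0%E) (fun x => (`|2 * M * w x| `^ p)%:E)) => //.
  - move=> n; apply/measurable_EFinP; apply: continuous_measurable_fun.
    by case: (expdecay_norm_powR p2 (eD n)).
  - move=> x _; apply/fine_cvgP; split; first exact: nearW.
    have cp : {for 0, continuous (fun y => `|y| `^ p)}.
      exact: is_derive1_continuous (is_derive_norm_powR p2 0).
    have := continuous_cvg _ cp (D0 x).
    by rewrite normr0 powR0 ?gt_eqF//; apply.
  - exact: expdecay_integrable.
  - move=> n x _; rewrite gee0_abs ?lee_fin ?powR_ge0//.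
    by apply: ge0_ler_powR; rewrite ?nnegrE// ltW.
have ep : 0 < e `^ p by exact: powR_gt0.
have [n Dn] : exists n, pint p (D n) <= e `^ p.
  near \oo => n; exists n.
  have : `|0 - pint p (D n)| <= e `^ p.
    by near: n; move/cvgrPdist_le: cvg0; apply.
  by rewrite sub0r normrN ger0_norm// pint_ge0.
exists (r n); first by rewrite r0 rd.
have De : pnorm p (D n) <= e.
  have -> : e = (e `^ p) `^ p^-1 by rewrite -powRrM mulfV ?gt_eqF// powRr1// ltW.
  by apply: ge0_ler_powR; rewrite ?nnegrE ?invr_ge0 ?pint_ge0// ltW.
apply: le_trans (lerD (lexx _) De).
apply: pnorm_leD => //.
- exact: bcont_expdecay (regular_bcont_derive1 tT) ew.
- exact: bcont_expdecay (bcont_diff_quotient (r n) (regular_bcont tT)) ew.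
- move=> x; have -> : ux t x * w x = diff_quotient (r n) (u t) x * w x + D n x.
    by rewrite /D; ring.
  exact: ler_normD.
Unshelve. all: by end_near. Qed.

Lemma econtinuousD f g : econtinuous T f -> econtinuous T g -> econtinuous T (fun t => f t + g t).
Proof.
move=> cf cg t0 t0T e e0; have e2 : 0 < e / 2 by rewrite divr_gt0.
have [d1 d10 dP1] := cf _ t0T _ e2; have [d2 d20 dP2] := cg _ t0T _ e2.
exists (Num.min d1 d2); first by rewrite lt_min d10.
move=> t tT; rewrite lt_min => /andP[h1 h2].
by rewrite opprD addrACA (le_trans (ler_normD _ _))// [e]splitr lerD ?dP1 ?dP2.
Qed.

Lemma energy_bound t : 0 <= t <= T -> 0 <= energy t <= 2 * M * pnorm p w.
Proof.
move=> tT; have [_ uM _ _ _] := hu.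
have M0 : 0 <= M by have [+ _] := uM _ tT 0; exact: le_trans.
have bound h : bcont h -> (forall x, `|h x| <= M) -> pnorm p (fun x => h x * w x) <= M * pnorm p w.
  move=> bh hM; rewrite -[M in leRHS]ger0_norm// -(pnormZ p2 M ew).
  apply: pnorm_le => //; [exact: bcont_expdecay|exact: expdecayZ|move=> x].
  by rewrite !normrM ler_wpM2r// (ger0_norm M0).
have h1 := bound _ (regular_bcont tT) (fun x => (uM _ tT x).1).
have h2 := bound _ (regular_bcont_derive1 tT) (fun x => (uM _ tT x).2).
apply/andP; split; first by apply: addr_ge0; exact: pnorm_ge0.
by apply: le_trans (lerD h1 h2) _; rewrite -mulrA mulr_natl mulr2n; exact: lexx.
Qed.

(** The approximants for [gronwall_approx] are the sums of the norms of [u] and of a difference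
    quotient, with [r] depending on [t] and [e]. Their source involves the full energy, because [F]
    contains [u_x] and not the quotient; this is why that lemma keeps [z] and [Y] apart. *)
Lemma energy_gronwall (lam : R) : (B + 2) * M + (2 * k0 + 1) * M < lam ->
  forall t, 0 <= t <= T -> energy t <= energy 0 * expR (lam * t).
Proof.
move=> Mlam t tT.
have T0 : (0 : R) <= 0 <= T by rewrite lexx; case/andP: tT; exact: le_trans.
have M0 : 0 <= M by apply: regular_M_ge0; case/andP: T0.
have k00 : 0 <= k0.
  case: (mw) => _ _ _ V0 Vk; rewrite -lee_fin (le_trans _ Vk)// integral_ge0// => x _.
  by rewrite lee_fin mulr_ge0 ?Gker_ge0.
have K0 : 0 <= (B + 2) * M by rewrite mulr_ge0// addr_ge0.
have b0 : 0 <= (2 * k0 + 1) * M by rewrite mulr_ge0// addr_ge0// mulr_ge0.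
apply: (gronwall_approx K0 b0 Mlam energy_bound) tT => {t} e e0 t tT.
pose y0 := pnorm p (fun x => ux 0 x * w x).
have y00 : 0 <= y0 by exact: pnorm_ge0.
(* Bounding [r] by [1 / (2 (L + 1))] and by [e / N] is what [small_step_bounds] asks for. *)
pose N := 2 * (L + 1) * (1 + y0 + (k0 + 1) * M).
have L1 : 0 < L + 1 by rewrite ltr_wpDl.
have kM : 0 <= (k0 + 1) * M by rewrite mulr_ge0// addr_ge0.
have N0 : 0 < N.
  by rewrite !mulr_gt0// -addrA ltr_pwDl// addr_ge0.
have [|r /andP[r0 rd] ylim] := @pnorm_diff_quotient_lim t e (Num.min (2^-1 / (L + 1)) (e / N)) tT e0.
  by rewrite lt_min !divr_gt0.
move: rd; rewrite lt_min ltr_pdivlMr// ltr_pdivlMr// => /andP[rL rN].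
have [bL bk] := small_step_bounds L0 k00 M0 y00 r0 rL rN.
exists (fun t => pnorm p (fun x => u t x * w x) + pnorm p (fun x => diff_quotient r (u t) x * w x)).
split.
- apply: econtinuousD; first exact: pnorm_econtinuous regular_bcont regular_uniform.
  apply: (@pnorm_econtinuous (fun t => diff_quotient r (u t))).
    by move=> s sT; exact: bcont_diff_quotient (regular_bcont sT).
  exact: diff_quotient_uniform r0 regular_uniform.
- rewrite /energy -addrA lerD2l; exact: le_trans (pnorm_diff_quotient_le r0 T0) bL.
- move=> s sT a a0; have a2 : 0 < a / 2 by rewrite divr_gt0.
  have sT' : 0 <= s <= T by case/andP: sT => /ltW -> ->.
  have [d1 d10 dP1] := energy_euler_u sT a2.
  have [d2 d20 dP2] := energy_euler_diff_quotient r0 sT a2.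
  exists (Num.min d1 d2); first by rewrite lt_min d10.
  move=> q qs; rewrite lt_min => /andP[h1 h2].
  have := lerD (dP1 _ qs h1) (dP2 _ qs h2).
  have sq : 0 <= s - q by case/andP: qs => _ /ltW; rewrite subr_ge0.
  have yu : 0 <= pnorm p (fun x => u s x * w x) by exact: pnorm_ge0.
  have /andP[E0 _] := energy_bound sT'.
  move: (pnorm p (fun x => u s x * w x)) yu => Yu Yu0.
  move: (pnorm p (fun x => u q x * w x)) => Yuq.
  move: (pnorm p (fun x => diff_quotient r (u s) x * w x)) => Yq.
  move: (pnorm p (fun x => diff_quotient r (u q) x * w x)) => Yqq.
  move: (energy s) E0 => E E0 le1; apply: le_trans le1 _.
  rewrite addrACA lerD2l -mulrDr; apply: ler_wpM2l => //.
  by apply: sum_rates => //; exact: mulr_ge0.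
- by rewrite /energy -addrA lerD2l; exact: ylim.
Qed.

End regular_solution_energy.

(** * From smooth to truncated weights *)

Lemma le_of_expR_small a x : 0 <= x -> (forall e, 0 < e -> e <= 2^-1 -> a <= expR e * x) -> a <= x.
Proof.
move=> x0 ax; apply/ler_addgt0Pr => e e0.
have x1 : 0 < 2 * x + 1 by rewrite ltr_wpDl// mulr_ge0.
pose d := Num.min 2^-1 (e / (2 * x + 1)).
have d0 : 0 < d by rewrite lt_min invr_gt0 ltr0n divr_gt0.
have d2 : d <= 2^-1 by rewrite ge_min lexx.
have de : d * (2 * x + 1) <= e by rewrite -ler_pdivlMr// ge_min lexx orbT.
have h := expR_le1D2 (ltW d0) d2; apply: le_trans (ax _ d0 d2) _.
by apply: le_trans (ler_wpM2r x0 h) _; clearbody d; lra.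
Qed.

Lemma pnorm_weight_le p (g w1 w2 : R -> R) (k : R) : 2 <= p -> bcont g -> expdecay w1 ->
  expdecay w2 -> (forall x, 0 <= w1 x) -> 0 <= k -> (forall x, w1 x <= k * w2 x) ->
  pnorm p (fun x => g x * w1 x) <= k * pnorm p (fun x => g x * w2 x).
Proof.
move=> p2 bg e1 e2 w10 k0 w12.
have eg2 := bcont_expdecay bg e2.
rewrite -[k in leRHS]ger0_norm// -(pnormZ p2 k eg2).
apply: pnorm_le => //; [exact: bcont_expdecay|exact: expdecayZ|move=> x].
rewrite mulrCA !normrM ler_wpM2l// -normrM ger0_norm// ger0_norm//.
exact: le_trans (w10 x) (w12 x).
Qed.

(** Passing between the weight and its average costs [expR (L * d)] once at time [t] and once at
    time 0. The choice [L d = e / 2] makes the total [expR e], while the rate stays the same for all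
    [d]. *)
Lemma energy_gronwall_expdecay T (M : R) u p (L k0 : R) (V w : R -> R) (lam : R) :
  regular_solution T M u -> 2 <= p -> 0 < L -> expdecay w -> (forall x, 0 < w x) ->
  moderate_weight L k0 V w -> (L * expR 2 + 2) * M + (2 * k0 + 1) * M < lam ->
  forall t, 0 <= t <= T -> energy u p w t <= energy u p w 0 * expR (lam * t).
Proof.
move=> hu p2 L0 ew w0 [wL wV cV V0 Vk] Mlam t tT.
have T0 : (0 : R) <= 0 <= T by rewrite lexx; case/andP: tT; exact: le_trans.
have E0 : 0 <= energy u p w 0 by apply: addr_ge0; exact: pnorm_ge0.
apply: le_of_expR_small => [|e e0 e2]; first by rewrite mulr_ge0 ?expR_ge0.
pose d := e / 2 / L; have d0 : 0 < d by rewrite !divr_gt0.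
have Ld : L * d = e / 2 by rewrite /d mulrC divfK ?gt_eqF.
have Ld1 : L * d <= 1 by rewrite Ld; lra.
have [w1 [w1' [sw1 w1L w1V ww1]]] := average_weight ew w0 (ltW L0) wL wV d0 Ld1.
have B0 : 0 <= L * expR 2 by rewrite mulr_ge0 ?expR_ge0 ?ltW.
have mw1 : moderate_weight L k0 V w1 by split.
have gr := energy_gronwall hu p2 B0 (ltW L0) sw1 mw1 Mlam tT.
have [w10 _ _ _ ew1] := sw1.
have k_ge0 : 0 <= expR (L * d) by exact: expR_ge0.
have cmp (v1 v2 : R -> R) s : 0 <= s <= T -> expdecay v1 -> expdecay v2 -> (forall x, 0 < v1 x) ->
    (forall x, v1 x <= expR (L * d) * v2 x) -> energy u p v1 s <= expR (L * d) * energy u p v2 s.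
  move=> sT e1 e2' v10 v12; rewrite /energy mulrDr; apply: lerD; apply: pnorm_weight_le => //.
  - exact: (regular_bcont hu sT).
  - by move=> x; exact: ltW.
  - exact: (regular_bcont_derive1 hu sT).
  - by move=> x; exact: ltW.
have h1 := cmp w w1 t tT ew ew1 w0 (fun x => (ww1 x).2).
have h2 := cmp w1 w 0 T0 ew1 ew w10 (fun x => (ww1 x).1).
apply: le_trans h1 _; apply: le_trans (ler_wpM2l k_ge0 gr) _.
have -> : expR e = expR (L * d) * expR (L * d) :> R by rewrite -expRD Ld -splitr.
rewrite -[leRHS]mulrA; apply: ler_wpM2l => //; rewrite mulrA; apply: ler_wpM2r => //.
Qed.

(* The factors [e^(K / p)] of the next two lemmas tend to 1: they transfer the
   estimate for real [p] to [p = +oo]. *)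
Lemma pnorm_upper f (s : R) : expdecay f -> 0 < s -> (forall x, `|f x| <= s) ->
  exists2 K : R, 0 <= K & forall p, 2 <= p -> pnorm p f <= expR (K / p) * s.
Proof.
(* For [y = |f| / s] in [[0, 1]] one has [y^p <= y], so the integral of [|f|^p] is at most [s^p K],
   and [K <= expR K]. *)
move=> ef s0 fs; pose K := \int[mu]_x (s^-1 * `|f x|).
have efs : expdecay (fun x => s^-1 * `|f x|) by exact: expdecayZ (expdecay_norm ef).
have K0 : 0 <= K by apply: Rintegral_ge0 => x _; rewrite mulr_ge0// invr_ge0 ltW.
exists K => // p p2; have p0 : 0 < p by rewrite (lt_le_trans _ p2).
have sp : 0 <= s `^ p by exact: powR_ge0.
have h : pint p f <= s `^ p * K.
  rewrite -expdecay_RintegralZ//; apply: expdecay_le_Rintegral.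
  - exact: expdecay_norm_powR.
  - exact: expdecayZ.
  move=> x; have fx : `|f x| = s * (s^-1 * `|f x|) by rewrite mulVKf ?gt_eqF.
  rewrite {1}fx powRM ?mulr_ge0 ?invr_ge0 ?(ltW s0)//; apply: ler_wpM2l => //.
  have y0 : 0 <= s^-1 * `|f x| by rewrite mulr_ge0// invr_ge0 ltW.
  have y1 : s^-1 * `|f x| <= 1 by rewrite ler_pdivrMl// mulr1.
  rewrite -(mulr_powRB1 y0 p0); apply: ler_piMr => //.
  apply: (@le_trans _ _ (1 `^ (p - 1))); last by rewrite powR1.
  by apply: ge0_ler_powR; rewrite ?nnegrE ?subr_ge0// (le_trans _ p2)// ler1n.
rewrite /pnorm; apply: (@le_trans _ _ ((s * expR (K / p)) `^ p `^ p^-1)).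
  apply: ge0_ler_powR; rewrite ?nnegrE ?invr_ge0 ?pint_ge0 ?powR_ge0 ?(ltW p0)//.
  apply: le_trans h _; rewrite powRM ?expR_ge0 ?(ltW s0)//; apply: ler_wpM2l => //.
  rewrite -expRM mulfVK ?gt_eqF//.
  by have := expR_ge1Dx K; lra.
by rewrite -powRrM mulfV ?gt_eqF// powRr1 ?mulr_ge0 ?expR_ge0 ?(ltW s0)// mulrC.
Qed.

Lemma pnorm_lower f x c : expdecay f -> c < `|f x| ->
  exists2 K : R, 0 <= K & forall p, 2 <= p -> c <= expR (K / p) * pnorm p f.
Proof.
move=> ef cf; have [c0|c0] := ltP c 0.
  by exists 0 => // p _; rewrite mul0r expR0 mul1r (le_trans (ltW c0))// pnorm_ge0.
have [cc _] := ef; have cn := continuous_normr cc.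
have /nbhs_ballP[r /= r0 rP] : \forall y \near x, c < `|f y| by have /cvgr_gt/(_ c cf) := cn x.
(* The length of an interval on which [|f| > c], so that the norm is at least [c l^(1/p)]; [l <= 1]
   makes [- ln l] nonnegative. *)
pose l := Num.min 1 (r / 2); have l0 : 0 < l by rewrite lt_min ltr01 divr_gt0.
have l1 : l <= 1 by rewrite ge_min lexx.
have lr : l <= r / 2 by rewrite ge_min lexx orbT.
have ln0 : 0 <= - ln l by rewrite oppr_ge0 ln_le0.
exists (- ln l) => // p p2; have p0 : 0 < p by rewrite (lt_le_trans _ p2).
have h : l * c `^ p <= pint p f.
  rewrite -lee_fin -EFin_pint//.
  apply: (@le_trans _ _ (\int[mu]_(y in [set` `[x, (x + l)%R]]) (cst (c `^ p)%:E y))%E).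
    rewrite integral_cst//= lebesgue_measure_itv/= lte_fin ltrDl l0 -EFinD addrAC subrr add0r.
    by rewrite -EFinM mulrC.
  have mfp : measurable_fun setT (fun y => (`|f y| `^ p)%:E).
    by apply/measurable_EFinP; apply: continuous_measurable_fun; case: (expdecay_norm_powR p2 ef).
  apply: (@le_trans _ _ (\int[mu]_(y in [set` `[x, (x + l)%R]]) (`|f y| `^ p)%:E)%E).
    apply: ge0_le_integral => //.
    - by move=> y _; rewrite lee_fin powR_ge0.
    - exact: measurable_funTS.
    move=> y /=; rewrite in_itv/= => /andP[xy yx]; rewrite lee_fin.
    apply: ge0_ler_powR; rewrite ?nnegrE ?(ltW p0)//; apply/ltW/rP.
    by rewrite /ball/= distrC ger0_norm ?subr_ge0//; lra.
  by apply: ge0_subset_integral => // y _; rewrite lee_fin powR_ge0.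
have -> : expR (- ln l / p) = l `^ (- p^-1) by rewrite /powR gt_eqF// !mulNr mulrC.
have -> : c = l `^ (- p^-1) * (l * c `^ p) `^ p^-1.
  rewrite powRM ?powR_ge0 ?(ltW l0)// powRN mulKf ?gt_eqF ?powR_gt0//.
  by rewrite -powRrM mulfV ?gt_eqF// powRr1.
apply: ler_wpM2l; first exact: powR_ge0.
apply: ge0_ler_powR => //; rewrite ?nnegrE ?invr_ge0 ?pint_ge0 ?(ltW p0)//.
by rewrite mulr_ge0 ?powR_ge0 ?(ltW l0).
Qed.

(** * Removing the truncation, for finite [p] and for the sup norm *)

Lemma Lp_normE p f : 0 < p -> Lp_norm p%:E f = ((\int[mu]_x (`|f x| `^ p)%:E) `^ p^-1)%E.
Proof. by move=> p0; rewrite /Lp_norm unlock; congr (_ `^ _)%E; apply: eq_integral. Qed.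

Lemma Lp_norm_ge0 (p : \bar R) f : (0 <= Lp_norm p f)%E.
Proof. exact: Lnorm_ge0. Qed.

Lemma lee_poweR (q : R) (x y : \bar R) : 0 <= q -> (0 <= x)%E -> (x <= y)%E -> (x `^ q <= y `^ q)%E.
Proof.
move=> q0 x0 xy; apply: (gt0_ler_poweR q0) => //; rewrite in_itv/= leey andbT//.
exact: le_trans xy.
Qed.

Lemma pnorm_le_Lp_norm p g h : 2 <= p -> expdecay g -> continuous h ->
  (forall x, `|g x| <= `|h x|) -> ((pnorm p g)%:E <= Lp_norm p%:E h)%E.
Proof.
move=> p2 eg ch gh; have p0 : 0 < p by rewrite (lt_le_trans _ p2).
have i0 (k : R -> R) : (0 <= \int[mu]_x (`|k x| `^ p)%:E)%E.
  by apply: integral_ge0 => x _; rewrite lee_fin powR_ge0.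
rewrite (Lp_normE _ p0) /pnorm -poweR_EFin -(EFin_pint p2 eg).
apply: lee_poweR; [by rewrite invr_ge0 ltW|exact: i0|].
apply: ge0_le_integral => //.
- by apply/measurable_EFinP; apply: measurable_norm_powR; case: eg.
- by apply/measurable_EFinP; exact: measurable_norm_powR.
- by move=> x _; rewrite lee_fin; apply: ge0_ler_powR; rewrite ?nnegrE// ltW.
Qed.

Lemma truncated_weight_le (n m : R) phi x : n <= m ->
  truncated_weight n phi x <= truncated_weight m phi x.
Proof.
move=> nm; rewrite /truncated_weight le_min !ge_min lexx/=.
by apply/orP; right; rewrite ler_wpM2r// expR_ge0.
Qed.

Lemma truncated_weight_eventually phi x : \forall n \near \oo,
  truncated_weight n.+1%:R phi x = phi x.
Proof.
near=> n; apply: min_l; rewrite -ler_pdivrMr ?expR_gt0//.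
apply: (@le_trans _ _ n%:R); last by rewrite ler_nat.
by near: n; exact: nbhs_infty_ger.
Unshelve. all: by end_near. Qed.

(** Monotone convergence: the truncated weights increase with [n] and equal [phi] at each point for
    large [n]. *)
Lemma Lp_norm_truncated_le p f (phi : R -> R) a : 2 <= p -> continuous f -> continuous phi ->
  (forall x, 0 < phi x) -> (forall n, expdecay (fun x => f x * truncated_weight n.+1%:R phi x)) ->
  (forall n, pnorm p (fun x => f x * truncated_weight n.+1%:R phi x) <= a) ->
  (Lp_norm p%:E (fun x => (f x * phi x)%R) <= a%:E)%E.
Proof.
move=> p2 cf cphi phi0 ef fa; have p0 : 0 < p by rewrite (lt_le_trans _ p2).
have a0 : 0 <= a by apply: le_trans (fa 0%N); exact: pnorm_ge0.
rewrite Lp_normE//.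
pose G n x : \bar R := (`|f x * truncated_weight n.+1%:R phi x| `^ p)%:E.
have lim x : limn (G^~ x) = (`|f x * phi x| `^ p)%:E.
  apply: lim_near_cst => //.
  by apply: filterS (truncated_weight_eventually phi x) => n; rewrite /G => ->.
have tw0 n x : 0 <= truncated_weight n.+1%:R phi x.
  by rewrite /truncated_weight le_min ltW//= mulr_ge0// expR_ge0.
have cvg : (\int[mu]_x G n x)%E @[n --> \oo] --> (\int[mu]_x (`|f x * phi x| `^ p)%:E)%E.
  under eq_integral => x _ do rewrite -lim.
  apply: cvg_monotone_convergence => //.
  - move=> n; apply/measurable_EFinP; apply: continuous_measurable_fun.
    by case: (expdecay_norm_powR p2 (ef n)).
  - by move=> n x _; rewrite lee_fin powR_ge0.
  - move=> x _ n m nm; rewrite lee_fin; apply: ge0_ler_powR; rewrite ?nnegrE ?(ltW p0)//.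
    rewrite !normrM ler_wpM2l// !ger0_norm//; apply: truncated_weight_le.
    by rewrite ler_nat ltnS.
have ia : (\int[mu]_x (`|f x * phi x| `^ p)%:E <= (a `^ p)%:E)%E.
  rewrite -(cvg_lim _ cvg)//; apply: lime_le; first by apply/cvg_ex; eexists; exact: cvg.
  apply: nearW => n; rewrite EFin_pint// lee_fin; exact: pint_le_pnorm.
have -> : a%:E = ((a `^ p)%:E `^ p^-1)%E.
  by rewrite poweR_EFin -powRrM mulfV ?gt_eqF// powRr1.
apply: lee_poweR ia; first by rewrite invr_ge0 ltW.
by apply: integral_ge0 => x _; rewrite lee_fin powR_ge0.
Qed.
(** Each norm passes to the limit separately, but only their sum is bounded. By monotonicity in the
    truncation the bound holds with independent indices [n] and [m], so [S] can be split at the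
    supremum of the first norms. *)
Lemma energy_Lp_bound T (M : R) u p (L k0 lam : R) (V phi : R -> R) :
  regular_solution T M u -> 2 <= p -> 0 < L -> continuous phi -> (forall x, 0 < phi x) ->
  (forall n, expdecay (truncated_weight n.+1%:R phi)) ->
  (forall n x, 0 < truncated_weight n.+1%:R phi x) ->
  (forall n, moderate_weight L k0 V (truncated_weight n.+1%:R phi)) ->
  (L * expR 2 + 2) * M + (2 * k0 + 1) * M < lam ->
  forall t, 0 <= t <= T -> forall a b : R,
  (Lp_norm p%:E (fun x => (u 0 x * phi x)%R) <= a%:E)%E ->
  (Lp_norm p%:E (fun x => (derive1 (u 0) x * phi x)%R) <= b%:E)%E ->
  (Lp_norm p%:E (fun x => (u t x * phi x)%R) +
   Lp_norm p%:E (fun x => (derive1 (u t) x * phi x)%R) <= ((a + b) * expR (lam * t))%:E)%E.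
Proof.
move=> hu p2 L0 cphi phi0 ew w0 mw Mlam t tT a b ua ub.
have T0 : (0 : R) <= 0 <= T by rewrite lexx; case/andP: tT; exact: le_trans.
pose w n := truncated_weight n.+1%:R phi.
have wphi n x : w n x <= phi x by rewrite /w /truncated_weight ge_min lexx.
have start n : energy u p (w n) 0 <= a + b.
  have below (g : R -> R) (c : R) : bcont g -> (Lp_norm p%:E (fun x => (g x * phi x)%R) <= c%:E)%E ->
      pnorm p (fun x => g x * w n x) <= c.
    move=> bg gc; rewrite -lee_fin; apply: le_trans gc; apply: pnorm_le_Lp_norm => //.
    - exact: bcont_expdecay bg (ew n).
    - by apply: continuous_mul => //; case: bg.
    - move=> x; rewrite !normrM (gtr0_norm (phi0 x)) (gtr0_norm (w0 n x)).
      by apply: ler_wpM2l => //; exact: wphi.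
  apply: lerD; first exact: below (regular_bcont hu T0) ua.
  exact: below (regular_bcont_derive1 hu T0) ub.
set S := (a + b) * expR (lam * t).
have nS n : energy u p (w n) t <= S.
  apply: le_trans (energy_gronwall_expdecay hu p2 L0 (ew n) (w0 n) (mw n) Mlam tT) _.
  exact: (ler_wpM2r (expR_ge0 _) (start n)).
pose y n := pnorm p (fun x => u t x * w n x).
pose z n := pnorm p (fun x => derive1 (u t) x * w n x).
have bu := regular_bcont hu tT; have bx := regular_bcont_derive1 hu tT.
have mono (g : R -> R) : bcont g -> {homo (fun n => pnorm p (fun x => g x * w n x)) : n m / (n <= m)%N >-> n <= m}.
  move=> bg n m nm; apply: pnorm_le => //; [exact: bcont_expdecay bg (ew n)|exact: bcont_expdecay bg (ew m)|].
  move=> x; rewrite !normrM (gtr0_norm (w0 n x)) (gtr0_norm (w0 m x)); apply: ler_wpM2l => //.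
  by apply: truncated_weight_le; rewrite ler_nat ltnS.
have yz n m : y n + z m <= S.
  apply: le_trans (nS (maxn n m)); apply: lerD; first exact: mono (leq_maxl n m).
  exact: mono (leq_maxr n m).
have hy : has_sup (range y) by split; [exists (y 0%N); exists 0%N|
  exists (S - z 0%N) => _ [n _ <-]; rewrite lerBrDr].
have ysup n : y n <= sup (range y) by apply: ub_le_sup; [case: hy|exists n].
have zS n : z n <= S - sup (range y).
  rewrite lerBrDl -lerBrDr; apply: ge_sup; first by case: hy.
  by move=> _ [m _ <-]; rewrite lerBrDr.
have -> : S%:E = ((sup (range y))%:E + (S - sup (range y))%:E)%E.
  by rewrite -EFinD addrC subrK.
apply: leeD; apply: Lp_norm_truncated_le => //.
- by case: bu.
- by move=> n; exact: bcont_expdecay bu (ew n).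
- by case: bx.
- by move=> n; exact: bcont_expdecay bx (ew n).
Qed.

(** On the left the sup norms are replaced by values at two independent points. At a fixed
    truncation the energy estimate for finite [p] loses only factors [e^(K/p)] with [K] independent
    of [p], so [p] goes to infinity before [n] does; for large [n] the truncated weight agrees with
    [phi] at both points. *)
Lemma energy_sup_bound T (M : R) u (L k0 lam : R) (V phi : R -> R) :
  regular_solution T M u -> 0 < L -> continuous phi -> (forall x, 0 < phi x) ->
  (forall n, expdecay (truncated_weight n.+1%:R phi)) ->
  (forall n x, 0 < truncated_weight n.+1%:R phi x) ->
  (forall n, moderate_weight L k0 V (truncated_weight n.+1%:R phi)) ->
  (L * expR 2 + 2) * M + (2 * k0 + 1) * M < lam ->
  forall t, 0 <= t <= T -> forall a b : R, 0 <= a -> 0 <= b ->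
  (Lp_norm +oo (fun x => (u 0 x * phi x)%R) <= a%:E)%E ->
  (Lp_norm +oo (fun x => (derive1 (u 0) x * phi x)%R) <= b%:E)%E ->
  (Lp_norm +oo (fun x => (u t x * phi x)%R) +
   Lp_norm +oo (fun x => (derive1 (u t) x * phi x)%R) <= ((a + b) * expR (lam * t))%:E)%E.
Proof.
move=> hu L0 cphi phi0 ew w0 mw Mlam t tT a b a0 b0 ua ub.
have T0 : (0 : R) <= 0 <= T by rewrite lexx; case/andP: tT; exact: le_trans.
pose w n := truncated_weight n.+1%:R phi.
have wphi n x : w n x <= phi x by rewrite /w /truncated_weight ge_min lexx.
have E0 : 0 <= expR (lam * t) by exact: expR_ge0.
have bounded (g : R -> R) (c : R) : bcont g -> (Lp_norm +oo (fun x => (g x * phi x)%R) <= c%:E)%E ->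
    forall n x, `|g x * w n x| <= c.
  move=> [cg _] gc n x; rewrite -lee_fin; apply: le_trans gc.
  apply: le_trans (le_Lp_norm_oo x (continuous_mul cg cphi)).
  rewrite lee_fin !normrM (gtr0_norm (phi0 x)) (gtr0_norm (w0 n x)).
  by apply: ler_wpM2l => //; exact: wphi.
have bu0 := regular_bcont hu T0; have bx0 := regular_bcont_derive1 hu T0.
have bu := regular_bcont hu tT; have bx := regular_bcont_derive1 hu tT.
have key n x y c1 c2 : c1 < `|u t x * w n x| -> c2 < `|derive1 (u t) y * w n y| ->
    c1 + c2 <= (a + b) * expR (lam * t).
  move=> h1 h2; apply/ler_addgt0Pr => eta eta0.
  (* The slack [q] makes [a + q] and [b + q] positive, as [pnorm_upper] requires, and costs
     [2 q e^(lam t) = eta] altogether. *)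
  have eta1 : 0 < eta / 2 / expR (lam * t) by rewrite !divr_gt0// expR_gt0.
  set q := eta / 2 / expR (lam * t) in eta1.
  have qE : q * expR (lam * t) = eta / 2 by rewrite /q divfK// gt_eqF// expR_gt0.
  have aq x' : `|u 0 x' * w n x'| <= a + q.
    by rewrite (le_trans (bounded _ _ bu0 ua n x'))// lerDl ltW.
  have bq x' : `|derive1 (u 0) x' * w n x'| <= b + q.
    by rewrite (le_trans (bounded _ _ bx0 ub n x'))// lerDl ltW.
  have [K1 K10 K1P] := pnorm_upper (bcont_expdecay bu0 (ew n)) (ltr_wpDl a0 eta1) aq.
  have [K2 K20 K2P] := pnorm_upper (bcont_expdecay bx0 (ew n)) (ltr_wpDl b0 eta1) bq.
  have [l1 l10 l1P] := pnorm_lower (bcont_expdecay bu (ew n)) h1.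
  have [l2 l20 l2P] := pnorm_lower (bcont_expdecay bx (ew n)) h2.
  pose k := K1 + K2; pose l := l1 + l2.
  have X0 : 0 <= (a + b + (q + q)) * expR (lam * t).
    by rewrite mulr_ge0// !addr_ge0// ltW.
  have -> : (a + b) * expR (lam * t) + eta = (a + b + (q + q)) * expR (lam * t).
    by rewrite [RHS]mulrDl mulrDl [(q + q) * _]mulrDl qE -splitr.
  apply: le_of_expR_small => // e e0 _.
  (* Large enough for the combined loss [expR ((k + l) / p)] to be at most [expR e]. *)
  pose p := 2 + (k + l) / e.
  have kl : 0 <= k + l by rewrite !addr_ge0.
  have p2 : 2 <= p by rewrite lerDl divr_ge0// ltW.
  have p0 : 0 < p by rewrite (lt_le_trans _ p2).
  have ple : (k + l) / p <= e.
    by rewrite ler_pdivrMr// mulrC -ler_pdivrMr// lerDr.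
  have leE (s s' c : R) : 0 <= c -> s <= s' -> expR (s / p) * c <= expR (s' / p) * c.
    by move=> c0 ss; rewrite ler_wpM2r// ler_expR ler_wpM2r// invr_ge0 ltW.
  have low : c1 + c2 <= expR (l / p) * energy u p (w n) t.
    rewrite mulrDr; apply: lerD; [apply: le_trans (l1P p p2) _|apply: le_trans (l2P p p2) _];
      by apply: leE; rewrite ?pnorm_ge0// ?lerDl ?lerDr.
  have up : energy u p (w n) 0 <= expR (k / p) * (a + b + (q + q)).
    rewrite addrACA mulrDr; apply: lerD; [apply: le_trans (K1P p p2) _|apply: le_trans (K2P p p2) _];
      by apply: leE; rewrite ?addr_ge0 ?(ltW eta1)// ?lerDl ?lerDr.
  have gr := energy_gronwall_expdecay hu p2 L0 (ew n) (w0 n) (mw n) Mlam tT.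
  have l0 : 0 <= expR (l / p) by exact: expR_ge0.
  apply: le_trans low _; apply: le_trans (ler_wpM2l l0 gr) _.
  apply: le_trans (ler_wpM2l l0 (ler_wpM2r E0 up)) _.
  rewrite !mulrA -expRD -mulrDl [l + k]addrC -!mulrA; apply: ler_wpM2r => //.
  by rewrite ler_expR.
set S := (a + b) * expR (lam * t) in key *.
have pt x y : `|u t x * phi x| + `|derive1 (u t) y * phi y| <= S.
  near \oo => n.
  have -> : phi x = w n x by rewrite /w; near: n; apply: filterS (truncated_weight_eventually phi x) => n ->.
  have -> : phi y = w n y by rewrite /w; near: n; apply: filterS (truncated_weight_eventually phi y) => n ->.
  apply/ler_addgt0Pr => e e0; have e2 : 0 < e / 2 by rewrite divr_gt0.
  rewrite -lerBlDr [e]splitr opprD addrACA.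
  by apply: (key n x y); rewrite gtrBl.
have ux_ge y : (Lp_norm +oo (fun x => (u t x * phi x)%R) <= (S - `|derive1 (u t) y * phi y|)%:E)%E.
  by apply: Lp_norm_oo_le => x; rewrite lee_fin lerBrDr.
have := ux_ge; have := Lp_norm_ge0 +oo (fun x => (u t x * phi x)%R).
case: (Lp_norm +oo (fun x => (u t x * phi x)%R)) => [r _ h|_ h|//]; last first.
  by have := h 0; rewrite leye_eq.
have -> : S%:E = (r%:E + (S - r)%:E)%E by rewrite -EFinD addrC subrK.
apply: leeD => //; apply: Lp_norm_oo_le => y; rewrite lee_fin lerBrDr addrC -lerBrDr -lee_fin.
exact: h.
Unshelve. all: by end_near. Qed.

(** * Pointwise regularity of strong solutions *)

Lemma bcont_of_bound f (B : R) : (forall x, derivable f x 1) -> (forall x, `|f x| <= B) -> bcont f.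
Proof.
by move=> df fB; split; [move=> x; exact/differentiable_continuous/derivable1_diffP|exists B].
Qed.

(** Compactness in time gives the uniform bounds that make [M] finite. Since [u] and [u_x] are
    continuous in [x], their essential suprema bound them everywhere, so [fine M] itself can serve
    as the pointwise constant. *)
Lemma strong_solution_regular T (s : R) u0 u : 0 < T -> 3 / 2 < s ->
  CH_strong_solution T s u0 u ->
  let M := ereal_sup [set (Lp_norm +oo (u t) + Lp_norm +oo (derive1 (u t)))%E
                     | t in [set` `[0, T]]] in
  (M < +oo)%E /\ regular_solution T (fine M) u.
Proof.
move=> T0 s32 [uC [u00 [du ut]]] M.
have [reg unif] := C_Hs_regular s32 uC du.
have [B1 uB1] : exists B : R, forall t x, 0 <= t <= T -> `|u t x| <= B.
  apply: locally_bounded_bounded; first exact: ltW.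
    by move=> t /reg[_ [B uB]]; exists B => x; case: (uB x).
  move=> t0 t0T; have [d d0 dP] := unif _ t0T _ ltr01.
  by exists d => // t tT td x; case: (dP _ tT td x).
have [B2 uB2] : exists B : R, forall t x, 0 <= t <= T -> `|derive1 (u t) x| <= B.
  apply: (@locally_bounded_bounded _ T (fun t => derive1 (u t))); first exact: ltW.
    by move=> t /reg[_ [B uB]]; exists B => x; case: (uB x).
  move=> t0 t0T; have [d d0 dP] := unif _ t0T _ ltr01.
  by exists d => // t tT td x; case: (dP _ tT td x).
have cu t : 0 <= t <= T -> continuous (u t).
  by move=> tT x; exact/differentiable_continuous/derivable1_diffP/du.
have TT : (0 : R) <= 0 <= T by rewrite lexx ltW.
have MB : (M <= (B1 + B2)%:E)%E.
  apply: ge_ereal_sup => y [t /=]; rewrite in_itv/= => tT <-; rewrite EFinD.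
  by apply: leeD; apply: Lp_norm_oo_le => x; rewrite lee_fin; [exact: uB1|exact: uB2].
have Mge t : 0 <= t <= T -> (Lp_norm +oo (u t) + Lp_norm +oo (derive1 (u t)) <= M)%E.
  by move=> tT; apply: ereal_sup_ubound; exists t => //=; rewrite in_itv.
have M0 : (0 <= M)%E by apply: le_trans (Mge 0 TT); rewrite adde_ge0// Lp_norm_ge0.
have Mfin : (M < +oo)%E by rewrite (le_lt_trans MB)// ltry.
have MfinE : M = (fine M)%:E by rewrite fineK// ge0_fin_numE.
split; [exact: Mfin|split].
- by move=> t tT x; split; [exact: du|rewrite derive1E].
- move=> t tT x; rewrite -!lee_fin -MfinE; split; apply: le_trans (Mge t tT).
    by apply: le_trans (le_Lp_norm_oo x (cu t tT)) _; rewrite leeDl// Lp_norm_ge0.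
  by apply: le_trans (le_Lp_norm_oo x (reg t tT).1) _; rewrite leeDr// Lp_norm_ge0.
- by move=> t /reg[].
- exact: unif.
- move=> t t0T x.
  have tT : 0 <= t <= T by case/andP: t0T => /ltW -> /ltW ->.
  have b1 := bcont_of_bound (du t tT) (fun x => uB1 t x tT).
  have b2 : bcont (derive1 (u t)) by split; [exact: (reg t tT).1|exists B2 => y; exact: uB2].
  have bF : bcont (F_CH (u t)) := bcontD (bcontM b1 b1) (bcontZ 2^-1 (bcontM b2 b2)).
  by have := ut t t0T x; rewrite (is_derive1E (is_derive_conv x bF)).
Qed.

End camassa_holm.

(** * Persistence of the weighted norms *)

Unset Implicit Arguments.

Theorem theorem2p1 (R : realType) (A C0 m I : R) :
  exists2 C : R, 0 < C &
  forall v phi : R -> R,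
    admissible_CH phi v A C0 ->
    inf (range v) = m ->
    (\int[@lebesgue_measure R]_x (v x * expR (- `|x|))%:E = I%:E)%E ->
  forall (T s : R) (p : \bar R) (u0 : R -> R) (u : R -> R -> R),
    0 < T -> 3 / 2 < s -> (2%:E <= p)%E ->
    CH_strong_solution T s u0 u ->
    (Lp_norm p (fun x => (u0 x * phi x)%R) < +oo)%E ->
    (Lp_norm p (fun x => (derive1 u0 x * phi x)%R) < +oo)%E ->
    let M := ereal_sup [set (Lp_norm +oo (u t) + Lp_norm +oo (derive1 (u t)))%E
                       | t in `[0, T]] in
    (M < +oo)%E /\
    forall t, 0 <= t <= T ->
      (Lp_norm p (fun x => (u t x * phi x)%R) +
       Lp_norm p (fun x => (derive1 (u t) x * phi x)%R)
       <= (Lp_norm p (fun x => (u0 x * phi x)%R) +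
           Lp_norm p (fun x => (derive1 u0 x * phi x)%R))
          * (expR (C * fine M * t))%:E)%E.
Proof.
(* [C] is fixed before the signs of [A], [C0] and [I] are known, hence the absolute values. [L] is
   the logarithmic Lipschitz constant of the truncated weights, and [k0] the integral of the kernel
   times [moderate_bound]. *)
pose L := `|A| + 1; pose k0 := 2^-1 * (`|C0| * `|I|) + 2.
have L0 : 0 < L by rewrite ltr_wpDl.
have k00 : 0 <= k0 by rewrite addr_ge0// mulr_ge0 ?invr_ge0// mulr_ge0.
have B0 : 0 <= L * expR 2 by rewrite mulr_ge0 ?expR_ge0 ?(ltW L0).
pose D := L * expR 2 + 2 + (2 * k0 + 1).
have D0 : 0 <= D by rewrite !addr_ge0// mulr_ge0.
(* [D] adds the growth rate [L e^2 + 2] and the source rate [2 k0 + 1]; the further 1 provides the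
   strict inequality of the Gronwall lemma. *)
exists (D + 1); first by rewrite ltr_wpDl.
move=> v phi [acphi [A0 [aephi [[cv [v0 _]] [[C00 [cphi [phi0 phimod]]] _]]]]] _ vI.
move=> T s p u0 u T0 s32 p2 sol n0 n1 M.
have [Mfin hu] := strong_solution_regular T0 s32 sol.
split=> // t tT; have u00 : u 0 = u0 by case: sol => _ [].
rewrite -u00 in n0 n1 *.
have T00 : (0 : R) <= 0 <= T by rewrite lexx ltW.
have I0 : 0 <= I.
  by rewrite -lee_fin -vI integral_ge0// => x _; rewrite lee_fin mulr_ge0 ?expR_ge0.
have AE : `|A| = A by rewrite gtr0_norm.
have phiA x y : phi x <= expR (A * `|x - y|) * phi y.
  exact: (abs_cont_exp_bound x y cphi phi0 acphi (ltW A0) aephi).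
have n1R n : (0 : R) < n.+1%:R by rewrite ltr0n.
have tw n := truncated_weightP (n1R n) (ltW A0) cphi phi0 v0 (ltW C00) phiA phimod.
have ew n : expdecay (truncated_weight n.+1%:R phi) by case: (tw n).
have w0 n x : 0 < truncated_weight n.+1%:R phi x by case: (tw n).
have mw n : moderate_weight L k0 (moderate_bound C0 v) (truncated_weight n.+1%:R phi).
  case: (tw n) => _ _ h1 h2; split=> //.
  - by move=> x y; rewrite /L AE; exact: h1.
  - exact: continuous_moderate_bound.
  - by move=> x; rewrite addr_ge0 ?expR_ge0// mulr_ge0 ?(ltW C00).
  - by rewrite (integral_Gker_moderate_bound cv v0 (ltW C00) vI) lee_fin /k0 !ger0_norm ?(ltW C00).
have M0 : 0 <= fine M by exact: regular_M_ge0 hu (ltW T0).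
have uM := let: And5 _ h _ _ _ := hu in h t tT.
have rhs0 : (0 <= (Lp_norm p (fun x => (u 0 x * phi x)%R) +
    Lp_norm p (fun x => (derive1 (u 0) x * phi x)%R)) * (expR ((D + 1) * fine M * t))%:E)%E.
  by rewrite mule_ge0 ?adde_ge0 ?Lp_norm_ge0// lee_fin expR_ge0.
(* At [M = 0] the two rates coincide and strictness fails, but then [u] and [u_x] vanish and so does
   the left-hand side. *)
have [Meq0|Mpos] := eqVneq (fine M) 0.
  have zero (g : R -> R) : (forall x, `|g x| <= fine M) -> Lp_norm p (fun x => (g x * phi x)%R) = 0%E.
    move=> gM; rewrite (_ : (fun x => _) = cst 0%R).
      by rewrite /Lp_norm Lnorm0// gt_eqF// (lt_le_trans _ p2)// lte_fin.
    by apply/funext => x; have := gM x; rewrite Meq0 normr_le0 => /eqP ->; rewrite mul0r.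
  apply: le_trans rhs0.
  by rewrite (zero _ (fun x => (uM x).1)) (zero _ (fun x => (uM x).2)) add0e.
have {}Mpos : 0 < fine M by rewrite lt0r Mpos.
have Mlam : (L * expR 2 + 2) * fine M + (2 * k0 + 1) * fine M < (D + 1) * fine M.
  by rewrite -mulrDl ltr_pM2r// -/D ltrDl.
have fin g : (Lp_norm p g < +oo)%E -> Lp_norm p g = (fine (Lp_norm p g))%:E.
  by move=> gfin; rewrite fineK// ge0_fin_numE// Lp_norm_ge0.
have f0 g : 0 <= fine (Lp_norm p g) by rewrite fine_ge0// Lp_norm_ge0.
have le g : (Lp_norm p g < +oo)%E -> (Lp_norm p g <= (fine (Lp_norm p g))%:E)%E.
  by move=> /fin {1}->.
rewrite (fin _ n0) (fin _ n1) -EFinD -EFinM.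
have := le _ n1; have := le _ n0.
case: p p2 f0 {n0 n1 rhs0 fin le} => [r||//] p2 f0 h0 h1.
  exact: (energy_Lp_bound hu p2 L0 cphi phi0 ew w0 mw Mlam tT).
exact: (energy_sup_bound hu L0 cphi phi0 ew w0 mw Mlam tT).
Qed.
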